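(* For every $n$ there exist an $n$-vertex plane graph $G$, a planar drawing $\mathcal{H}$ of the empty spanning subgraph $H=(V(G),\emptyset)$ of $G$, and an ordering $\sigma$ of the edges of $G$ such that every drawing of $G$ that greedily extends $\mathcal{H}$ with respect to $\sigma$ has an edge with $2^{\Omega(n)}$ bends.
   Context: Let $G$ be a plane graph (a planar graph with a fixed planar embedding), $H$ a spanning subgraph with a fixed straight-line planar drawing $\mathcal{H}$, and $\sigma=[e_1,\dots,e_m]$ an ordering of the edges of $G$ not in $H$. A drawing $\Gamma$ of $G$ greedily extends $\mathcal{H}$ with respect to $\sigma$ if it is obtained from $\mathcal{H}$ by drawing $e_1,\dots,e_m$ in this order, each $e_i$ as a polygonal curve that respects the embedding of $G$ (and is planar with respect to what is already drawn) and has the minimum possible number of bends given the previously drawn edges. *)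

(* Defs.v *)
From HB Require Import structures.
From mathcomp Require Import all_boot all_order all_algebra.
From mathcomp Require Import all_classical all_reals all_analysis.
Set Implicit Arguments. Unset Strict Implicit. Unset Printing Implicit Defensive.
Import Order.TTheory GRing.Theory Num.Theory.
Import numFieldNormedType.Exports.
Local Open Scope classical_set_scope.
Local Open Scope ring_scope.

Section Drawings.
Variable R : realType.

Local Notation point := (R * R)%type.

Definition seg (a b : point) : set point :=
  [set p | exists t : R, 0 <= t <= 1 /\
     p = ((1 - t) * a.1 + t * b.1, (1 - t) * a.2 + t * b.2)].

Definition polyline (s : seq point) : set point :=
  [set p | exists i : nat, (i.+1 < size s)%N /\
     seg (nth (0, 0) s i) (nth (0, 0) s i.+1) p].

Definition simple_polyline (s : seq point) : Prop :=
  (2 <= size s)%N /\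
  (forall i : nat, (i.+1 < size s)%N -> nth (0, 0) s i != nth (0, 0) s i.+1) /\
  (forall i j : nat, (i < j)%N -> (j.+1 < size s)%N ->
     let Si := seg (nth (0, 0) s i) (nth (0, 0) s i.+1) in
     let Sj := seg (nth (0, 0) s j) (nth (0, 0) s j.+1) in
     (j = i.+1 -> Si `&` Sj = [set nth (0, 0) s j]) /\
     ((i.+1 < j)%N -> Si `&` Sj = set0)).

Variable n : nat.
Definition vertex := 'I_n.
(* An edge {u,v} of a simple graph on vertex set 'I_n, stored as (u,v), u < v. *)
Definition edge := (vertex * vertex)%type.

Definition edge_seq (E : seq edge) : Prop :=
  uniq E /\ forall e, e \in E -> (e.1 < e.2)%N.

(* Vertex positions pos, bend lists b: edge e drawn as the polyline
   pos e.1, (bends of e), pos e.2 ; the number of bends is size (b e). *)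
Definition edge_pts (pos : vertex -> point) (b : edge -> seq point) (e : edge) :=
  pos e.1 :: rcons (b e) (pos e.2).

Definition curve (pos : vertex -> point) (b : edge -> seq point) (e : edge) :=
  polyline (edge_pts pos b e).

Definition planar_drawing (pos : vertex -> point) (E : seq edge)
    (b : edge -> seq point) : Prop :=
  injective pos /\
  (forall e, e \in E -> simple_polyline (edge_pts pos b e)) /\
  (forall e v, e \in E -> curve pos b e (pos v) -> v = e.1 \/ v = e.2) /\
  (forall e f, e \in E -> f \in E -> e != f ->
     forall p, curve pos b e p -> curve pos b f p -> exists v, p = pos v).

(* Ambient isotopies of the plane: h 0 = id, every h t is a homeomorphism,
   and h is jointly continuous.  The time-1 maps are exactly the
   orientation-preserving homeomorphisms of the plane. *)
Definition ambient_isotopy (h : R -> point -> point) : Prop :=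
  continuous (fun tp : R * point => h tp.1 tp.2) /\
  h 0 = id /\
  (forall t, exists g : point -> point,
     cancel (h t) g /\ cancel g (h t) /\ continuous (h t) /\ continuous g).

(* The drawing (pos, b) of the subgraph with edge list E has the same plane
   embedding as the restriction to E of the reference drawing (pos0, b0)
   (which fixes the embedding of the plane graph G). *)
Definition respects_embedding (pos0 : vertex -> point) (b0 : edge -> seq point)
    (pos : vertex -> point) (E : seq edge) (b : edge -> seq point) : Prop :=
  exists h, ambient_isotopy h /\
    (forall v, h 1 (pos0 v) = pos v) /\
    (forall e, e \in E -> h 1 @` curve pos0 b0 e = curve pos b e).

Definition valid_partial (pos0 : vertex -> point) (b0 : edge -> seq point)
    (pos : vertex -> point) (E : seq edge) (b : edge -> seq point) : Prop :=
  planar_drawing pos E b /\ respects_embedding pos0 b0 pos E b.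

Definition upd_bends (b : edge -> seq point) (e : edge) (s : seq point) :=
  fun f => if f == e then s else b f.

(* Drawing with bend lists b greedily extends the drawing pos of the empty
   spanning subgraph w.r.t. the order sigma of the edges of the plane graph
   G = (('I_n, sigma), embedding given by (pos0, b0)): each sigma_i is drawn
   so that the partial drawing is planar and respects the embedding, with the
   minimum possible number of bends given the previously drawn edges. *)
Definition greedy_extension (pos0 : vertex -> point) (b0 : edge -> seq point)
    (pos : vertex -> point) (sigma : seq edge) (b : edge -> seq point) : Prop :=
  forall (E1 E2 : seq edge) (e : edge), sigma = E1 ++ e :: E2 ->
    (valid_partial pos0 b0 pos (rcons E1 e) b /\
     (forall s : seq point,
        valid_partial pos0 b0 pos (rcons E1 e) (upd_bends b e s) ->
        (size (b e) <= size s)%N)).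

End Drawings.

(* Main.v *)
Require Import Defs.
From HB Require Import structures.
From mathcomp Require Import all_boot all_order all_algebra.
From mathcomp Require Import all_classical all_reals all_analysis.
From mathcomp Require Import ring lra zify.
Set Implicit Arguments. Unset Strict Implicit. Unset Printing Implicit Defensive.
Import Order.TTheory GRing.Theory Num.Theory.
Import numFieldNormedType.Exports.

(* The vertices bound a rectangular room with floor points w_1, ..., w_k, and vertex v_i is to be
   joined to w_i inside the room. The drawing is arranged so that the first edge runs from the floor
   to above a horizontal gate and that v_(i+1) sits between w_i and w_(i-1), on the wrong side of the
   edge of w_i. Number the strands in which the first i edges cross the gate from left to right.
   Closing up the next edge below the floor gives a polygon that has w_i on one side and every
   earlier w_m and the walls on the other; by the even-odd rule consecutive strands lie on different
   sides, so the next edge passes through each of the 2^i gaps, and has at least 2^i segments. This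
   many segments do suffice, namely by following the previous strands at a small distance. Since the
   greedy edge has as few segments as possible, each of its segments crosses the gate once; its bends
   then have to enclose the old strands in the canonical way, which reproduces the same configuration
   with i + 1 in place of i. All partial drawings respect the embedding, because pendant curves can be
   retracted into short segments at their feet by ambient isotopies of the room. *)

(** The greedy drawing is not unique, so the induction cannot follow explicit coordinates. It
    carries the record [arr], which holds for whatever was drawn and records order and incidence:
    the order of the strands along the gate, which of them share an end, and where the free ends
    are. Sharing obeys two rules: above the gate, numbers with sum [2 ^ i]; below it, numbers
    strictly between [2 ^ j] and [2 ^ (j + 1)] with sum [3 * 2 ^ j]. The blocks below arise because
    the strands numbered by powers of two run down to the floor, where no bend can enclose them. In
    the next numbering old strands become even and new ones odd, so all sums double and both rules
    persist; in particular the odd strands are exactly those of the last edge, which is what the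
    parity argument detects. The competing path hugs the old strands and touches them in the limit,
    so compactness alone does not keep it off them; near the contacts the signs of areas decide
    instead. Since every [v_i] has degree one, the embedding hardly restricts its edge: the rim
    confines it to the room, and nothing else is prescribed. *)

(** * Combinatorics of the order in which a new edge visits the gaps *)

(* Order in which edge number [s + 1] visits the gaps of the gate. *)
Fixpoint walk (s a : nat) : nat :=
  if s is s'.+1 then
    if a < 2 ^ s' then (if odd a then 2 * walk s' a + 1 else 2 * walk s' a - 1)
    else let b := 2 * 2 ^ s' - 1 - a in
      if odd b then 2 * walk s' b - 1 else 2 * walk s' b + 1
  else 1.

Lemma walkA s a : a < 2 ^ s -> walk s.+1 a = if odd a then 2 * walk s a + 1 else 2 * walk s a - 1.
Proof. by move=> /= ->. Qed.

Lemma walkB s a : 2 ^ s <= a -> walk s.+1 a = let b := 2 * 2 ^ s - 1 - a in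
  if odd b then 2 * walk s b - 1 else 2 * walk s b + 1.
Proof. by move=> h; rewrite /= ltnNge h. Qed.

Lemma walk0 s : walk s 0 = 1.
Proof. by elim: s => //= s ->; rewrite expn_gt0. Qed.

Lemma pow2 s : 0 < 2 ^ s.
Proof. by rewrite expn_gt0. Qed.

Lemma odd_pow2 s : odd (2 ^ s) = (s == 0).
Proof. by case: s => // s; rewrite expnS oddM. Qed.

Lemma walk_odd s a : a < 2 ^ s -> odd (walk s a) /\ 0 < walk s a < 2 ^ s.+1.
Proof.
elim: s a => [|s IH] a ha; first by [].
have p := pow2 s; rewrite !expnS in ha IH *.
have [lt|le] := ltnP a (2 ^ s).
  have [oa h] := IH a lt; rewrite walkA //; case: ifP => _; lia.
have [oa h] := IH (2 * 2 ^ s - 1 - a) ltac:(lia).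
by rewrite walkB // /=; case: ifP => _; lia.
Qed.

(** The return journey ends beside strand 1 of the old numbering, which becomes 2, on the side
    opposite to the start; the next vertex lies there. *)
Lemma walk_last s : walk s.+1 (2 ^ s.+1 - 1) = 3.
Proof.
have p := pow2 s; rewrite walkB ?expnS; last by lia.
by rewrite /= subnn walk0.
Qed.

(** Bends above the gate are nested about the middle strand [2 ^ s]. The recursion preserves this
    because the followers of two strands joined above run on opposite sides of them, so the
    corrections by 1 cancel in the sum. *)
Lemma walk_top s a : ~~ odd a -> a.+1 < 2 ^ s -> walk s a + walk s a.+1 = 2 ^ s.+1.
Proof.
elim: s a => [|s IH] a ea ha; first by move: ha; rewrite expn0; lia.
have p := pow2 s; have op := odd_pow2 s; rewrite expnS in ha; rewrite [2 ^ s.+2]expnS.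
case: (ltngtP a.+1 (2 ^ s)) => lt.
- have := IH a ea lt; rewrite !walkA //; try lia.
  have := @walk_odd s a ltac:(lia); rewrite /= ea (negbTE ea) /=; lia.
- rewrite !walkB; try lia.
  have e1 : 2 * 2 ^ s - 1 - a = (2 * 2 ^ s - 2 - a).+1 by lia.
  have e2 : 2 * 2 ^ s - 1 - a.+1 = 2 * 2 ^ s - 2 - a by lia.
  have od : ~~ odd (2 * 2 ^ s - 2 - a) by lia.
  have := IH _ od ltac:(lia); rewrite e1 e2 /= od (negbTE od) /=.
  have := @walk_odd s (2 * 2 ^ s - 2 - a).+1 ltac:(lia); lia.
(* The turn at the far end of the previous edge lies above the gate only for the second edge, which
   turns round [v_1]. *)
- have s0 : s = 0 by apply/eqP; rewrite -op -lt /=.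
  by subst s; have -> : a = 0 by move: lt; rewrite expn0; lia.
Qed.

(** Bends below the gate must not enclose a strand that runs to the floor. Those strands are
    numbered by powers of two, so the bends are nested within the blocks between them, each about
    the midpoint of its block. *)
Lemma walk_bot s a : odd a -> a.+1 < 2 ^ s -> exists j,
  2 ^ j < walk s a < 2 ^ j.+1 /\ walk s a + walk s a.+1 = 3 * 2 ^ j.
Proof.
elim: s a => [|s IH] a ea ha; first by move: ha; rewrite expn0; lia.
have p := pow2 s; have op := odd_pow2 s; rewrite expnS in ha.
case: (ltngtP a.+1 (2 ^ s)) => lt.
- have [j [h1 h2]] := IH a ea lt; exists j.+1.
  rewrite !walkA //; try lia.
  have := @walk_odd s a.+1 ltac:(lia); rewrite /= ea /= !expnS; rewrite !expnS in h1 h2; lia.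
- rewrite !walkB; try lia.
  have e1 : 2 * 2 ^ s - 1 - a = (2 * 2 ^ s - 2 - a).+1 by lia.
  have e2 : 2 * 2 ^ s - 1 - a.+1 = 2 * 2 ^ s - 2 - a by lia.
  have od : odd (2 * 2 ^ s - 2 - a) by lia.
  have [j [h1 h2]] := IH _ od ltac:(lia); rewrite e1 e2 /= od /=; exists j.+1.
  rewrite !expnS in h1 h2 *; lia.
(* The turn round the free end of the previous edge: its last strand is 3, so the new ones are 7 and
   5, with sum [3 * 2 ^ 2]. *)
- case: s IH ha p op lt => [|s] IH ha p op lt; first by move: lt; rewrite expn0; lia.
  have ea' : a = 2 ^ s.+1 - 1 by lia.
  rewrite (@walkA s.+1 a); last by lia.
  rewrite (@walkB s.+1 a.+1); last by lia.
  have e1 : 2 * 2 ^ s.+1 - 1 - a.+1 = a by lia.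
  have w3 : walk s.+1 a = 3 by rewrite ea' walk_last.
  by exists 2; cbv zeta; rewrite e1 ea w3.
Qed.

(** Since [x] and [y] are odd, [2 * x + 1 = 2 * y - 1] is impossible; a coincidence thus needs the
    same old strand, which is passed on opposite sides on the way out and back. *)
Lemma walk_inj s a b : a < 2 ^ s -> b < 2 ^ s -> walk s a = walk s b -> a = b.
Proof.
elim: s a b => [|s IH] a b ha hb; first by move: ha hb; rewrite expn0; lia.
have p := pow2 s; rewrite expnS in ha hb.
have W x (hx : x < 2 ^ s) := walk_odd hx.
have I x y (hx : x < 2 ^ s) (hy : y < 2 ^ s) := IH x y hx hy.
have [la|la] := ltnP a (2 ^ s); have [lb|lb] := ltnP b (2 ^ s).
- have i1 := I a b la lb; have w1 := W a la; have w2 := W b lb; rewrite !walkA //; case: ifP; case: ifP; lia.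
- have hb' : 2 * 2 ^ s - 1 - b < 2 ^ s by lia.
  have i1 := I a _ la hb'; have w1 := W a la; have w2 := W _ hb'; rewrite walkA // walkB //; cbv zeta.
  by case: ifP => o1; case: ifP => o2 e; exfalso; try lia;
    have e' := i1 ltac:(lia); rewrite e' in o1; rewrite o1 in o2.
- have ha' : 2 * 2 ^ s - 1 - a < 2 ^ s by lia.
  have i1 := I _ b ha' lb; have w1 := W b lb; have w2 := W _ ha'; rewrite (walkA lb) walkB //; cbv zeta.
  by case: ifP => o1; case: ifP => o2 e; exfalso; try lia;
    have e' := i1 ltac:(lia); rewrite e' in o1; rewrite o1 in o2.
- have ha' : 2 * 2 ^ s - 1 - a < 2 ^ s by lia.
  have hb' : 2 * 2 ^ s - 1 - b < 2 ^ s by lia.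
  have i1 := I _ _ ha' hb'; have w1 := W _ ha'; have w2 := W _ hb'; rewrite !walkB //; cbv zeta.
  case: ifP => o1; case: ifP => o2; lia.
Qed.

Lemma pow2_bracket d : 0 < d -> exists j, 2 ^ j <= d < 2 ^ j.+1.
Proof. by move=> d0; exists (trunc_log 2 d); apply: trunc_log_bounds. Qed.

Lemma pow2_uniq j j' d : 2 ^ j <= d < 2 ^ j.+1 -> 2 ^ j' <= d < 2 ^ j'.+1 -> j = j'.
Proof.
move=> /andP[h1 h2] /andP[h3 h4]; case: (ltngtP j j') => // jj.
  by have := leq_pexp2l (isT : 0 < 2) jj; lia.
by have := leq_pexp2l (isT : 0 < 2) jj; lia.
Qed.

Ltac nlia := repeat match goal with
  | H : is_true (leq _ _) |- _ => revert H
  | H : is_true (andb (leq _ _) (leq _ _)) |- _ => revert H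
  | H : @eq nat _ _ |- _ => revert H
  | H : @eq (Equality.sort Datatypes_nat__canonical__eqtype_Equality) ?x ?y |- _ =>
      change (@eq nat x y) in H; revert H
  | H : is_true (odd _) |- _ => revert H
  | H : is_true (negb (odd _)) |- _ => revert H
  | H : is_true (negb (@eq_op Datatypes_nat__canonical__eqtype_Equality _ _)) |- _ => revert H
  | H : not (@eq nat _ _) |- _ => revert H
  end; clear; intros; lia.

(** Keeps the two kinds of bends apart: two strands joined above the gate are never also joined
    below it. *)
Lemma pow2_neq3 a b : 2 ^ a <> 3 * 2 ^ b.
Proof.
case: (leqP a b) => h e.
  by have := leq_pexp2l (isT : 0 < 2) h; have := pow2 b; lia.
have : 2 ^ (a - b) * 2 ^ b = 3 * 2 ^ b by rewrite -expnD subnK // ltnW.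
move=> /eqP; rewrite eqn_pmul2r ?pow2 // => /eqP.
by case E : (a - b) => [|c]; rewrite ?expn0 ?expnS; lia.
Qed.

Local Open Scope classical_set_scope.
Local Open Scope ring_scope.

(** * Segments, sides of a line, and conditions valid for all small parameters *)

Section Segments.
Variable R : realType.
Local Notation pt := (R * R)%type.
Implicit Types (a b p q z u v : pt) (r s t : R).

Definition lerp a b t : pt := ((1 - t) * a.1 + t * b.1, (1 - t) * a.2 + t * b.2).

Lemma lerp0 a b : lerp a b 0 = a.
Proof. by case: a => ? ?; rewrite /lerp /=; congr (_, _); ring. Qed.

Lemma lerp1 a b : lerp a b 1 = b.
Proof. by case: b => ? ?; rewrite /lerp /=; congr (_, _); ring. Qed.

Lemma seg_lerp a b t : 0 <= t <= 1 -> seg a b (lerp a b t).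
Proof. by exists t. Qed.

Lemma seg_l a b : seg a b a.
Proof. by rewrite -{2}(lerp0 a b); apply: seg_lerp; rewrite lexx ler01. Qed.

Lemma seg_r a b : seg a b b.
Proof. by rewrite -{2}(lerp1 a b); apply: seg_lerp; rewrite lexx ler01. Qed.

Lemma lerp_sym a b t : lerp a b t = lerp b a (1 - t).
Proof. by rewrite /lerp; congr (_, _); ring. Qed.

Lemma seg_symI a b p : seg a b p -> seg b a p.
Proof.
by move=> [t [ht ->]]; exists (1 - t); split; [lra | rewrite -/(lerp _ _ _) lerp_sym].
Qed.

Lemma seg_sym a b : seg a b = seg b a.
Proof. by apply/seteqP; split=> p; apply: seg_symI. Qed.

Lemma lerp_lerp a b s t r : lerp (lerp a b s) (lerp a b t) r = lerp a b ((1 - r) * s + r * t).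
Proof. by rewrite /lerp /=; congr (_, _); ring. Qed.

Lemma seg_sub a b p q : seg a b p -> seg a b q -> seg p q `<=` seg a b.
Proof.
move=> [s [hs ->]] [t [ht ->]] _ [r [hr ->]].
rewrite -!/(lerp _ _ _) lerp_lerp; apply: seg_lerp; nra.
Qed.

Lemma segxx a p : seg a a p -> p = a.
Proof. by move=> [t [_ ->]]; case: a => x y /=; congr (_, _); ring. Qed.

(* Twice the signed area of the triangle [b], [v], [p]; for [b] below [v] it is
   positive exactly when [p] lies to the right of the line. *)
Definition sd b v p : R := (p.1 - b.1) * (v.2 - b.2) - (p.2 - b.2) * (v.1 - b.1).

Lemma sd_lerp b v p q t : sd b v (lerp p q t) = (1 - t) * sd b v p + t * sd b v q.
Proof. by rewrite /sd /lerp /=; ring. Qed.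

Lemma sd_l b v : sd b v b = 0.
Proof. by rewrite /sd; ring. Qed.

Lemma sd_r b v : sd b v v = 0.
Proof. by rewrite /sd; ring. Qed.

(** Validity for all sufficiently small positive parameters; finitely many such conditions can be
    met at once. *)
Definition small (P : R -> Prop) := exists e, 0 < e /\ forall d, 0 < d < e -> P d.

Lemma small_and P Q : small P -> small Q -> small (fun d => P d /\ Q d).
Proof.
move=> [e [e0 he]] [f [f0 hf]]; exists (Num.min e f); split; first by rewrite lt_min e0.
by move=> d /andP[d0]; rewrite lt_min => /andP[h1 h2]; split; [apply: he|apply: hf]; apply/andP.
Qed.

Lemma small_imp P Q : (forall d, 0 < d -> P d -> Q d) -> small P -> small Q.
Proof.
move=> h [e [e0 he]]; exists e; split=> // d hd; apply: h; last exact: he.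
by case/andP: hd.
Qed.

Lemma small_true (P : R -> Prop) : (forall d, 0 < d -> P d) -> small P.
Proof. by move=> h; exists 1; split=> // d /andP[d0 _]; apply: h. Qed.

Lemma small_all n (P : nat -> R -> Prop) :
  (forall i, (i < n)%N -> small (P i)) -> small (fun d => forall i, (i < n)%N -> P i d).
Proof.
elim: n => [|n IH] h; first exact: small_true.
have := small_and (IH (fun i hi => h i (ltnW hi))) (h n (ltnSn n)).
apply: small_imp => d _ [h1 h2] i; rewrite ltnS leq_eqVlt => /orP[/eqP->|] //.
exact: h1.
Qed.

Lemma small_ex P : small P -> exists d, 0 < d /\ P d.
Proof. by move=> [e [e0 he]]; exists (e / 2); split; [lra | apply: he; lra]. Qed.

Lemma small_lt (x y c : R) : x < y -> small (fun d => x + d * c < y).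
Proof.
move=> xy; exists ((y - x) / (1 + `|c|)).
have c0 : 0 < 1 + `|c| by have := normr_ge0 c; lra.
split; first by apply: divr_gt0 => //; lra.
move=> d /andP[d0]; rewrite ltr_pdivlMr // => h.
have := ler_norm c; nra.
Qed.

Lemma small_gt (x y c : R) : y < x -> small (fun d => y < x + d * c).
Proof.
move=> xy; have := @small_lt (- x) (- y) (- c).
by move=> /(_ ltac:(lra)); apply: small_imp => d _; lra.
Qed.

(** The distance is a continuous function on the compact square of parameters, and 0 is not among
    its values. *)
Lemma seg_dist p q p' q' : (forall z, seg p q z -> ~ seg p' q' z) ->
  exists r, 0 < r /\ forall z z', seg p q z -> seg p' q' z' ->
    r <= `|z.1 - z'.1| + `|z.2 - z'.2|.
Proof.
move=> dis.
pose f (st : R * R) : R := `|(lerp p q st.1).1 - (lerp p' q' st.2).1| +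
   `|(lerp p q st.1).2 - (lerp p' q' st.2).2|.
have fc : continuous f.
  move=> st; rewrite /f /lerp /=.
  have c1 : (fun x : R * R => x.1) @ st --> st.1 by exact: cvg_fst.
  have c2 : (fun x : R * R => x.2) @ st --> st.2 by exact: cvg_snd.
  by apply: cvgD; apply: cvg_norm; apply: cvgB; apply: cvgD; apply: cvgM => //;
    try exact: cvg_cst; apply: cvgB => //; exact: cvg_cst.
have K : compact (`[0:R, 1] `*` `[0:R, 1]) by apply: compact_setX; exact: segment_compact.
have := @continuous_compact _ _ f _ (continuous_subspaceT fc) K.
move=> /(compact_closed (@norm_hausdorff _ _)) cl.
have n0 : ~ (f @` (`[0:R, 1] `*` `[0:R, 1])) 0.
  move=> [[s t] [/= hs ht]] /eqP.
  rewrite /f /= paddr_eq0 // !normr_eq0 => /andP[/eqP h1 /eqP h2].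
  apply: (dis (lerp p q s)); first by apply: seg_lerp; move: hs; rewrite /= in_itv.
  exists t; split; first by move: ht; rewrite /= in_itv.
  by move: h1 h2; rewrite /lerp /= => h1 h2; congr (_, _); lra.
have : nbhs (0 : R) (~` (f @` (`[0:R, 1] `*` `[0:R, 1]))).
  by apply: open_nbhs_nbhs; split=> //; exact: closed_openC.
move=> /nbhs_ballP[r /= r0 hr]; exists r; split=> // z z' [s [hs ->]] [t [ht ->]].
rewrite leNgt; apply/negP => lt.
apply: (hr (f (s, t))).
  rewrite /ball /= sub0r normrN ger0_norm; last by rewrite /f addr_ge0.
  exact: lt.
by exists (s, t) => //=; split; rewrite /= in_itv.
Qed.

(** Moving the ends by [d] times fixed vectors displaces every point by at most a constant times
    [d], finally less than the distance of the segments. *)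
Lemma small_disjoint p q p' q' u v u' v' : (forall z, seg p q z -> ~ seg p' q' z) ->
  small (fun d => forall z,
    seg (p.1 + d * u.1, p.2 + d * u.2) (q.1 + d * v.1, q.2 + d * v.2) z ->
    ~ seg (p'.1 + d * u'.1, p'.2 + d * u'.2) (q'.1 + d * v'.1, q'.2 + d * v'.2) z).
Proof.
move=> /seg_dist[r [r0 hr]].
pose N (x : pt) := `|x.1| + `|x.2| : R.
have := @small_lt 0 r (N u + N v + N u' + N v') r0.
apply: small_imp => d d0 hd z [s [hs ->]] [t [ht]] [] h1 h2.
have := hr _ _ (seg_lerp p q hs) (seg_lerp p' q' ht).
rewrite /lerp /=.
have e1 : (1 - s) * p.1 + s * q.1 - ((1 - t) * p'.1 + t * q'.1) =
  - (d * ((1 - s) * u.1 + s * v.1 - (1 - t) * u'.1 - t * v'.1)) by lra.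
have e2 : (1 - s) * p.2 + s * q.2 - ((1 - t) * p'.2 + t * q'.2) =
  - (d * ((1 - s) * u.2 + s * v.2 - (1 - t) * u'.2 - t * v'.2)) by lra.
rewrite e1 e2 !normrN !normrM (gtr0_norm d0).
have B (x y x' y' : R) : `|(1 - s) * x + s * y - (1 - t) * x' - t * y'| <= `|x| + `|y| + `|x'| + `|y'|.
  have h (c w : R) : 0 <= c <= 1 -> `|c * w| <= `|w|.
    by move=> /andP[c0 c1]; rewrite normrM (ger0_norm c0); have := normr_ge0 w; nra.
  have := h (1 - s) x ltac:(lra); have := h s y ltac:(lra).
  have := h (1 - t) x' ltac:(lra); have := h t y' ltac:(lra).
  have := ler_normB ((1 - s) * x + s * y - (1 - t) * x') (t * y').
  have := ler_normB ((1 - s) * x + s * y) ((1 - t) * x').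
  have := ler_normD ((1 - s) * x) (s * y); lra.
have := B u.1 v.1 u'.1 v'.1; have := B u.2 v.2 u'.2 v'.2.
rewrite /N in hd; nra.
Qed.

End Segments.

(** * The even-odd rule for closed polygons *)

Section Parity.
Variable R : realType.
Local Notation pt := (R * R)%type.
Implicit Types (a b p q z : pt) (y : R).

(* Junk ([a.1]) when the line through [a] and [b] is horizontal. *)
Definition xat a b y : R := a.1 + (y - a.2) * ((b.1 - a.1) / (b.2 - a.2)).

Definition btw a b y := a.2 <= y <= b.2 \/ b.2 <= y <= a.2.

Lemma xat_l a b : xat a b a.2 = a.1.
Proof. by rewrite /xat; ring. Qed.

Lemma xat_r a b : a.2 != b.2 -> xat a b b.2 = b.1.
Proof.
move=> h; rewrite /xat mulrCA divff ?mulr1; first by ring.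
by rewrite subr_eq0 eq_sym.
Qed.

Lemma xat_lin a b (t y1 y2 : R) :
  xat a b ((1 - t) * y1 + t * y2) = (1 - t) * xat a b y1 + t * xat a b y2.
Proof. by rewrite /xat; ring. Qed.

Lemma btw_sym a b y : btw a b y -> btw b a y.
Proof. by case; [right|left]. Qed.

Lemma btw_l a b : btw a b a.2.
Proof. by rewrite /btw lexx /=; case: (leP a.2 b.2) => h; [left|right; rewrite (ltW h)]. Qed.

Lemma btw_r a b : btw a b b.2.
Proof. by apply: btw_sym; apply: btw_l. Qed.

Lemma btw_lin a b (t y1 y2 : R) : 0 <= t <= 1 -> btw a b y1 -> btw a b y2 ->
  btw a b ((1 - t) * y1 + t * y2).
Proof. by rewrite /btw => ht h1 h2; case: (lerP a.2 b.2) => h; [left|right]; nra. Qed.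

Lemma seg_btw a b z : seg a b z -> btw a b z.2.
Proof.
move=> [t [ht ->]] /=; apply: btw_lin => //; [exact: btw_l|exact: btw_r].
Qed.

Lemma seg_xat a b z : a.2 != b.2 -> seg a b z -> z.1 = xat a b z.2.
Proof. by move=> h [t [_ ->]] /=; rewrite xat_lin xat_l xat_r. Qed.

Lemma xat_seg a b y : a.2 != b.2 -> btw a b y -> seg a b (xat a b y, y).
Proof.
move=> h hy; have h1 : b.2 - a.2 != 0 by rewrite subr_eq0 eq_sym.
exists ((y - a.2) / (b.2 - a.2)); split.
  case: (ltrgtP a.2 b.2) hy h1 => [lt|lt|/eqP]; rewrite /btw; last by rewrite (negbTE h).
    have l' : 0 < b.2 - a.2 by lra.
    by move=> [|] hy _; rewrite ler_pdivlMr ?ler_pdivrMr // mul0r mul1r; lra.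
  have l' : b.2 - a.2 < 0 by lra.
  by move=> [|] hy _; rewrite ler_ndivlMr ?ler_ndivrMr // mul0r mul1r; lra.
by rewrite /xat; congr (_, _); field.
Qed.

Lemma xat_cross a b p q y1 y2 : a.2 != b.2 -> p.2 != q.2 ->
  btw a b y1 -> btw a b y2 -> btw p q y1 -> btw p q y2 ->
  xat p q y1 < xat a b y1 -> xat a b y2 <= xat p q y2 ->
  exists t, 0 <= t <= 1 /\ let y := (1 - t) * y1 + t * y2 in
    [/\ xat a b y = xat p q y, seg a b (xat a b y, y) & seg p q (xat a b y, y)].
Proof.
move=> hab hpq b1 b2 c1 c2 l1 l2.
pose D1 := xat a b y1 - xat p q y1; pose D2 := xat p q y2 - xat a b y2.
have D0 : 0 < D1 + D2 by rewrite /D1 /D2; lra.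
pose t := D1 / (D1 + D2).
have ht : 0 <= t <= 1.
  by rewrite /t ler_pdivlMr // ler_pdivrMr // mul0r mul1r /D1 /D2; lra.
have e : xat a b ((1 - t) * y1 + t * y2) = xat p q ((1 - t) * y1 + t * y2).
  rewrite !xat_lin.
  have : t * (D1 + D2) = D1 by rewrite /t mulfVK //; lra.
  by rewrite /D1 /D2; lra.
exists t; split=> //=; split=> //; first by apply: xat_seg => //; apply: btw_lin.
by rewrite e; apply: xat_seg => //; apply: btw_lin.
Qed.

(* The horizontal ray from [q] to the right hits the edge [a b], resp. the ray from
   [a] to the left hits [q q']; both tests break ties with [a.2 <= q.2] only. *)
Definition hitr a b q := ((a.2 <= q.2) != (b.2 <= q.2)) && (q.1 < xat a b q.2).
Definition hitl q q' a := ((a.2 <= q.2) != (a.2 <= q'.2)) && (xat q q' a.2 < a.1).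

(** While [q] moves to [q'], its ray gains or loses the edge [a b] only at the height of an end that
    lies to the right, because disjoint segments cannot exchange their horizontal order. The
    symmetric form makes the terms cancel when summed along a polygon, and the common tie rule
    avoids any assumption of general position. *)
Lemma hit_parity a b q q' : (forall z, seg a b z -> ~ seg q q' z) ->
  hitr a b q (+) hitr a b q' = hitl q q' a (+) hitl q q' b.
Proof.
move=> dis; rewrite /hitr /hitl.
(* The left-right order of the two segments is the same at all heights that they share. *)
have key y1 y2 : a.2 != b.2 -> q.2 != q'.2 -> btw a b y1 -> btw a b y2 ->
    btw q q' y1 -> btw q q' y2 -> (xat q q' y1 < xat a b y1) = (xat q q' y2 < xat a b y2).
  move=> h1 h2 h3 h4 h5 h6; apply/idP/idP => lt; rewrite ltNge; apply/negP => le.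
    by have [t [_ [_ s1 s2]]] := xat_cross h1 h2 h3 h4 h5 h6 lt le; apply: dis s1 s2.
  by have [t [_ [_ s1 s2]]] := xat_cross h1 h2 h4 h3 h6 h5 lt le; apply: dis s1 s2.
have [eab|hab] := eqVneq a.2 b.2.
  rewrite eab !eqxx /=; have [eq|hq] := eqVneq q.2 q'.2; first by rewrite eq !eqxx.
  case: (boolP ((b.2 <= q.2) != (b.2 <= q'.2))) => //= sp.
  have bt : btw q q' b.2.
    by move: sp; rewrite /btw; case: (leP b.2 q.2); case: (leP b.2 q'.2) => // ? ?; first [left; lra|right; lra].
  have hs := xat_seg hq bt.
  case: (ltP (xat q q' b.2) a.1) => l1; case: (ltP (xat q q' b.2) b.1) => l2 //; exfalso;
    apply: (dis (xat q q' b.2, b.2)) hs.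
    have d0 : 0 < a.1 - b.1 by lra.
    exists ((a.1 - xat q q' b.2) / (a.1 - b.1)); split.
      by rewrite ler_pdivlMr // ler_pdivrMr // mul0r mul1r; lra.
    by rewrite eab; congr (_, _); field; rewrite ?subr_eq0; lra.
  have d0 : 0 < b.1 - a.1 by lra.
  exists ((xat q q' b.2 - a.1) / (b.1 - a.1)); split.
    by rewrite ler_pdivlMr // ler_pdivrMr // mul0r mul1r; lra.
  by rewrite eab; congr (_, _); field; rewrite ?subr_eq0; lra.
have [eq|hq] := eqVneq q.2 q'.2.
  rewrite -eq !eqxx /=.
  case: (boolP ((a.2 <= q.2) != (b.2 <= q.2))) => //= sp.
  have bt : btw a b q.2.
    by move: sp; rewrite /btw; case: (leP a.2 q.2); case: (leP b.2 q.2) => // ? ?; first [left; lra|right; lra].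
  have hs := xat_seg hab bt.
  case: (ltP q.1 (xat a b q.2)) => l1; case: (ltP q'.1 (xat a b q.2)) => l2 //; exfalso;
    apply: (dis _ hs).
    have d0 : 0 < q'.1 - q.1 by lra.
    exists ((xat a b q.2 - q.1) / (q'.1 - q.1)); split.
      by rewrite ler_pdivlMr // ler_pdivrMr // mul0r mul1r; lra.
    by rewrite -eq; congr (_, _); field; rewrite ?subr_eq0; lra.
  have d0 : 0 < q.1 - q'.1 by lra.
  exists ((q.1 - xat a b q.2) / (q.1 - q'.1)); split.
    by rewrite ler_pdivlMr // ler_pdivrMr // mul0r mul1r; lra.
  by rewrite -eq; congr (_, _); field; rewrite ?subr_eq0; lra.
have ka : (xat q q' a.2 < a.1) = (xat q q' a.2 < xat a b a.2) by rewrite xat_l.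
have kb : (xat q q' b.2 < b.1) = (xat q q' b.2 < xat a b b.2) by rewrite xat_r.
rewrite ka kb; rewrite -{1}(xat_l q q') -{1}(xat_r hq).
have Bq := btw_l q q'; have Bq' := btw_r q q'; have Ba := btw_l a b; have Bb := btw_r a b.
have K y1 y2 h1 h2 h3 h4 := @key y1 y2 hab hq h1 h2 h3 h4.
case: (leP a.2 q.2) => A1; case: (leP a.2 q'.2) => A2; case: (leP b.2 q.2) => B1;
  case: (leP b.2 q'.2) => B2; rewrite ?eqxx //= ?addbF ?addFb //; first [
    by exfalso; lra
  | apply: K => //; rewrite /btw; first [left; lra|right; lra]
  | idtac ].
all: first [apply/negbTE | apply: esym; apply/negbTE]; rewrite negb_add; apply/eqP; apply: K => //;
  by rewrite /btw; first [left; lra|right; lra].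
Qed.

Fixpoint hits (x : pt) (s : seq pt) (q : pt) : bool :=
  if s is y :: s' then hitr x y q (+) hits y s' q else false.

Lemma hits_rcons (x : pt) s (y : pt) q : hits x (rcons s y) q = hits x s q (+) hitr (last x s) y q.
Proof. by elim: s x => [|w s IH] x /=; rewrite ?addbF ?IH ?addbA. Qed.

Lemma polyline_cons (x y : pt) s : polyline (x :: y :: s) = seg x y `|` polyline (y :: s).
Proof.
apply/seteqP; split=> p.
  by move=> [[|i] [hi h]]; [left|right; exists i].
by move=> [h|[i [hi h]]]; [exists 0%N|exists i.+1].
Qed.

Lemma polyline1 (x : pt) : polyline [:: x] = set0.
Proof. by apply/seteqP; split=> p // [i []]. Qed.

(** Each inner vertex contributes to two consecutive edges and cancels; for a closed polygon the two
    outer terms cancel as well. *)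
Lemma hits_parity x s q q' : (forall z, polyline (x :: s) z -> ~ seg q q' z) ->
  hits x s q (+) hits x s q' = hitl q q' x (+) hitl q q' (last x s).
Proof.
elim: s x => [|y s IH] x; first by rewrite /= addbb.
rewrite polyline_cons => dis /=.
have h1 := @hit_parity x y q q' (fun z hz => dis z (or_introl hz)).
have h2 := IH y (fun z hz => dis z (or_intror hz)).
by rewrite addbACA h1 h2 addbA -(addbA (hitl q q' x)) addbb addbF.
Qed.

Lemma closed_parity x s q q' : (forall z, polyline (x :: rcons s x) z -> ~ seg q q' z) ->
  hits x (rcons s x) q = hits x (rcons s x) q'.
Proof.
by move=> /hits_parity; rewrite last_rcons addbb => /negbT; rewrite negb_add => /eqP.
Qed.

End Parity.

(** * Ambient isotopies and pushes along a vector *)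

Section Isotopy.
Variable R : realType.
Local Notation pt := (R * R)%type.
Implicit Types (a b c p q z u : pt) (f : pt -> pt).

Definition n1 p q : R := `|p.1 - q.1| + `|p.2 - q.2|.

Lemma n1_ge0 p q : 0 <= n1 p q.
Proof. by rewrite addr_ge0. Qed.

Lemma n1_eq0 p q : n1 p q <= 0 -> p = q.
Proof.
move=> h; have /eqP : n1 p q = 0 by apply/eqP; rewrite eq_le h n1_ge0.
rewrite /n1 paddr_eq0 // !normr_eq0 !subr_eq0 => /andP[/eqP h1 /eqP h2].
by rewrite [p]surjective_pairing h1 h2 -surjective_pairing.
Qed.

Lemma lip_continuous (F : R * pt -> pt) (C : R) :
  (forall x y, n1 (F x) (F y) <= C * (`|x.1 - y.1| + n1 x.2 y.2)) -> continuous F.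
Proof.
move=> hF x; apply/cvg_ballP => e e0; change (nbhs x (fun y => ball (F x) e (F y))).
have C0 : 0 < 3 * (`|C| + 1) by have := normr_ge0 C; lra.
apply/nbhs_ballP; exists (e / (3 * (`|C| + 1))); first by rewrite /= divr_gt0.
move=> y [/= h1 [/= h2 h3]].
have := hF x y; rewrite /n1.
move: h1 h2 h3; rewrite /ball /= !ltr_pdivlMr // => h1 h2 h3 h4.
have h5 : `|(F x).1 - (F y).1| + `|(F x).2 - (F y).2| < e.
  apply: le_lt_trans h4 _.
  have := ler_norm C; have := normr_ge0 C.
  move: (normr_ge0 (x.1 - y.1)) (normr_ge0 (x.2.1 - y.2.1)) (normr_ge0 (x.2.2 - y.2.2)).
  move: h1 h2 h3; move: `|x.1 - y.1| `|x.2.1 - y.2.1| `|x.2.2 - y.2.2| `|C| => X Y Z D.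
  nra.
split; rewrite /ball /=.
  by apply: le_lt_trans h5; rewrite lerDl.
by apply: le_lt_trans h5; rewrite lerDr.
Qed.

(** The inverse family is jointly continuous too, which makes the time-1 maps closed under
    inverses. *)
Definition siso (h g : R -> pt -> pt) :=
  [/\ continuous (fun tp : R * pt => h tp.1 tp.2),
      continuous (fun tp : R * pt => g tp.1 tp.2), h 0 = id,
      forall t, cancel (h t) (g t) & forall t, cancel (g t) (h t)].

Definition amb f := exists h g, siso h g /\ h 1 = f.

Lemma amb_id : amb id.
Proof.
exists (fun _ => id), (fun _ => id); split=> //; split=> // x; exact: cvg_snd.
Qed.

Lemma comp_jcont (h h' : R -> pt -> pt) :
  continuous (fun tp : R * pt => h tp.1 tp.2) ->
  continuous (fun tp : R * pt => h' tp.1 tp.2) ->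
  continuous (fun tp : R * pt => h tp.1 (h' tp.1 tp.2)).
Proof.
by move=> ch ch' x; exact: (cvg_comp2 cvg_fst (ch' x) (ch (x.1, h' x.1 x.2))).
Qed.

Lemma amb_comp f f' : amb f -> amb f' -> amb (f \o f').
Proof.
move=> [h [g [[ch cg h0 k1 k2] <-]]] [h' [g' [[ch' cg' h0' k1' k2'] <-]]].
exists (fun t => h t \o h' t), (fun t => g' t \o g t); split=> //; split.
- exact: (comp_jcont ch ch').
- exact: (comp_jcont cg' cg).
- by rewrite h0 h0'.
- by move=> t; apply: can_comp.
- by move=> t; apply: can_comp.
Qed.

Lemma amb_inv f : amb f -> exists f', [/\ amb f', cancel f f' & cancel f' f].
Proof.
move=> [h [g [[ch cg h0 k1 k2] <-]]]; exists (g 1); split=> //.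
exists g, h; split=> //; split=> //.
by apply/funext => x; have := k2 0 x; rewrite h0.
Qed.

Lemma amb_isotopy f : amb f -> exists h, ambient_isotopy h /\ h 1 = f.
Proof.
move=> [h [g [[ch cg h0 k1 k2] hf]]]; exists h; split=> //; split=> //; split=> // t.
have cpair (F : R -> pt -> pt) : continuous (fun tp : R * pt => F tp.1 tp.2) -> continuous (F t).
  by move=> cF x; exact: (cvg_comp2 (cvg_cst t) cvg_id (cF (t, x))).
by exists (g t); split=> //; split=> //; split; apply: cpair.
Qed.

(** Isotopies are indexed by all reals, so time is frozen outside the unit interval. *)
Definition clip (t : R) : R := Num.max 0 (Num.min t 1).

Lemma clipE t : clip t = if t <= 0 then 0 else if t <= 1 then t else 1.
Proof.
rewrite /clip; case: (leP t 1) => h; first by case: (leP 0 t) => h'; case: leP => h''; lra.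
by rewrite max_r // leNgt (lt_trans _ h).
Qed.

Lemma clip_bnd t : 0 <= clip t <= 1.
Proof. by rewrite clipE; case: (leP t 0) => h; first lra; case: (leP t 1) => h'; lra. Qed.

Lemma clip_lip s t : `|clip s - clip t| <= `|s - t|.
Proof.
have := ler_norm (s - t); have := ler_norm (t - s); rewrite (distrC t s) => h1 h2.
rewrite ler_norml !clipE; case: (leP s 0) => ?; case: (leP t 0) => ?; try lra;
  try (case: (leP s 1) => ?); try (case: (leP t 1) => ?); lra.
Qed.

Lemma clip0 : clip 0 = 0.
Proof. by rewrite clipE lexx. Qed.

Lemma clip1 : clip 1 = 1.
Proof. by rewrite clipE lexx; case: (leP 1 0) => h //; lra. Qed.

Section Push.
Variables (phi : pt -> R) (u : pt) (M L : R).
Hypothesis phiM : forall p, `|phi p| <= M.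
Hypothesis phiL : forall p q, `|phi p - phi q| <= L * n1 p q.
Hypothesis uL : L * (`|u.1| + `|u.2|) <= 1 / 2.

Let U := `|u.1| + `|u.2|.
Let hp (t : R) (p : pt) : pt := (p.1 + clip t * phi p * u.1, p.2 + clip t * phi p * u.2).

Let U0 : 0 <= U. Proof. by rewrite addr_ge0. Qed.
Let M0 : 0 <= M. Proof. exact: le_trans (phiM 0). Qed.

Let phid s t p q : `|clip s * phi p - clip t * phi q| <= L * n1 p q + M * `|s - t|.
Proof.
have -> : clip s * phi p - clip t * phi q = clip s * (phi p - phi q) + (clip s - clip t) * phi q by ring.
apply: le_trans (ler_normD _ _) _; rewrite !normrM.
have /andP[c0 c1] := clip_bnd s; rewrite (ger0_norm c0).
have := phiL p q; have := phiM q; have := clip_lip s t.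
have := normr_ge0 (phi p - phi q); have := normr_ge0 (phi q); have := normr_ge0 (clip s - clip t).
move: `|phi p - phi q| `|phi q| `|clip s - clip t| `|s - t| (n1 p q) => A B C D E.
nra.
Qed.

Let hp_diff s t p q : n1 (hp s p) (hp t q) <= 3 / 2 * n1 p q + M * U * `|s - t| /\
  n1 p q / 2 <= n1 (hp s p) (hp t q) + M * U * `|s - t|.
Proof.
have h := phid s t p q; rewrite /n1 /hp /=.
set w := clip s * phi p - clip t * phi q in h.
have e1 : p.1 + clip s * phi p * u.1 - (q.1 + clip t * phi q * u.1) = (p.1 - q.1) + w * u.1.
  by rewrite /w; ring.
have e2 : p.2 + clip s * phi p * u.2 - (q.2 + clip t * phi q * u.2) = (p.2 - q.2) + w * u.2.
  by rewrite /w; ring.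
rewrite e1 e2.
have d1 := ler_normD (p.1 - q.1) (w * u.1); have d2 := ler_normD (p.2 - q.2) (w * u.2).
have d3 := ler_normB (p.1 - q.1 + w * u.1) (w * u.1).
have d4 := ler_normB (p.2 - q.2 + w * u.2) (w * u.2).
rewrite !addrK in d3 d4; rewrite !normrM in d1 d2 d3 d4.
have hw : `|w| * U <= n1 p q / 2 + M * U * `|s - t|.
  have : `|w| * U <= (L * n1 p q + M * `|s - t|) * U by apply: ler_wpM2r.
  have := n1_ge0 p q; move: uL; rewrite -/U; nra.
rewrite /U /n1 in hw *; split; lra.
Qed.

(** A preimage of [q] is sought on the line through [q] in direction [u]: its offset [l] must solve
    [l = clip t * phi (q - l u)], and the right side stays within [[- M, M]]. *)
Let hp_surj t q : exists p, hp t p = q.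
Proof.
pose F (l : R) := l - clip t * phi (q.1 - l * u.1, q.2 - l * u.2).
have K0 : 0 < 1 + `|L| * U by have := mulr_ge0 (normr_ge0 L) U0; lra.
have Flip (l l' : R) : `|F l - F l'| <= `|l - l'| * (1 + `|L| * U).
  rewrite /F.
  have -> : l - clip t * phi (q.1 - l * u.1, q.2 - l * u.2) -
     (l' - clip t * phi (q.1 - l' * u.1, q.2 - l' * u.2)) =
    (l - l') - (clip t * phi (q.1 - l * u.1, q.2 - l * u.2)
      - clip t * phi (q.1 - l' * u.1, q.2 - l' * u.2)) by ring.
  apply: le_trans (ler_normB _ _) _.
  have := phid t t (q.1 - l * u.1, q.2 - l * u.2) (q.1 - l' * u.1, q.2 - l' * u.2).
  rewrite subrr normr0 mulr0 addr0 /n1 /=.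
  have -> : q.1 - l * u.1 - (q.1 - l' * u.1) = - ((l - l') * u.1) by ring.
  have -> : q.2 - l * u.2 - (q.2 - l' * u.2) = - ((l - l') * u.2) by ring.
  rewrite !normrN !normrM -mulrDr -/U => h.
  have : L * (`|l - l'| * U) <= `|L| * (`|l - l'| * U).
    by apply: ler_wpM2r (ler_norm L); rewrite mulr_ge0.
  move=> h2; rewrite mulrDr mulr1 lerD2l; apply: le_trans h (le_trans h2 _).
  by rewrite mulrCA.
have Fc : continuous F.
  move=> l; apply/cvgrPdist_lt => e e0.
  apply/nbhs_ballP; exists (e / (1 + `|L| * U)); first by rewrite /= divr_gt0.
  move=> l'; rewrite /ball /= ltr_pdivlMr // => hl.
  exact: le_lt_trans (Flip _ _) hl.
have bd l : - M <= clip t * phi (q.1 - l * u.1, q.2 - l * u.2) <= M.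
  have := phiM (q.1 - l * u.1, q.2 - l * u.2); rewrite ler_norml.
  have := clip_bnd t; move: (clip t) (phi _) => A B h1 h2; nra.
have [] := @IVT R F (- M) M 0.
- by have := M0; lra.
- exact: continuous_subspaceT.
- have := bd M; have := bd (- M); rewrite /F ge_min le_max.
  by move=> h1 h2; apply/andP; split; apply/orP; [left|right]; lra.
move=> l _ /eqP; rewrite subr_eq0 => /eqP hl.
exists (q.1 - l * u.1, q.2 - l * u.2); rewrite /hp /= -hl [RHS]surjective_pairing.
by congr (_, _); ring.
Qed.

(** The bound [uL] lets the push change distances only by factors between [1 / 2] and [3 / 2]; this
    gives injectivity and the continuity of the inverse. *)
Lemma amb_push : amb (fun p => (p.1 + phi p * u.1, p.2 + phi p * u.2)).
Proof.
pose g t q := projT1 (cid (hp_surj t q)).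
have hg t : cancel (g t) (hp t) by move=> q; rewrite /g; case: cid.
have inj t : injective (hp t).
  move=> p q e; have [_] := hp_diff t t p q; rewrite e subrr normr0 mulr0 addr0.
  rewrite {2}/n1 !subrr normr0 addr0 => h; apply: n1_eq0; lra.
exists hp, g; split; last by apply/funext => p; rewrite /hp clip1 !mul1r.
split=> //.
- apply: (@lip_continuous _ (3 / 2 + M * U)) => x y.
  have [h _] := hp_diff x.1 y.1 x.2 y.2; apply: le_trans h _.
  have := n1_ge0 x.2 y.2; have := normr_ge0 (x.1 - y.1); have := mulr_ge0 M0 U0; nra.
- apply: (@lip_continuous _ (2 + 2 * (M * U))) => x y.
  have [_ h] := hp_diff x.1 y.1 (g x.1 x.2) (g y.1 y.2); rewrite !hg in h.
  have := n1_ge0 x.2 y.2; have := normr_ge0 (x.1 - y.1); have := mulr_ge0 M0 U0; nra.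
- by apply/funext => p; rewrite /hp clip0 !mul0r !addr0 -surjective_pairing.
- by move=> t p; apply: (inj t); rewrite hg.
Qed.

End Push.

End Isotopy.

(** * Swinging a segment about one end while obstacles stay fixed *)

Section Swing.
Variable R : realType.
Local Notation pt := (R * R)%type.
Implicit Types (a b c p q z u : pt) (f : pt -> pt).

Section Kite.
Variables (c a : pt).
Hypothesis ca : c <> a.
Let e : pt := (a.1 - c.1, a.2 - c.2).
Let m2 : R := e.1 ^+ 2 + e.2 ^+ 2.

(* Coordinates along and across the segment [c a]: [lam] is 0 at [c] and 1 at [a]. *)
Definition lam p : R := ((p.1 - c.1) * e.1 + (p.2 - c.2) * e.2) / m2.
Definition mu p : R := ((p.2 - c.2) * e.1 - (p.1 - c.1) * e.2) / m2.
(** A tent that equals [lam] on the segment and is supported in a kite with its tip at [c]; the last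
    term cuts it off beyond [a]. The kite shrinks to the segment as [K] grows. *)
Definition kite (K : R) p : R :=
  Num.max 0 (lam p - K * `|mu p| - K * Num.max 0 (lam p - 1)).

Lemma m2_gt0 : 0 < m2.
Proof.
rewrite lt_def addr_ge0 ?sqr_ge0 // andbT paddr_eq0 ?sqr_ge0 // !sqrf_eq0 !subr_eq0.
apply/negP => /andP[/eqP h1 /eqP h2]; apply: ca.
by rewrite [c]surjective_pairing -h1 -h2 -surjective_pairing.
Qed.

Lemma lam_mu p : p.1 = c.1 + lam p * e.1 - mu p * e.2 /\ p.2 = c.2 + lam p * e.2 + mu p * e.1.
Proof.
have := m2_gt0; rewrite /lam /mu /m2; move: (e.1) (e.2) => x y h.
by split; field; rewrite gt_eqF // -!expr2.
Qed.

Lemma lam_lerp p q t : lam (lerp p q t) = (1 - t) * lam p + t * lam q.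
Proof. by rewrite /lam /lerp /=; ring. Qed.

Lemma mu_lerp p q t : mu (lerp p q t) = (1 - t) * mu p + t * mu q.
Proof. by rewrite /mu /lerp /=; ring. Qed.

Lemma lam_c : lam c = 0. Proof. by rewrite /lam !subrr !mul0r addr0 mul0r. Qed.
Lemma mu_c : mu c = 0. Proof. by rewrite /mu !subrr !mul0r subr0 mul0r. Qed.
Lemma lam_a : lam a = 1.
Proof. by rewrite /lam -[a.1 - c.1]/e.1 -[a.2 - c.2]/e.2 -!expr2 divff // gt_eqF // m2_gt0. Qed.
Lemma mu_a : mu a = 0. Proof. by rewrite /mu /= [X in X / _](_ : _ = 0) ?mul0r //; ring. Qed.

Lemma kite_lerp K t : 0 <= t <= 1 -> kite K (lerp c a t) = t.
Proof.
move=> ht; rewrite /kite lam_lerp mu_lerp lam_c lam_a mu_c mu_a !mulr0 !addr0 add0r mulr1 normr0.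
by rewrite (max_l (y := t - 1)) ?mulr0 ?subr0 ?max_r //; lra.
Qed.

Lemma kite_bnd (K : R) p : 1 <= K -> `|kite K p| <= 1.
Proof.
move=> K1; have k0 : 0 <= kite K p by rewrite /kite le_max lexx.
rewrite (ger0_norm k0) /kite ge_max ler01 /=.
have : lam p - 1 <= Num.max 0 (lam p - 1) by rewrite le_max lexx orbT.
have : 0 <= Num.max 0 (lam p - 1) by rewrite le_max lexx.
have := normr_ge0 (mu p); move: (Num.max _ _) `|mu p| => A B; nra.
Qed.

Lemma max0_lip (x y : R) : `|Num.max 0 x - Num.max 0 y| <= `|x - y|.
Proof.
have := ler_norm (x - y); have := ler_norm (y - x); rewrite (distrC y x) => h1 h2.
by rewrite ler_norml; case: (leP 0 x) => ?; case: (leP 0 y) => ?; lra.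
Qed.

Lemma kite_lip (K : R) : 0 <= K -> forall p q,
  `|kite K p - kite K q| <= (1 + 2 * K) * ((`|e.1| + `|e.2|) / m2) * n1 p q.
Proof.
move=> K0 p q; have m0 := m2_gt0.
have dl : `|lam p - lam q| <= (`|e.1| + `|e.2|) / m2 * n1 p q.
  have -> : lam p - lam q = ((p.1 - q.1) * e.1 + (p.2 - q.2) * e.2) / m2 by rewrite /lam; ring.
  rewrite normrM (gtr0_norm (x := m2^-1)) ?invr_gt0 // [leRHS]mulrAC ler_pM2r ?invr_gt0 //.
  apply: le_trans (ler_normD _ _) _; rewrite !normrM /n1.
  move: (normr_ge0 (p.1 - q.1)) (normr_ge0 (p.2 - q.2)) (normr_ge0 e.1) (normr_ge0 e.2).
  move: `|p.1 - q.1| `|p.2 - q.2| `|e.1| `|e.2| => A B C D; nra.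
have dm : `|mu p - mu q| <= (`|e.1| + `|e.2|) / m2 * n1 p q.
  have -> : mu p - mu q = ((p.2 - q.2) * e.1 - (p.1 - q.1) * e.2) / m2 by rewrite /mu; ring.
  rewrite normrM (gtr0_norm (x := m2^-1)) ?invr_gt0 // [leRHS]mulrAC ler_pM2r ?invr_gt0 //.
  apply: le_trans (ler_normB _ _) _; rewrite !normrM /n1.
  move: (normr_ge0 (p.1 - q.1)) (normr_ge0 (p.2 - q.2)) (normr_ge0 e.1) (normr_ge0 e.2).
  move: `|p.1 - q.1| `|p.2 - q.2| `|e.1| `|e.2| => A B C D; nra.
apply: le_trans (max0_lip _ _) _.
have -> : lam p - K * `|mu p| - K * Num.max 0 (lam p - 1) -
    (lam q - K * `|mu q| - K * Num.max 0 (lam q - 1)) =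
  (lam p - lam q) - K * (`|mu p| - `|mu q|) - K * (Num.max 0 (lam p - 1) - Num.max 0 (lam q - 1)) by ring.
apply: le_trans (ler_normB _ _) _.
have h1 := ler_normB (lam p - lam q) (K * (`|mu p| - `|mu q|)).
have h3 : `| `|mu p| - `|mu q| | <= `|mu p - mu q| by exact: ler_dist_dist.
have h4 := max0_lip (lam p - 1) (lam q - 1).
have e4 : lam p - 1 - (lam q - 1) = lam p - lam q by ring.
rewrite e4 in h4.
rewrite !(normrM K) (ger0_norm K0) in h1 *.
rewrite -[leRHS]mulrA.
have k1 := ler_wpM2l K0 (le_trans h3 dm); have k2 := ler_wpM2l K0 (le_trans h4 dl).
lra.
Qed.

Lemma kite_eq0 K p : lam p <= K * (`|mu p| + Num.max 0 (lam p - 1)) -> kite K p = 0.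
Proof. by move=> h; rewrite /kite max_l //; lra. Qed.

(** Where [lam] is positive, the distance to the segment is at most [E] times the sum of the two
    penalties. A distance of at least [r] thus makes the penalties at least [r / E], and the chosen
    [K] lets them outweigh [lam]. *)
Lemma kite_far p q : (forall z, seg p q z -> ~ seg c a z) ->
  exists K0, 1 <= K0 /\ forall K z, K0 <= K -> seg p q z -> kite K z = 0.
Proof.
move=> /seg_dist[r [r0 hr]].
pose E := `|e.1| + `|e.2|; have E0 : 0 <= E by rewrite addr_ge0.
exists (1 + (E + 1) / r); split; first by rewrite lerDl divr_ge0 //; lra.
move=> K z hK hz; apply: kite_eq0.
have mx0 : 0 <= Num.max 0 (lam z - 1) by rewrite le_max lexx.
have mx1 : lam z - 1 <= Num.max 0 (lam z - 1) by rewrite le_max lexx orbT.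
have k0 : 0 <= (E + 1) / r by rewrite divr_ge0 //; lra.
case: (leP (lam z) 0) => l0.
  by apply: le_trans l0 _; rewrite mulr_ge0 ?addr_ge0 //; lra.
have hcl := clip_bnd (lam z).
have := hr _ _ hz (seg_lerp c a hcl); rewrite /lerp /n1 /=.
have [h1 h2] := lam_mu z.
have mE : `|lam z - clip (lam z)| = Num.max 0 (lam z - 1).
  rewrite clipE leNgt l0 /=; case: (leP (lam z) 1) => l1.
    by rewrite subrr normr0 max_l //; lra.
  by rewrite gtr0_norm ?max_r //; lra.
have -> : z.1 - ((1 - clip (lam z)) * c.1 + clip (lam z) * a.1) =
    (lam z - clip (lam z)) * e.1 - mu z * e.2 by rewrite {1}h1 /e /=; ring.
have -> : z.2 - ((1 - clip (lam z)) * c.2 + clip (lam z) * a.2) =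
    (lam z - clip (lam z)) * e.2 + mu z * e.1 by rewrite {1}h2 /e /=; ring.
have g1 := ler_normB ((lam z - clip (lam z)) * e.1) (mu z * e.2).
have g2 := ler_normD ((lam z - clip (lam z)) * e.2) (mu z * e.1).
move=> hr'; rewrite !(normrM (lam z - clip (lam z))) !(normrM (mu z)) mE in g1 g2.
have hr2 : r <= (`|mu z| + Num.max 0 (lam z - 1)) * E by rewrite /E; lra.
have X0 := normr_ge0 (mu z).
have hX : 1 <= (E + 1) / r * (`|mu z| + Num.max 0 (lam z - 1)).
  by rewrite mulrAC ler_pdivlMr // mul1r; nra.
have : (1 + (E + 1) / r) * (`|mu z| + Num.max 0 (lam z - 1)) <=
  K * (`|mu z| + Num.max 0 (lam z - 1)) by apply: ler_wpM2r => //; lra.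
lra.
Qed.

(** An obstacle that leaves [c] in another direction with positive [lam] has [mu] nonzero, and then
    [lam] is a fixed multiple of [|mu|] along it; a sufficiently slim kite avoids it. *)
Lemma kite_ray p : (forall z, seg c p z -> seg c a z -> z = c) ->
  exists K0, 1 <= K0 /\ forall K z, K0 <= K -> seg c p z -> kite K z = 0.
Proof.
move=> dis.
have lz t : lam (lerp c p t) = t * lam p by rewrite lam_lerp lam_c mulr0 add0r.
have mz t : mu (lerp c p t) = t * mu p by rewrite mu_lerp mu_c mulr0 add0r.
case: (leP (lam p) 0) => l0.
  exists 1; split=> // K z hK [t [ht ->]]; apply: kite_eq0; rewrite -/(lerp c p t) lz.
  have : 0 <= Num.max 0 (t * lam p - 1) by rewrite le_max lexx.
  have := normr_ge0 (mu (lerp c p t)); move: `|_| (Num.max _ _) => A B; nra.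
have m0 : mu p != 0.
  apply/eqP => m0.
  pose t := Num.min 1 (lam p)^-1.
  have ht : 0 < t <= 1 by rewrite /t lt_min ltr01 invr_gt0 l0 ge_min lexx.
  have ht2 : 0 <= t * lam p <= 1.
    have : t <= (lam p)^-1 by rewrite /t ge_min lexx orbT.
    rewrite -(ler_pM2r l0) mulVf ?gt_eqF //; nra.
  have ez : lerp c p t = lerp c a (t * lam p).
    have [h1 h2] := lam_mu p; rewrite m0 !mul0r ?subr0 ?addr0 in h1 h2.
    by rewrite /lerp h1 h2 /e /=; congr (_, _); ring.
  have : lerp c p t = c.
    by apply: dis; [apply: seg_lerp; lra | rewrite ez; apply: seg_lerp].
  move=> /(congr1 lam); rewrite lz lam_c => /eqP.
  by rewrite mulf_eq0 !gt_eqF //; case/andP: ht.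
have mp : 0 < `|mu p| by rewrite normr_gt0.
exists (1 + lam p / `|mu p|); split; first by rewrite lerDl divr_ge0 // ltW.
move=> K z hK [t [ht ->]]; apply: kite_eq0; rewrite -/(lerp c p t) lz mz.
have : 0 <= Num.max 0 (t * lam p - 1) by rewrite le_max lexx.
have t0 : 0 <= t by case/andP: ht.
rewrite normrM (ger0_norm t0).
have hh : lam p <= K * `|mu p|.
  by rewrite -ler_pdivrMr //; lra.
have k0 : 0 <= lam p / `|mu p| by rewrite divr_ge0 // ltW.
move: (Num.max _ _) `|mu p| mp hh => A B; nra.
Qed.

Lemma seg_split p q z : seg p q c -> seg p q z -> seg c p z \/ seg c q z.
Proof.
move=> [s [hs ec]] [t [ht ez]]; rewrite -/(lerp _ _ _) in ec ez.
have h (x y : R) : 0 <= x <= y -> y != 0 -> 0 <= x / y <= 1.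
  move=> hxy y0; have yp : 0 < y by rewrite lt_def y0 /=; lra.
  by rewrite ler_pdivlMr // ler_pdivrMr //; lra.
case: (leP t s) => ts.
  left; have [s0|s0] := eqVneq s 0.
    have -> : z = c by rewrite ec ez; congr lerp; lra.
    exact: seg_l.
  exists ((s - t) / s); split; first by apply: h => //; lra.
  rewrite ec ez /lerp /=; congr (_, _); field => //.
right; have [s0|s0] := eqVneq (1 - s) 0; first by lra.
exists ((t - s) / (1 - s)); split; first by apply: h => //; lra.
rewrite ec ez /lerp /=; congr (_, _); field => //.
Qed.

Lemma kite_avoid p q : (forall z, seg p q z -> seg c a z -> z = c) ->
  exists K0, 1 <= K0 /\ forall K z, K0 <= K -> seg p q z -> kite K z = 0.
Proof.
move=> dis; have [hc|hc] := pselect (seg p q c).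
  have [K1 [h1 k1]] : exists K0, 1 <= K0 /\ forall K z, K0 <= K -> seg c p z -> kite K z = 0.
    by apply: kite_ray => z hz; apply: dis; apply: seg_sub hz => //; exact: seg_l.
  have [K2 [h2 k2]] : exists K0, 1 <= K0 /\ forall K z, K0 <= K -> seg c q z -> kite K z = 0.
    by apply: kite_ray => z hz; apply: dis; apply: seg_sub hz => //; exact: seg_r.
  exists (K1 + K2); split; first by lra.
  move=> K z hK hz; case: (seg_split hc hz) => h; [apply: k1 h|apply: k2 h]; lra.
apply: kite_far => z h1 h2; apply: hc; by rewrite -(dis z h1 h2).
Qed.

End Kite.

Definition carries (os : seq (pt * pt)) c a a' := exists f,
  [/\ amb f, forall o z, o \in os -> seg o.1 o.2 z -> f z = z &
      forall t, 0 <= t <= 1 -> f (lerp c a t) = lerp c a' t].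

Lemma carries_refl os c a : carries os c a a.
Proof. by exists id; split=> //; exact: amb_id. Qed.

Lemma carries_trans os c a a' a'' : carries os c a a' -> carries os c a' a'' -> carries os c a a''.
Proof.
move=> [f [af hf kf]] [g [ag hg kg]]; exists (g \o f); split; first exact: amb_comp.
  by move=> o z ho hz /=; rewrite (hf o) // (hg o).
by move=> t ht /=; rewrite kf // kg.
Qed.

Lemma carries_sym os c a a' : carries os c a a' -> carries os c a' a.
Proof.
move=> [f [af hf kf]]; have [g [ag fg gf]] := amb_inv af; exists g; split=> //.
  by move=> o z ho hz; rewrite -{1}(hf o z) // fg.
by move=> t ht; rewrite -kf // fg.
Qed.

(** Push by the kite function in the direction from [a] to [a']: it vanishes on the obstacles and is
    linear on the segment. The shift must be small for the Lipschitz condition of [amb_push]. *)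
Lemma carries_local os c a : c <> a ->
  (forall o z, o \in os -> seg o.1 o.2 z -> seg c a z -> z = c) ->
  exists eps, 0 < eps /\ forall a', n1 a a' < eps -> carries os c a a'.
Proof.
move=> ca dis.
have [K [K1 hK]] : exists K, 1 <= K /\ forall o z, o \in os -> seg o.1 o.2 z -> kite c a K z = 0.
  suff [K0 [k1 hk]] : exists K0, 1 <= K0 /\ forall K o z, K0 <= K -> o \in os ->
      seg o.1 o.2 z -> kite c a K z = 0.
    by exists K0; split=> // o z; apply: hk.
  elim: os dis => [|o os IH] dis; first by exists 1.
  have [K1 [k1 h1]] := IH (fun o' z ho => dis o' z (mem_behead (s := o :: os) ho)).
  have [K2 [k2 h2]] := kite_avoid ca (fun z => dis o z (mem_head o os)).
  exists (K1 + K2); split; first by lra.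
  move=> K o' z hK; rewrite inE => /orP[/eqP->|ho].
    by apply: h2; lra.
  by apply: h1 ho; lra.
pose L := (1 + 2 * K) * ((`|(a.1 - c.1)| + `|(a.2 - c.2)|) / ((a.1 - c.1) ^+ 2 + (a.2 - c.2) ^+ 2)).
have L0 : 0 <= L.
  by rewrite mulr_ge0 ?divr_ge0 ?addr_ge0 ?sqr_ge0 //; lra.
exists (1 / (2 * (L + 1))); split; first by rewrite divr_gt0 //; lra.
move=> a' ha.
have hu : L * (`|a'.1 - a.1| + `|a'.2 - a.2|) <= 1 / 2.
  move: ha; rewrite /n1 (distrC a.1) (distrC a.2) ltr_pdivlMr; last by lra.
  have := normr_ge0 (a'.1 - a.1); have := normr_ge0 (a'.2 - a.2).
  move: `|a'.1 - a.1| `|a'.2 - a.2| => X Y; nra.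
have K0 : 0 <= K by lra.
have am := @amb_push _ (kite c a K) (a'.1 - a.1, a'.2 - a.2) 1 L
  (fun p => kite_bnd c a p K1) (kite_lip ca K0) hu.
eexists; split; first exact: am.
  by move=> o z ho hz /=; rewrite (hK o) // !mul0r !addr0 -surjective_pairing.
by move=> t ht /=; rewrite kite_lerp // /lerp /=; congr (_, _); ring.
Qed.

(** Continuous induction on the parameter: local moves and their inverses show that the supremum of
    the reachable parameters is reached, and that it can be passed unless it is 1. *)
Lemma carries_swing os c a0 a1 :
  (forall s, 0 <= s <= 1 -> c <> lerp a0 a1 s) ->
  (forall s, 0 <= s <= 1 -> forall o z, o \in os -> seg o.1 o.2 z ->
     seg c (lerp a0 a1 s) z -> z = c) ->
  carries os c a0 a1.
Proof.
move=> ne dis.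
pose S := [set s : R | 0 <= s <= 1 /\ carries os c a0 (lerp a0 a1 s)].
have loc s : 0 <= s <= 1 -> exists eps, 0 < eps /\ forall s', `|s - s'| < eps ->
    carries os c (lerp a0 a1 s) (lerp a0 a1 s').
  move=> hs; have [e [e0 he]] := carries_local (ne s hs) (dis s hs).
  have D0 : 0 <= n1 a0 a1 by exact: n1_ge0.
  exists (e / (n1 a0 a1 + 1)); split; first by rewrite divr_gt0 //; lra.
  move=> s' hs'; apply: he; move: hs'; rewrite ltr_pdivlMr; last by lra.
  rewrite /n1 /lerp /=.
  have -> : (1 - s) * a0.1 + s * a1.1 - ((1 - s') * a0.1 + s' * a1.1) = - ((s - s') * (a0.1 - a1.1)) by ring.
  have -> : (1 - s) * a0.2 + s * a1.2 - ((1 - s') * a0.2 + s' * a1.2) = - ((s - s') * (a0.2 - a1.2)) by ring.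
  rewrite !normrN !normrM; have := normr_ge0 (s - s'); lra.
have S0 : S 0 by split; [lra | rewrite lerp0; exact: carries_refl].
have ub : has_sup S.
  by split; [exists 0 | exists 1 => s [/andP[]]].
have s0 : 0 <= sup S by apply: (ub_le_sup ub.2).
have s1 : sup S <= 1 by apply: ge_sup; [exists 0 | move=> s [/andP[]]].
have hs : 0 <= sup S <= 1 by rewrite s0 s1.
have [e [e0 he]] := loc _ hs.
have [s [hs' cs] ls] := sup_adherent e0 ub.
have ss : s <= sup S by apply: (ub_le_sup ub.2).
have cS : carries os c a0 (lerp a0 a1 (sup S)).
  apply: carries_trans cs _; apply: carries_sym; apply: he.
  by rewrite ger0_norm; lra.
have [lt|ge] := ltP (sup S) 1; last first.
  by have -> : a1 = lerp a0 a1 (sup S) by rewrite (_ : sup S = 1) ?lerp1 //; lra.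
pose s' := Num.min 1 (sup S + e / 2).
have b1 : s' <= 1 by rewrite /s' ge_min lexx.
have b2 : s' <= sup S + e / 2 by rewrite /s' ge_min lexx orbT.
have b3 : sup S < s' by rewrite /s' lt_min lt /=; lra.
have : S s'.
  split; first by lra.
  apply: carries_trans cS _; apply: he; rewrite ltr0_norm; lra.
move=> /(ub_le_sup ub.2); lra.
Qed.

End Swing.

(** * Retracting a polyline into a short segment at its foot *)

Section Retract.
Variable R : realType.
Ltac reals := repeat match goal with
  | H : is_true (@Order.le _ _ _ _) |- _ => revert H
  | H : is_true (@Order.lt _ _ _ _) |- _ => revert H
  | H : is_true (andb (@Order.le _ _ _ _) _) |- _ => revert H
  | H : is_true (andb (@Order.lt _ _ _ _) _) |- _ => revert H
  | H : @eq ?T _ _ |- _ => unify T (Real.sort R); revert H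
  end.
Ltac rlra := solve [reals; clear -R; intros; lra] || lra.
Ltac rnra := solve [reals; clear -R; intros; nra] || nra.

Local Notation pt := (R * R)%type.
Implicit Types (a b c p q z x : pt) (f : pt -> pt) (s : seq pt) (os : seq (pt * pt)).

Definition segs s : seq (pt * pt) := zip s (behead s).

Lemma size_segs s : size (segs s) = (size s).-1.
Proof. by rewrite /segs size_zip size_behead; case: s => //= x s; nlia. Qed.

Lemma nth_segs s i : (i.+1 < size s)%N ->
  nth (0, 0) (segs s) i = (nth (0, 0) s i, nth (0, 0) s i.+1).
Proof.
case: s => // x s /= hi.
by rewrite /segs nth_zip_cond size_zip /= (_ : (i < _)%N); [|nlia].
Qed.

Lemma polylineP s z : polyline s z <-> exists2 o, o \in segs s & seg o.1 o.2 z.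
Proof.
split.
  move=> [i [hi h]]; exists (nth (0, 0) (segs s) i); last by rewrite nth_segs.
  by apply: mem_nth; rewrite size_segs; nlia.
case=> o ho h.
have hi : (index o (segs s) < size (segs s))%N by rewrite index_mem.
have hi' : ((index o (segs s)).+1 < size s)%N by move: hi; rewrite size_segs; nlia.
exists (index o (segs s)); split=> //.
by have := nth_index (0, 0) ho; rewrite nth_segs // => E; rewrite -E in h.
Qed.

Lemma polyline_rcons s x c : polyline (rcons (rcons s x) c) = polyline (rcons s x) `|` seg x c.
Proof.
elim: s => [|y s IH] /=; first by rewrite polyline_cons !polyline1 set0U setU0.
case: s IH => [|w s] IH /=.
  by rewrite !polyline_cons !polyline1 !setU0.
by rewrite polyline_cons [in RHS]polyline_cons IH setUA.
Qed.

Lemma polyline_rconsS s a z : polyline s z -> polyline (rcons s a) z.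
Proof.
by case/lastP: s => [|s x]; [move=> [i []] | rewrite polyline_rcons; left].
Qed.

Lemma simple_rcons s x : (2 <= size s)%N -> simple_polyline (rcons s x) -> simple_polyline s.
Proof.
move=> h2 [_ [h3 h4]]; split=> //; split.
  move=> i hi; have := h3 i; rewrite size_rcons !nth_rcons hi (ltnW hi); apply; nlia.
move=> i j ij hj; have := h4 i j ij; rewrite size_rcons => /(_ ltac:(nlia)).
have i1 : (i < size s)%N by nlia.
have i2 : (i.+1 < size s)%N by nlia.
have i3 : (j < size s)%N by nlia.
by rewrite !nth_rcons hj i1 i2 i3.
Qed.

Lemma simple_last s x c a : simple_polyline (rcons (rcons (rcons s x) c) a) ->
  [/\ c <> a, x <> c,
      forall z, polyline (rcons s x) z -> ~ seg c a z,
      forall z, seg x c z -> seg c a z -> z = c &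
      forall z, polyline (rcons s x) z -> seg x c z -> z = x].
Proof.
move=> [_ [h1 h2]]; set t := rcons _ a in h1 h2.
have sz : size t = (size s).+3 by rewrite /t !size_rcons.
have nx : nth (0, 0) t (size s) = x.
  by rewrite /t !nth_rcons !size_rcons ltnS leqnSn ltnSn ltnn eqxx.
have nc : nth (0, 0) t (size s).+1 = c.
  by rewrite /t !nth_rcons !size_rcons ltnSn ltnn eqxx.
have na : nth (0, 0) t (size s).+2 = a.
  by rewrite /t nth_rcons !size_rcons ltnn eqxx.
have ns i : (i <= size s)%N -> nth (0, 0) t i = nth (0, 0) (rcons s x) i.
  move=> hi; have i1 : (i < (size s).+1)%N by nlia.
  have i2 : (i < (size s).+2)%N by nlia.
  by rewrite /t !(nth_rcons _ (rcons _ _)) !size_rcons i1 i2.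
split.
- have := h1 (size s).+1; rewrite sz nc na => /(_ ltac:(nlia)) h e.
  by rewrite e eqxx in h.
- have := h1 (size s); rewrite sz nx nc => /(_ ltac:(nlia)) h e.
  by rewrite e eqxx in h.
- move=> z [i [hi hz]] hz'; rewrite size_rcons in hi.
  have [_] := h2 i (size s).+1 ltac:(nlia) ltac:(rewrite sz; nlia).
  move=> /(_ ltac:(nlia)); rewrite nc na !ns; try nlia.
  by move=> /seteqP[/(_ z) + _]; apply.
- move=> z hz hz'.
  have [/(_ erefl) + _] := h2 (size s) (size s).+1 ltac:(nlia) ltac:(rewrite sz; nlia).
  by rewrite nx nc na => /seteqP[/(_ z) + _]; apply.
- move=> z [i [hi hz]] hz'; rewrite size_rcons in hi.
  have [+ +] := h2 i (size s) ltac:(nlia) ltac:(rewrite sz; nlia).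
  rewrite nx nc !ns; try nlia.
  case: (ltngtP i.+1 (size s)) => his; try nlia.
    by move=> _ /(_ isT) /seteqP[/(_ z) + _] => h; exfalso; apply: h.
  by move=> /(_ (esym his)) /seteqP[/(_ z) + _] _; apply.
Qed.

Lemma far_list os c : (forall o, o \in os -> ~ seg o.1 o.2 c) ->
  exists r, 0 < r /\ forall o z, o \in os -> seg o.1 o.2 z -> r <= n1 c z.
Proof.
elim: os => [|o os IH] h; first by exists 1.
have [r [r0 hr]] := IH (fun o' ho => h o' (mem_behead (s := o :: os) ho)).
have [r' [r0' hr']] : exists r', 0 < r' /\ forall z z', seg c c z -> seg o.1 o.2 z' ->
    r' <= `|z.1 - z'.1| + `|z.2 - z'.2|.
  by apply: seg_dist => z /segxx ->; apply: h; rewrite mem_head.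
exists (Num.min r r'); split; first by rewrite lt_min r0.
move=> o' z; rewrite inE ge_min => /orP[/eqP->|ho] hz.
  by rewrite (hr' c z) ?orbT //; exact: seg_l.
by rewrite (hr o' z).
Qed.

Lemma n1_lerp c a t : 0 <= t -> n1 c (lerp c a t) = t * n1 c a.
Proof.
move=> t0; rewrite /n1 /lerp /=.
have -> : c.1 - ((1 - t) * c.1 + t * a.1) = t * (c.1 - a.1) by ring.
have -> : c.2 - ((1 - t) * c.2 + t * a.2) = t * (c.2 - a.2) by ring.
by rewrite !normrM ger0_norm // mulrDr.
Qed.

Lemma n1_lerp2 c a a' t : 0 <= t <= 1 -> n1 c (lerp a a' t) <= (1 - t) * n1 c a + t * n1 c a'.
Proof.
move=> ht; rewrite /n1 /lerp /=.
have -> : c.1 - ((1 - t) * a.1 + t * a'.1) = (1 - t) * (c.1 - a.1) + t * (c.1 - a'.1) by ring.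
have -> : c.2 - ((1 - t) * a.2 + t * a'.2) = (1 - t) * (c.2 - a.2) + t * (c.2 - a'.2) by ring.
have t0 : 0 <= t by rlra. have t1 : 0 <= 1 - t by rlra.
have h1 := ler_normD ((1 - t) * (c.1 - a.1)) (t * (c.1 - a'.1)).
have h2 := ler_normD ((1 - t) * (c.2 - a.2)) (t * (c.2 - a'.2)).
rewrite !normrM !(ger0_norm t0) !(ger0_norm t1) in h1 h2; rlra.
Qed.

Lemma carries_img c a a' f : (forall t, 0 <= t <= 1 -> f (lerp c a t) = lerp c a' t) ->
  f @` seg c a = seg c a'.
Proof.
move=> h; apply/seteqP; split=> z.
  by move=> [_ [t [ht ->]] <-]; exists t; rewrite -/(lerp c a t) h.
by move=> [t [ht ->]]; exists (lerp c a t); [exact: seg_lerp | rewrite h].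
Qed.

Lemma fix_img f (A : set pt) : (forall z, A z -> f z = z) -> f @` A = A.
Proof.
move=> h; apply/seteqP; split=> z; first by move=> [w hw <-]; rewrite h.
by move=> hz; exists z; rewrite ?h.
Qed.

Definition fixes os f := forall o z, o \in os -> seg o.1 o.2 z -> f z = z.

Lemma fixes_comp os f f' : fixes os f -> fixes os f' -> fixes os (f' \o f).
Proof. by move=> h h' o z ho hz /=; rewrite (h o) // (h' o). Qed.

Lemma fixes_sub os os' f : {subset os <= os'} -> fixes os' f -> fixes os f.
Proof. by move=> h h' o z ho; apply: h'; apply: h. Qed.

Lemma fixes_polyline os s f z : {subset segs s <= os} -> fixes os f -> polyline s z -> f z = z.
Proof. by move=> h hf /polylineP; case=> o ho; apply: hf; apply: h. Qed.

(** Obstacles touch the polyline only at its foot, so some neighbourhood of the bend [c] is free of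
    them and of the earlier segments; there the last segment can turn once it is short. *)
Lemma retract_last os s x c a :
  simple_polyline (rcons (rcons (rcons s x) c) a) ->
  (forall o z, o \in os -> seg o.1 o.2 z ->
     polyline (rcons (rcons (rcons s x) c) a) z -> z = head x s) ->
  exists f, [/\ amb f, fixes os f,
    f @` polyline (rcons (rcons (rcons s x) c) a) = polyline (rcons (rcons s x) c) & f a = c].
Proof.
move=> hs dis; have [ca xc d1 d2 d3] := simple_last hs.
have hd : head x s = x \/ polyline (rcons s x) (head x s).
  case: (s) => [|y [|y' s']] /=; first (by left); right; rewrite polyline_cons; left; exact: seg_l.
have hdca : ~ seg c a (head x s).
  move=> h; case: hd => [e|h']; last exact: d1 h' h.
  by apply: xc; apply: d2; rewrite ?e in h *; first exact: seg_l.
pose os1 := os ++ segs (rcons s x).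
have osc o : o \in os1 -> ~ seg o.1 o.2 c.
  rewrite mem_cat => /orP[ho|ho] hc.
    apply: hdca; rewrite -(dis o c ho hc); first exact: seg_l.
    by rewrite polyline_rcons; right; exact: seg_l.
  by apply: (d1 c); [apply/polylineP; exists o | exact: seg_l].
have [r [r0 hr]] := far_list osc.
(* Here [r] is the distance from [c] to everything except the segment [x c]; [tau] makes both the
   shortened segment and the extension beyond [c] at most [r / 2] long. *)
pose D := n1 c a + n1 c x + 1.
have n10 := n1_ge0 c a; have n10' := n1_ge0 c x.
have D0 : 0 < D by rewrite /D; rlra.
pose tau := Num.min 1 (r / (2 * D)).
have t0 : 0 < tau by rewrite /tau lt_min ltr01 divr_gt0 //; rlra.
have t1 : tau <= 1 by rewrite /tau ge_min lexx.
have tD : tau * (2 * D) <= r by rewrite -ler_pdivlMr ?ge_min ?lexx ?orbT //; rlra.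
pose a1 := lerp c a tau.
pose a2 : pt := (c.1 + tau * (c.1 - x.1), c.2 + tau * (c.2 - x.2)).
have na1 : n1 c a1 <= r / 2 by rewrite n1_lerp ?(ltW t0) //; rewrite /D in tD; rnra.
have na2 : n1 c a2 <= r / 2.
  have -> : n1 c a2 = tau * n1 c x.
    rewrite /n1 /a2 /= !opprD !addNKr !normrN !normrM (gtr0_norm t0) -mulrDr.
    by [].
  by rewrite /D in tD; rnra.
(* shorten the last segment *)
have [f1 [am1 fx1 mv1]] : carries ((x, c) :: os1) c a a1.
  have ne (t : R) : 0 < t -> c <> lerp c a t.
    move=> t00 e; have : n1 c (lerp c a t) <= 0 by rewrite -e /n1 !subrr normr0 addr0.
    rewrite n1_lerp ?(ltW t00) // => h; apply: ca; apply: n1_eq0; rnra.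
  have sub (s' : R) : 0 <= s' <= 1 -> exists t, 0 < t <= 1 /\ lerp a a1 s' = lerp c a t.
    move=> hs'; exists ((1 - s') + s' * tau); split; first by rnra.
    by rewrite /a1 /lerp /=; congr (_, _); ring.
  apply: carries_swing => s' /sub[t [ht ->]]; first by apply: ne; rlra.
  move=> o z ho hz hz'.
  have hca : seg c a z by apply: seg_sub hz'; [exact: seg_l | apply: seg_lerp; rlra].
  move: ho; rewrite inE mem_cat => /orP[/eqP e|/orP[ho|ho]].
  - by rewrite e in hz; apply: d2.
  - by exfalso; apply: hdca; rewrite -(dis o z ho hz) // polyline_rcons; right.
  - by exfalso; apply: (d1 z) hca; apply/polylineP; exists o.
(* turn it into the extension of the previous segment *)
have [f2 [am2 fx2 mv2]] : carries ((x, c) :: os1) c a1 a2.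
  (* While turning, the segment has a direction that combines those from [c] to [a] and from [x] to
     [c] with nonnegative coefficients. Such a direction never points back towards [x], because the
     two segments meet only in [c]. *)
  have noray (al be : R) : 0 <= al -> 0 <= be -> 0 < al + be -> forall w, 0 <= w ->
      ~ ((al * (a.1 - c.1) + be * (c.1 - x.1), al * (a.2 - c.2) + be * (c.2 - x.2)) =
         (w * (x.1 - c.1), w * (x.2 - c.2))).
    move=> al0 be0 ab w w0 [] e1 e2.
    have [al1|al1] := eqVneq al 0.
      apply: xc; rewrite al1 in e1 e2 ab.
      have wb : be + w != 0 by rewrite gt_eqF //; rlra.
      have k1 : (be + w) * (c.1 - x.1) = 0 by rlra.
      have k2 : (be + w) * (c.2 - x.2) = 0 by rlra.
      move: k1 k2 => /eqP; rewrite mulf_eq0 (negbTE wb) subr_eq0 => /eqP k1.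
      move=> /eqP; rewrite mulf_eq0 (negbTE wb) subr_eq0 => /eqP k2.
      by rewrite [x]surjective_pairing -k1 -k2 -surjective_pairing.
    have alp : 0 < al by rewrite lt_def al1.
    pose v := (w + be) / al.
    have v0 : 0 <= v by rewrite divr_ge0 ?(ltW alp) // addr_ge0.
    have k1 : a.1 - c.1 = v * (x.1 - c.1).
      by rewrite /v mulrAC; apply: (mulfI al1); rewrite mulrCA divff ?mulr1 //; rlra.
    have k2 : a.2 - c.2 = v * (x.2 - c.2).
      by rewrite /v mulrAC; apply: (mulfI al1); rewrite mulrCA divff ?mulr1 //; rlra.
    pose th := (1 + v)^-1.
    have v1 : 0 < 1 + v by rlra.
    have th0 : 0 < th by rewrite invr_gt0.
    have thv : th * (1 + v) = 1 by rewrite mulVf // gt_eqF.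
    have th1 : th <= 1 by rnra.
    have thv1 : 0 <= th * v <= 1 by rnra.
    have e : lerp c a th = lerp c x (th * v).
      rewrite /lerp; congr (_, _).
        have : a.1 = c.1 + v * (x.1 - c.1) by rlra.
        by move=> ->; ring.
      have : a.2 = c.2 + v * (x.2 - c.2) by rlra.
      by move=> ->; ring.
    have : lerp c a th = c.
      apply: d2; last by apply: seg_lerp; rlra.
      by rewrite e seg_sym; apply: seg_lerp.
    move=> ec; have : n1 c (lerp c a th) <= 0 by rewrite ec /n1 !subrr normr0 addr0.
    rewrite n1_lerp ?(ltW th0) // => h; apply: ca; apply: n1_eq0; rnra.
  have coord (s' t : R) : lerp c (lerp a1 a2 s') t =
     (c.1 + t * ((1 - s') * tau * (a.1 - c.1) + s' * tau * (c.1 - x.1)),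
      c.2 + t * ((1 - s') * tau * (a.2 - c.2) + s' * tau * (c.2 - x.2))).
    by rewrite /a1 /a2 /lerp /=; congr (_, _); ring.
  apply: carries_swing => s' hs'.
    move=> e; have := coord s' 1; rewrite lerp1 -e => ec.
    have e1 := congr1 fst ec; have e2 := congr1 snd ec; rewrite /= in e1 e2.
    apply: (@noray ((1 - s') * tau) (s' * tau) _ _ _ 0); rewrite ?mul0r //.
    - by apply: mulr_ge0; rlra.
    - by apply: mulr_ge0; rlra.
    - by rewrite -mulrDl subrK mul1r.
    by congr (_, _); rlra.
  move=> o z ho hz [t [ht]]; rewrite -/(lerp _ _ _) => ez.
  have nz : n1 c z < r.
    rewrite ez n1_lerp; last by rlra.
    have N0 := n1_ge0 c (lerp a1 a2 s').
    have N1 : n1 c (lerp a1 a2 s') < r.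
      have h1 : (1 - s') * n1 c a1 <= (1 - s') * (r / 2) by apply: ler_wpM2l => //; rlra.
      have h2 : s' * n1 c a2 <= s' * (r / 2) by apply: ler_wpM2l => //; rlra.
      by have := n1_lerp2 c a1 a2 hs'; rlra.
    have : t * n1 c (lerp a1 a2 s') <= 1 * n1 c (lerp a1 a2 s') by apply: ler_wpM2r => //; rlra.
    by rlra.
  move: ho; rewrite inE => /orP[/eqP e|ho]; last by exfalso; have := hr o z ho hz; rlra.
  move: hz; rewrite e /= => -[w [hw ez']]; rewrite -/(lerp _ _ _) in ez'.
  have [tt|tt] := eqVneq t 0; first by rewrite ez tt lerp0.
  exfalso; apply: (@noray (t * ((1 - s') * tau)) (t * (s' * tau)) _ _ _ (1 - w)).
  - by rewrite !mulr_ge0 //; rlra.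
  - by rewrite !mulr_ge0 //; rlra.
  - have t00 : 0 < t by rewrite lt_def tt /=; rlra.
    by rewrite -mulrDr -mulrDl subrK mul1r mulr_gt0.
  - rlra.
  move: ez; rewrite coord ez' /lerp => -[] e1 e2; congr (_, _); rlra.
(* slide the tip back along the previous segment *)
have [f3 [am3 fx3 mv3]] : carries os1 x a2 c.
  have sub (s' : R) : 0 <= s' <= 1 -> lerp a2 c s' = (c.1 + (1 - s') * tau * (c.1 - x.1), c.2 + (1 - s') * tau * (c.2 - x.2)).
    by move=> hs'; rewrite /a2 /lerp /=; congr (_, _); ring.
  have nxc (t : R) : 0 < t -> x <> lerp x c t.
    move=> t00 e; have : n1 x (lerp x c t) <= 0 by rewrite -e /n1 !subrr normr0 addr0.
    rewrite n1_lerp ?(ltW t00) // => h; apply: xc; apply: n1_eq0; rnra.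
  have sub' (s' : R) : lerp a2 c s' = lerp x c (1 + (1 - s') * tau).
    by rewrite /a2 /lerp /=; congr (_, _); ring.
  apply: carries_swing => s' hs'; rewrite sub'; first by apply: nxc; rnra.
  move=> o z ho hz [t [ht]]; rewrite -/(lerp _ _ _) => ez.
  have ez2 : z = lerp x c (t * (1 + (1 - s') * tau)).
    by rewrite ez /lerp /=; congr (_, _); ring.
  have w1 : 0 <= t * (1 + (1 - s') * tau).
    by apply: mulr_ge0; [rlra | apply: addr_ge0; [rlra | apply: mulr_ge0; rlra]].
  have /orP[l1|l1] := le_total (t * (1 + (1 - s') * tau)) 1.
    have hxc : seg x c z by rewrite ez2; apply: seg_lerp; rewrite w1 l1.
    move: ho; rewrite mem_cat => /orP[ho|ho].
      have zh : z = head x s.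
        by apply: (dis o) => //; rewrite polyline_rcons polyline_rcons; left; right.
      by case: hd => [|h]; rewrite zh // ; apply: d3 => //; rewrite -zh.
    by apply: d3 => //; apply/polylineP; exists o.
  exfalso; have := hr o z ho hz.
  have -> : z = lerp c x (- (t * (1 + (1 - s') * tau) - 1)).
    by rewrite ez2 /lerp /=; congr (_, _); ring.
  set w := t * _ - 1.
  have hw : 0 <= w <= tau.
    have h1 : (1 - s') * tau <= 1 * tau by apply: ler_wpM2r; rlra.
    have h2 : 0 <= (1 - s') * tau by apply: mulr_ge0; rlra.
    have : t * (1 + (1 - s') * tau) <= 1 * (1 + (1 - s') * tau) by apply: ler_wpM2r; rlra.
    by rewrite /w; rlra.
  have -> : n1 c (lerp c x (- w)) = w * n1 c x.
    rewrite /n1 /lerp /=.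
    have -> : c.1 - ((1 - - w) * c.1 + - w * x.1) = - (w * (c.1 - x.1)) by ring.
    have -> : c.2 - ((1 - - w) * c.2 + - w * x.2) = - (w * (c.2 - x.2)) by ring.
    by rewrite !normrN !normrM ger0_norm ?mulrDr //; rlra.
  by rewrite /D in tD; rnra.
have s1 : {subset os <= os1} by move=> o ho; rewrite mem_cat ho.
have s2 : {subset os1 <= (x, c) :: os1} by move=> o ho; rewrite inE ho orbT.
have sx : {subset segs (rcons s x) <= os1} by move=> o ho; rewrite mem_cat ho orbT.
exists (f3 \o (f2 \o f1)); split.
- by apply: amb_comp => //; apply: amb_comp.
- apply: fixes_comp; last exact: fixes_sub fx3.
  by apply: (fixes_sub s1); apply: (fixes_sub s2); apply: fixes_comp.
- have -> A : (f3 \o (f2 \o f1)) @` A = f3 @` (f2 @` (f1 @` A)) by rewrite !image_comp.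
  rewrite (polyline_rcons (rcons s x)) (polyline_rcons s) !image_setU.
  have i1 f : fixes os1 f -> f @` polyline (rcons s x) = polyline (rcons s x).
    by move=> hf; apply: fix_img => z; apply: fixes_polyline hf.
  have i2 f : fixes ((x, c) :: os1) f -> f @` seg x c = seg x c.
    by move=> hf; apply: fix_img => z; apply: (hf (x, c)); rewrite mem_head.
  rewrite !i1 ?(i2 f1) ?(i2 f2) //; try exact: (fixes_sub s2).
  rewrite (carries_img mv1) (carries_img mv2) -setUA -image_setU.
  congr (_ `|` _).
  have -> : seg x c `|` seg c a2 = seg x a2.
    have t2 : 0 < 1 + tau by rlra.
    have ec : c = lerp x a2 (1 + tau)^-1.
      by rewrite [LHS]surjective_pairing /a2 /lerp /=; congr (_, _); field; rewrite gt_eqF.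
    have ht : 0 <= (1 + tau)^-1 <= 1 by rewrite invr_ge0 invf_le1 //; rlra.
    have hc : seg x a2 c by rewrite ec; apply: seg_lerp.
    apply/seteqP; split=> z.
      move=> [|]; apply: seg_sub => //; [exact: seg_l|exact: seg_r].
    move=> hz; have [h|h] := @seg_split _ c x a2 z hc hz; [left|right] => //.
    by rewrite seg_sym.
  exact: carries_img mv3.
- by rewrite /= -{1}(lerp1 c a) mv1 ?mv2 ?lerp1 ?ler01 ?lexx // -{1}(lerp1 x a2) mv3 ?lerp1 // ler01 lexx.
Qed.

(** Segments are retracted one by one from the free end, and the one left at the foot is
    shortened. *)
Lemma shrink_polyline os s x c (eps : R) : 0 < eps ->
  simple_polyline (x :: c :: s) ->
  (forall o z, o \in os -> seg o.1 o.2 z -> polyline (x :: c :: s) z -> z = x) ->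
  exists f t, [/\ amb f, fixes os f, 0 < t <= 1 /\ n1 x (lerp x c t) < eps,
    f @` polyline (x :: c :: s) = seg x (lerp x c t) & f (last c s) = lerp x c t].
Proof.
move=> e0; elim/last_ind: s => [|s a IH] hs dis.
  have xc : x <> c by case: hs => _ [/(_ 0%N isT)/eqP].
  have nn := n1_ge0 x c.
  pose t := Num.min 1 (eps / (2 * (n1 x c + 1))).
  have t0 : 0 < t by rewrite /t lt_min ltr01 divr_gt0 //; rlra.
  have t1 : t <= 1 by rewrite /t ge_min lexx.
  have tD : t * (2 * (n1 x c + 1)) <= eps by rewrite -ler_pdivlMr ?ge_min ?lexx ?orbT //; rlra.
  have [f [am fx mv]] : carries os x c (lerp x c t).
    have sub (s' : R) : lerp c (lerp x c t) s' = lerp x c ((1 - s') + s' * t).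
      by rewrite /lerp /=; congr (_, _); ring.
    apply: carries_swing => s' hs'; rewrite sub.
      have st : 0 < 1 - s' + s' * t.
        have h : (1 - s') * t <= (1 - s') * 1 by apply: ler_wpM2l; rlra.
        rlra.
      move=> e; have : n1 x (lerp x c (1 - s' + s' * t)) <= 0 by rewrite -e /n1 !subrr normr0 addr0.
      rewrite n1_lerp ?(ltW st) //.
      move=> h; apply: xc; apply: n1_eq0; rnra.
    move=> o z ho hz hz'; apply: (dis o) => //; rewrite polyline_cons; left.
    by apply: seg_sub hz'; [exact: seg_l | apply: seg_lerp; have := ltW t0; rnra].
  exists f, t; split=> //.
  - by rewrite t0 t1 n1_lerp ?(ltW t0) //; split=> //; rnra.
  - by rewrite polyline_cons polyline1 setU0; apply: carries_img.
  - by have := mv 1; rewrite !lerp1 => -> //; rlra.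
have [s0 [y [b eb]]] : exists s0 y, exists b, x :: c :: s = rcons (rcons s0 y) b.
  case/lastP: s {IH hs dis} => [|s b]; first by exists [::], x, c.
  case/lastP: s => [|s y]; first by exists [:: x], c, b.
  by exists (x :: c :: s), y, b.
have hh : head x (rcons s0 y) = x by case: s0 eb => [|z s0] /= [-> _].
move: (hs) (dis); rewrite -!rcons_cons eb => hs' dis'.
have hs2 : simple_polyline (x :: c :: s) by exact: (@simple_rcons (x :: c :: s) a isT hs).
have [f1 [am1 fx1 im1 tip1]] : exists f, [/\ amb f, fixes os f,
    f @` polyline (rcons (rcons (rcons s0 y) b) a) = polyline (rcons (rcons s0 y) b) & f a = b].
  apply: retract_last => // o z ho hz hp; rewrite (dis' o z ho hz hp).
  by case: (s0) hh => [|w s1] /= ->.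
have [||f2 [t [am2 fx2 ht im2 tip2]]] := IH.
- exact: hs2.
- by move=> o z ho hz hp; apply: (dis o) => //; rewrite -!rcons_cons; apply: polyline_rconsS.
exists (f2 \o f1), t; split=> //.
- exact: amb_comp.
- exact: fixes_comp.
- by rewrite -image_comp im1 -eb.
- rewrite last_rcons /= tip1 -tip2; congr f2.
  by have := congr1 (last x) eb; rewrite /= last_rcons.
Qed.

End Retract.

(** * Coordinates of the room and of the two drawings *)

Section Layout.
Variables (R : realType) (k : nat).
Local Notation pt := (R * R)%type.

(* The room is the open rectangle [- width < x < 0, 0 < y < height]; the curve number [i] runs from
   the floor point [wp i] to [vp i] in the given drawing, to [vp0 i] in the reference drawing. *)
Definition width : R := (2 * k + 2)%:R.
(** Greater than [width], so that strands from the floor are steep; see [X_w]. *)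
Definition gate : R := (2 * k + 3)%:R.
Definition height : R := (2 * k + 5)%:R.
Definition wp (i : nat) : pt := (- (2 * i)%:R, 0).
Definition vp (i : nat) : pt := if i == 1%N then (-1, gate + 1) else (3 - (2 * i)%:R, 1).
Definition vp0 (i : nat) : pt := (- (2 * i)%:R, 1 / 2).
Definition inside (z : pt) : Prop := - width < z.1 < 0 /\ 0 < z.2 < height.

Lemma natrR (m n : nat) : (m <= n)%N -> m%:R <= n%:R :> R.
Proof. by rewrite ler_nat. Qed.

Lemma widthE : width = 2 * k%:R + 2. Proof. by rewrite /width natrD natrM. Qed.
Lemma gateE : gate = 2 * k%:R + 3. Proof. by rewrite /gate natrD natrM. Qed.
Lemma heightE : height = 2 * k%:R + 5. Proof. by rewrite /height natrD natrM. Qed.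
Lemma wpE i : wp i = (- (2 * i%:R), 0). Proof. by rewrite /wp natrM. Qed.
Lemma vp1 : vp 1 = (-1, gate + 1). Proof. by []. Qed.
Lemma vpE i : (2 <= i)%N -> vp i = (3 - 2 * i%:R, 1).
Proof. by rewrite /vp natrM; case: i => [|[|i]]. Qed.
Lemma vp0E i : vp0 i = (- (2 * i%:R), 1 / 2). Proof. by rewrite /vp0 natrM. Qed.
Lemma natk0 : 0 <= k%:R :> R. Proof. exact: ler0n. Qed.

Lemma vp_inside i : (1 <= i <= k)%N -> inside (vp i).
Proof.
move=> /andP[i1 ik]; have := natrR i1; have := natrR ik; have := natk0.
rewrite /inside widthE heightE; case: (ltngtP i 1) => [|i2|->]; first by lia.
  have := natrR i2; rewrite vpE //=; lra.
by rewrite vp1 gateE /=; lra.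
Qed.

End Layout.

(** * Isotopy from any drawing of pendant curves to the reference drawing *)

Section Reference.
Variables (R : realType) (k : nat).
Local Notation pt := (R * R)%type.
Implicit Types (z : pt) (f : pt -> pt) (os : seq (pt * pt)) (ob : nat -> seq (pt * pt)) (tip : nat -> pt).
Local Notation wp := (@wp R).
Local Notation vp := (@vp R k).
Local Notation vp0 := (@vp0 R).
Local Notation inside := (@inside R k).

Definition uni (ob : seq (pt * pt)) : set pt := [set z | exists2 o, o \in ob & seg o.1 o.2 z].

Lemma uni_segs s : uni (segs s) = polyline s.
Proof. by apply/seteqP; split=> z h; apply/polylineP. Qed.

Lemma uni1 (o : pt * pt) : uni [:: o] = seg o.1 o.2.
Proof.
apply/seteqP; split=> z; first by case=> o'; rewrite inE => /eqP->.
by exists o; rewrite ?mem_head.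
Qed.

Lemma uni0 : uni [::] = set0.
Proof. by apply/seteqP; split=> z //; case. Qed.

Variable os : seq (pt * pt).

(* [ob m] lists the segments still present of the [m]-th curve, [tip m] is its free end. *)
Definition moves ob tip ob' tip' := exists f,
  [/\ amb f, fixes os f & forall m, (1 <= m <= k)%N -> f @` uni (ob m) = uni (ob' m) /\ f (tip m) = tip' m].

Lemma moves_refl ob tip : moves ob tip ob tip.
Proof. by exists id; split=> //; [exact: amb_id | move=> m _; rewrite image_id]. Qed.

Lemma moves_trans ob tip ob' tip' ob'' tip'' :
  moves ob tip ob' tip' -> moves ob' tip' ob'' tip'' -> moves ob tip ob'' tip''.
Proof.
move=> [f [af ff hf]] [g [ag fg hg]]; exists (g \o f); split.
- exact: amb_comp.
- exact: fixes_comp.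
- by move=> m hm; have [h1 h2] := hf m hm; rewrite -image_comp h1 /= h2; apply: hg.
Qed.

(** The degenerate segment at [tip m] also pins down the vertices whose curve is not present. *)
Definition others (ob : nat -> seq (pt * pt)) (tip : nat -> pt) l :=
  os ++ flatten [seq (tip m, tip m) :: ob m | m <- iota 1 k & m != l].

Lemma mem_others ob tip l o : o \in others ob tip l ->
  o \in os \/ exists m, [/\ (1 <= m <= k)%N, m != l & o = (tip m, tip m) \/ o \in ob m].
Proof.
rewrite mem_cat => /orP[H|H]; first (by left); right.
move: H => /flattenP[s /mapP[m]]; rewrite mem_filter mem_iota => /andP[ml hm] ->.
rewrite inE => ho; exists m; split=> //.
by case/orP: ho => [/eqP|]; [left|right].
Qed.

Lemma moves_one ob tip l (ob' : seq (pt * pt)) (tip' : pt) f : (1 <= l <= k)%N ->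
  amb f -> fixes (others ob tip l) f -> f @` uni (ob l) = uni ob' -> f (tip l) = tip' ->
  moves ob tip (fun m => if m == l then ob' else ob m) (fun m => if m == l then tip' else tip m).
Proof.
move=> hl af ff h1 h2; exists f; split=> //.
  by apply: fixes_sub ff => o ho; rewrite mem_cat ho.
move=> m hm; case: (eqVneq m l) => [->|ml] //.
have mem o : o \in (tip m, tip m) :: ob m -> o \in others ob tip l.
  move=> ho; rewrite mem_cat; apply/orP; right; apply/flattenP.
  exists ((tip m, tip m) :: ob m) => //; apply/mapP; exists m => //.
  by rewrite mem_filter ml mem_iota; nlia.
split; last by apply: (ff (tip m, tip m)); [apply: mem; rewrite mem_head | exact: seg_l].
apply: fix_img => z; case=> o ho hz; apply: (ff o) => //; apply: mem.
by rewrite inE ho orbT.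
Qed.

Hypothesis os_out : forall o z, o \in os -> seg o.1 o.2 z -> ~ inside z.

Variables (i : nat) (pl : nat -> seq pt).
Hypothesis ik : (i <= k)%N.
Hypothesis pl_simple : forall l, (1 <= l <= i)%N -> simple_polyline (pl l).
Hypothesis pl_shape : forall l, (1 <= l <= i)%N -> exists c s, pl l = wp l :: c :: s /\ last c s = vp l.
Hypothesis pl_in : forall l z, (1 <= l <= i)%N -> polyline (pl l) z -> z = wp l \/ inside z.
Hypothesis pl_dis : forall l m z, (1 <= l <= i)%N -> (1 <= m <= i)%N -> l != m ->
  polyline (pl l) z -> ~ polyline (pl m) z.
Hypothesis pl_vp : forall l m, (1 <= l <= i)%N -> (1 <= m <= k)%N -> l != m -> ~ polyline (pl l) (vp m).
Ltac reals := repeat match goal with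
  | H : is_true (@Order.le _ _ _ _) |- _ => revert H
  | H : is_true (@Order.lt _ _ _ _) |- _ => revert H
  | H : is_true (andb (@Order.le _ _ _ _) _) |- _ => revert H
  | H : is_true (andb (@Order.lt _ _ _ _) _) |- _ => revert H
  | H : @eq ?T _ _ |- _ => unify T (Real.sort R); revert H
  end.
Ltac rlra := solve [reals; clear -os_out ik pl_simple pl_shape pl_in pl_dis pl_vp; intros; lra] || lra.
Ltac rnra := solve [reals; clear -os_out ik pl_simple pl_shape pl_in pl_dis pl_vp; intros; nra] || nra.

Definition ob_init m := if (m <= i)%N then segs (pl m) else [::].

(** Each stub lies in the curve that it came from, so it stays disjoint from the curves still to be
    shrunk. *)
Lemma shrink_stage j : (j <= i)%N -> exists ob tip, [/\ moves ob_init vp ob tip,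
  forall m, (1 <= m <= j)%N -> ob m = [:: (wp m, tip m)] /\ n1 (wp m) (tip m) < 1 / 4,
  forall m, (1 <= m <= j)%N -> inside (tip m) /\ (seg (wp m) (tip m) `<=` polyline (pl m)) &
  forall m, (j < m)%N -> ob m = ob_init m /\ tip m = vp m].
Proof.
elim: j => [|j IH] ji.
  by exists ob_init, vp; split=> //; [exact: moves_refl | nlia | nlia].
case: (IH (ltnW ji)) => ob [tip [mv h1 h2 h3]].
have hl : (1 <= j.+1 <= i)%N by rewrite ji.
have [c [s [e el]]] := pl_shape hl.
have obl : ob j.+1 = segs (pl j.+1) by have [-> _] := h3 j.+1 (ltnSn j); rewrite /ob_init ji.
have tipl : tip j.+1 = vp j.+1 by have [_ ->] := h3 j.+1 (ltnSn j).
have := @shrink_polyline _ (others ob tip j.+1) s (wp j.+1) c (1 / 4).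
rewrite -e => /(_ ltac:(rlra) (pl_simple hl)).
case.
  move=> o z /mem_others[ho|[m [hm ml ho]]] hz hp.
    by case: (pl_in hl hp) => // /(os_out ho hz).
  exfalso; case: (leqP m j) => mj.
    have hm1 : (1 <= m <= j)%N by nlia.
    have hm2 : (1 <= m <= i)%N by nlia.
    have o1 := (h1 m hm1).1; have [_ sub] := h2 m hm1.
    apply: (pl_dis hm2 hl ml _ hp); apply: sub.
    by case: ho => [eo|]; [move: hz; rewrite eo => /segxx ->; exact: seg_r | rewrite o1 inE => /eqP eo; rewrite eo in hz].
  have [e1 t1] := h3 m mj; rewrite e1 t1 in ho.
  have tipm : o = (vp m, vp m) -> False.
    by move=> eo; move: hz hp; rewrite eo => /segxx /= ->; apply: pl_vp => //; rewrite eq_sym.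
  case: ho => // ho; rewrite /ob_init in ho; case: (leqP m i) ho => mi // ho.
  by apply: (pl_dis (l := m) (m := j.+1) _ hl ml _ hp); [nlia | apply/polylineP; exists o].
move=> f [t [am fx [ht nt] im tp]].
have tin : inside (lerp (wp j.+1) c t).
  have hp : polyline (pl j.+1) (lerp (wp j.+1) c t).
    by rewrite e polyline_cons; left; apply: seg_lerp; rlra.
  case: (pl_in hl hp) => // e0; exfalso.
  have : n1 (wp j.+1) (lerp (wp j.+1) c t) <= 0 by rewrite e0 /n1 !subrr normr0 addr0.
  rewrite n1_lerp; last by rlra.
  move=> le0; have : wp j.+1 = c by apply: n1_eq0; rnra.
  have := pl_simple hl; rewrite e => -[_ [/(_ 0%N isT) /= ne _]] e1.
  by rewrite -e1 eqxx in ne.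
have mv1 := @moves_one ob tip j.+1 [:: (wp j.+1, lerp (wp j.+1) c t)] (lerp (wp j.+1) c t) f.
exists (fun m => if m == j.+1 then [:: (wp j.+1, lerp (wp j.+1) c t)] else ob m),
  (fun m => if m == j.+1 then lerp (wp j.+1) c t else tip m); split.
- apply: moves_trans mv (mv1 _ am fx _ _); first by nlia.
    by rewrite obl uni_segs uni1.
  by rewrite tipl -el.
- move=> m hm; case: (eqVneq m j.+1) => [->|mj] //; by apply: h1; nlia.
- move=> m hm; case: (eqVneq m j.+1) => [->|mj]; last by apply: h2; nlia.
  split=> // z hz; rewrite e polyline_cons; left.
  by apply: seg_sub hz; [exact: seg_l | apply: seg_lerp; rlra].
- by move=> m hm; rewrite gtn_eqF //; apply: h3; nlia.
Qed.

Lemma carries_moves ob tip l (tip' : pt) : (1 <= l <= k)%N -> carries (others ob tip l) (wp l) (tip l) tip' ->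
  (ob l = [::] \/ ob l = [:: (wp l, tip l)]) ->
  moves ob tip (fun m => if m == l then (if ob l is [::] then [::] else [:: (wp l, tip')]) else ob m)
    (fun m => if m == l then tip' else tip m).
Proof.
move=> hl [f [am fx mv]] hob; apply: (moves_one hl am fx).
  case: hob => ->; first by rewrite uni0 image_set0.
  by rewrite !uni1 /=; apply: carries_img.
by have := mv 1; rewrite !lerp1; apply; rlra.
Qed.

Lemma near_coord (p q : pt) : n1 p q < 1 / 4 -> `|q.1 - p.1| < 1 / 4 /\ `|q.2 - p.2| < 1 / 4.
Proof.
rewrite /n1 (distrC p.1) (distrC p.2).
by move: (normr_ge0 (q.1 - p.1)) (normr_ge0 (q.2 - p.2)); split; rlra.
Qed.

(** Feet are two apart, so stubs that deviate by less than [1 / 4] can be swung upright in disjoint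
    vertical strips. *)
Lemma stub_stage j : (j <= i)%N -> exists ob tip, [/\ moves ob_init vp ob tip,
  forall m, (1 <= m <= i)%N -> ob m = [:: (wp m, tip m)],
  forall m, (1 <= m <= i)%N -> inside (tip m) /\ `|(tip m).1 + 2 * m%:R| < 1 / 4,
  forall m, (1 <= m <= j)%N -> tip m = vp0 m &
  (forall m, (j < m <= i)%N -> (tip m).2 < 1 / 4) /\
  forall m, (i < m)%N -> ob m = [::] /\ tip m = vp m].
Proof.
have k0 := @natk0 R k.
elim: j => [|j IH] ji.
  case: (shrink_stage (leqnn i)) => ob [tip [mv h1 h2 h3]].
  have near m : (1 <= m <= i)%N -> `|(tip m).1 + 2 * m%:R| < 1 / 4 /\ `|(tip m).2| < 1 / 4.
    move=> hm; have [_ hn] := h1 m hm.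
    by have [a b] := near_coord hn; move: a b; rewrite wpE /= subr0 opprK.
  exists ob, tip; split=> //.
  - by move=> m hm; have [-> _] := h1 m hm.
  - by move=> m hm; split; [have [] := h2 m hm | have [] := near m hm].
  - by move=> m; nlia.
  split; last by move=> m im; have [-> ->] := h3 m im; rewrite /ob_init leqNgt im.
  move=> m hm; have [_] := near m ltac:(nlia); exact: le_lt_trans (ler_norm _).
case: (IH (ltnW ji)) => ob [tip [mv h1 h2 h3 [h4 h5]]].
set l := j.+1; have hl : (1 <= l <= i)%N by rewrite /l ji.
have [tin tnear] := h2 l hl; have ty := h4 l ltac:(nlia).
move: (tin) => [tx /andP[ty0 _]]; move: tnear; rewrite ltr_norml => tnear.
have lk : l%:R <= k%:R :> R by apply: natrR; nlia.
have l1 : 1 <= l%:R :> R by apply: (natrR R (m := 1)); nlia.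
have pts (s t : R) z : 0 <= s <= 1 -> 0 <= t <= 1 ->
    z = lerp (wp l) (lerp (tip l) (vp0 l) s) t ->
    [/\ - (1 / 4) < z.1 + 2 * l%:R < 1 / 4, 0 <= z.2 <= 1 / 2 & 0 < t -> inside z].
  move=> hs ht ->; rewrite wpE vp0E /lerp /=.
  set x := (tip l).1 in tx tnear *; set y := (tip l).2 in ty ty0 *.
  have e1 : (1 - t) * (- (2 * l%:R)) + t * ((1 - s) * x + s * (- (2 * l%:R))) =
    - (2 * l%:R) + (t * (1 - s)) * (x + 2 * l%:R) by ring.
  have a0 : 0 <= t * (1 - s) by apply: mulr_ge0; rlra.
  have a1 : t * (1 - s) <= 1 by rnra.
  have b0 : 0 <= t * s by apply: mulr_ge0; rlra.
  have ab : t * (1 - s) + t * s = t by ring.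
  rewrite e1; move: (t * (1 - s)) (t * s) a0 a1 b0 ab => a b a0 a1 b0 ab.
  have e2 : (1 - t) * 0 + t * ((1 - s) * y + s * (1 / 2)) = t * ((1 - s) * y + s * (1 / 2)) by ring.
  rewrite e2.
  have y1 : 0 < (1 - s) * y + s * (1 / 2) <= 1 / 2 by rnra.
  rewrite /inside /= widthE heightE.
  have q1 : - (1 / 4) < a * (x + 2 * l%:R) < 1 / 4 by rnra.
  split; [rlra | rnra | move=> t0; split; [rlra | rnra]].
have cr : carries (others ob tip l) (wp l) (tip l) (vp0 l).
  apply: carries_swing => s hs.
    have [_ _ /(_ ltr01)] := pts s 1 _ hs ltac:(rlra) erefl; rewrite lerp1 => -[_ /andP[h _]] e.
    by move: h; rewrite -e wpE /= ltxx.
  move=> o z ho hz [t [ht]]; rewrite -/(lerp _ _ _) => ez.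
  have [p1 p2 p3] := pts s t z hs ht ez.
  have [t0|t0] := eqVneq t 0; first by rewrite ez t0 lerp0.
  have zin : inside z by apply: p3; rewrite lt_def t0 /=; rlra.
  exfalso; case: (mem_others ho) => [/os_out/(_ hz)//|[m [hm ml mo]]].
  case: (leqP m i) => mi.
    have hmi : (1 <= m <= i)%N by case/andP: hm => ->.
    have [_] := h2 m hmi; rewrite ltr_norml => tn.
    have zn : - (1 / 4) <= z.1 + 2 * m%:R <= 1 / 4.
      case: mo => [eo|].
        by move: hz; rewrite eo => /segxx -> /=; rlra.
      rewrite h1 // inE => /eqP eo; move: hz; rewrite eo wpE => -[r [hr ->]] /=.
      have h : - (1 / 4) <= r * ((tip m).1 + 2 * m%:R) <= 1 / 4 by rnra.
      rlra.
    case: (ltngtP m l) ml => // ml _.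
      have mR : m%:R + 1 <= l%:R :> R by rewrite natr1; apply: natrR.
      by move: mR zn p1; rlra.
    have mR : l%:R + 1 <= m%:R :> R by rewrite natr1; apply: natrR.
    by move: mR zn p1; rlra.
  have [e1 t1] := h5 m mi; rewrite e1 t1 in mo; case: mo => // eo.
  move: hz; rewrite eo => /segxx /= ez2; move: p2; rewrite ez2 /vp gateE.
  by case: ifP => _ /=; rlra.
exists (fun m => if m == l then (if ob l is [::] then [::] else [:: (wp l, vp0 l)]) else ob m),
  (fun m => if m == l then vp0 l else tip m); split.
- by apply: moves_trans mv (carries_moves _ cr _); [nlia | right; apply: h1].
- by move=> m hm; case: (eqVneq m l) => [->|ml]; [rewrite h1 | apply: h1].
- move=> m hm; case: (eqVneq m l) => [->|ml]; last exact: h2.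
  have [_ _ /(_ ltr01)] := pts 1 1 _ ltac:(rlra) ltac:(rlra) erefl; rewrite !lerp1 => vi; split=> //.
  by rewrite vp0E /= addNr normr0; rlra.
- by move=> m hm; case: (eqVneq m l) => [->|ml] //; apply: h3; nlia.
- split=> m hm; first by rewrite gtn_eqF; [apply: h4; nlia | nlia].
  by rewrite gtn_eqF; [apply: h5 | nlia].
Qed.

(** A vertex without a curve is moved as the free end of an imaginary segment from its foot, which
    reduces this case to [carries_swing]. *)
Lemma free_stage j : (i <= j <= k)%N -> exists ob tip, [/\ moves ob_init vp ob tip,
  forall m, (1 <= m <= i)%N -> ob m = [:: (wp m, vp0 m)],
  forall m, (i < m)%N -> ob m = [::],
  forall m, (1 <= m <= j)%N -> tip m = vp0 m &
  forall m, (j < m)%N -> tip m = vp m].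
Proof.
have k0 := @natk0 R k.
elim: j => [|j IH] /andP[ij jk].
  case: (stub_stage (leqnn i)) => ob [tip [mv h1 h2 h3 [h4 h5]]].
  exists ob, tip; split=> //; try (by move=> m; nlia); try by move=> m hm; have [] := h5 m ltac:(nlia).
case: (ltnP j i) => ji.
  have eij : i = j.+1 by nlia.
  case: (stub_stage (leqnn i)) => ob [tip [mv h1 h2 h3 [h4 h5]]].
  exists ob, tip; split=> //.
  - by move=> m hm; rewrite h1 // h3.
  - by move=> m hm; have [] := h5 m hm.
  - by move=> m hm; apply: h3; nlia.
  - by move=> m hm; have [] := h5 m ltac:(nlia).
case: (IH ltac:(nlia)) => ob [tip [mv h1 h2 h3 h4]].
set l := j.+1; have hl : (1 <= l <= k)%N by rewrite /l jk.
have lk : l%:R <= k%:R :> R by apply: natrR; nlia.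
have l1 : 1 <= l%:R :> R by apply: (natrR R (m := 1)); nlia.
have tl : tip l = vp l by apply: h4.
have ob0 : ob l = [::] by apply: h2; rewrite /l; nlia.
have pts (s t : R) : 0 <= s <= 1 -> 0 <= t <= 1 -> exists a b, [/\ 0 <= a, 0 <= b, a + b = t &
    lerp (wp l) (lerp (vp l) (vp0 l) s) t = 
      (- (2 * l%:R) + a * ((vp l).1 + 2 * l%:R), a * (vp l).2 + b * (1 / 2))].
  move=> hs ht; exists (t * (1 - s)), (t * s); split; [apply: mulr_ge0; rlra|apply: mulr_ge0; rlra|ring|].
  by rewrite wpE vp0E /lerp /=; congr (_, _); ring.
have vl : ((l = 1)%N /\ vp l = (-1, 2 * k%:R + 4)) \/ (2 <= l%:R :> R /\ vp l = (3 - 2 * l%:R, 1)).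
  case: (ltngtP l 1) => [|l2|->]; first by nlia.
    by right; rewrite vpE //; split=> //; apply: (natrR R (m := 2)).
  by left; rewrite vp1 gateE; split=> //; congr (_, _); ring.
have ins (a b : R) : 0 <= a -> 0 <= b -> a + b <= 1 -> 0 < a + b ->
    inside (- (2 * l%:R) + a * ((vp l).1 + 2 * l%:R), a * (vp l).2 + b * (1 / 2)).
  move=> a0 b0 ab ab0; rewrite /inside widthE heightE /=.
  by case: vl => -[e ->] /=; [rewrite e /= in lk l1 * |]; split; rnra.
have cr : carries (others ob tip l) (wp l) (tip l) (vp0 l).
  rewrite tl; apply: carries_swing => s hs.
    have [a [b [a0 b0 ab]]] := pts s 1 hs ltac:(rlra); rewrite lerp1 => -> e.
    by have [_] := ins a b a0 b0 ltac:(rlra) ltac:(rlra); rewrite -e wpE /= ltxx.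
  move=> o z ho hz [t [ht]]; rewrite -/(lerp _ _ _) => ez.
  have [t0|t0] := eqVneq t 0; first by rewrite ez t0 lerp0.
  have tp : 0 < t by rewrite lt_def t0 /=; rlra.
  have [a [b [a0 b0 ab e]]] := pts s t hs ht; rewrite e in ez.
  have zin : inside z by rewrite ez; apply: ins; rlra.
  exfalso; case: (mem_others ho) => [/os_out/(_ hz)//|[m [hm ml mo]]].
  case: (ltngtP m l) ml => // ml _.
    have mR : m%:R + 1 <= l%:R :> R by rewrite natr1; apply: natrR.
    have mR1 : 1 <= m%:R :> R by apply: (natrR R (m := 1)); case/andP: hm.
    have tm : tip m = vp0 m by apply: h3; clear -hm ml; nlia.
    have [zx zy] : z.1 = - (2 * m%:R) /\ z.2 <= 1 / 2.
      case: mo => [eo|].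
        by move: hz; rewrite eo tm vp0E => /segxx -> /=; split; rlra.
      case: (leqP m i) => mi; last by rewrite h2.
      rewrite h1; last by clear -hm mi; nlia.
      rewrite inE => /eqP eo; move: hz; rewrite eo wpE vp0E => -[r [hr ->]] /=.
      by split; rnra.
    (* Of the upright stubs to the right only the one at [w_(l-1)] is within reach; there the
       imaginary segment is at height at least [2 / 3], and the stub ends at [1 / 2]. *)
    have dm : l%:R - m%:R = 1 :> R \/ 2 <= l%:R - m%:R :> R.
      case: (ltngtP m.+1 l) => lm; [right|by clear -lm ml; nlia|left].
        have : m.+1%:R + 1 <= l%:R :> R by rewrite natr1; apply: natrR.
        by rewrite -natr1; rlra.
      by rewrite -lm -natr1; ring.
    move: zx zy; rewrite ez; case: vl => -[e' ->] /=; first by rewrite e' /= in mR; rlra.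
    by case: dm => dm; rnra.
  have mR : l%:R + 1 <= m%:R :> R by rewrite natr1; apply: natrR.
  have m2 : (2 <= m)%N by clear -hl ml; nlia.
  have mi : (i < m)%N by clear -ji ml; nlia.
  rewrite h2 // h4 in mo; last by clear -ml; nlia.
  case: mo => // eo.
  move: hz; rewrite eo => /segxx; rewrite vpE //= ez => -[] zx zy.
  move: zx zy; case: vl => -[e' ->] /=; last by rnra.
  move=> zx zy; rewrite e' /= in zx mR.
  have a1 : a = 5 - 2 * m%:R by rlra.
  have : a = 1.
    have : (m <= 2)%N by rewrite leqNgt; apply/negP => m3; have := natrR R m3; rlra.
    by move=> m2'; rewrite a1 (_ : m = 2%N); [ring | clear -m2 m2'; nlia].
  by move=> a1'; rewrite a1' in zy; rlra.
exists (fun m => if m == l then (if ob l is [::] then [::] else [:: (wp l, vp0 l)]) else ob m),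
  (fun m => if m == l then vp0 l else tip m); split.
- by apply: moves_trans mv (carries_moves _ cr _); [nlia | left].
- by move=> m hm; rewrite ltn_eqF; [apply: h1 | rewrite /l; nlia].
- by move=> m hm; case: (eqVneq m l) => _; [rewrite ob0 | apply: h2].
- by move=> m hm; case: (eqVneq m l) => [->|ml] //; apply: h3; nlia.
- by move=> m hm; rewrite gtn_eqF; [apply: h4; nlia | nlia].
Qed.

Lemma iso_reference : exists f, [/\ amb f, fixes os f,
  forall m, (1 <= m <= k)%N -> f (vp m) = vp0 m &
  forall m, (1 <= m <= i)%N -> f @` polyline (pl m) = seg (wp m) (vp0 m)].
Proof.
case: (free_stage (j := k) ltac:(rewrite ik leqnn //)) => ob [tip [[f [am fx mv]] h1 h2 h3 h4]].
exists f; split=> // m hm.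
  by have [_ ->] := mv m hm; apply: h3.
have [+ _] := mv m ltac:(nlia); rewrite /ob_init.
by case/andP: (hm) => _ ->; rewrite uni_segs h1 // uni1.
Qed.

End Reference.

(** * Arrangements of strands: order and nesting *)

Section Arrangement.
Variables (R : realType) (k : nat).
Local Notation pt := (R * R)%type.
Implicit Types (a b p q z : pt) (y : R) (d : nat).
Local Notation wp := (@wp R).
Local Notation vp := (@vp R k).
Local Notation gate := (@gate R k).
Local Notation inside := (@inside R k).

Lemma sdE b v p : b.2 < v.2 -> sd b v p = (p.1 - xat b v p.2) * (v.2 - b.2).
Proof. by move=> h; rewrite /sd /xat; field; rewrite subr_eq0 gt_eqF. Qed.

Lemma sd_gt0 b v p : b.2 < v.2 -> (0 < sd b v p) = (xat b v p.2 < p.1).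
Proof. by move=> h; rewrite sdE // pmulr_lgt0 ?subr_gt0. Qed.

Lemma sd_lt0 b v p : b.2 < v.2 -> (sd b v p < 0) = (p.1 < xat b v p.2).
Proof. by move=> h; rewrite sdE // pmulr_llt0 ?subr_gt0 // subr_lt0. Qed.

Lemma sd_eq0 b v p : b.2 < v.2 -> (sd b v p == 0) = (p.1 == xat b v p.2).
Proof.
move=> h; rewrite sdE // mulf_eq0 subr_eq0 (_ : v.2 - b.2 == 0 = false) ?orbF //.
by rewrite gt_eqF // subr_gt0.
Qed.

Lemma btw_gt b v y : b.2 <= v.2 -> btw b v y <-> b.2 <= y <= v.2.
Proof. by move=> h; rewrite /btw; split=> [[|]|]; [lra|lra|left]. Qed.

Lemma seg_y b v z : b.2 < v.2 -> seg b v z -> b.2 <= z.2 <= v.2 /\ z.1 = xat b v z.2.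
Proof.
move=> h hz; split; first by apply/(btw_gt _ (ltW h)); exact: seg_btw.
by apply: seg_xat => //; rewrite lt_eqF.
Qed.

Lemma seg_x b v y : b.2 < v.2 -> b.2 <= y <= v.2 -> seg b v (xat b v y, y).
Proof. by move=> h hy; apply: xat_seg; [rewrite lt_eqF | left]. Qed.

(** Two segments with a common end that cross the gate in different points lie on different
    lines. *)
Lemma fan_top b b' q (g : R) z : b.2 < g < q.2 -> b'.2 < g < q.2 -> xat b q g < xat b' q g ->
  seg b q z -> seg b' q z -> z = q.
Proof.
move=> h1 h2 lt hz hz'.
have [/andP[_ zq] z1] : b.2 <= z.2 <= q.2 /\ z.1 = xat b q z.2 by apply: seg_y => //; lra.
have [_ z1'] : b'.2 <= z.2 <= q.2 /\ z.1 = xat b' q z.2 by apply: seg_y => //; lra.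
have [e|ne] := eqVneq z.2 q.2.
  rewrite [z]surjective_pairing z1 e xat_r -?surjective_pairing //; lra.
exfalso.
have zq' : z.2 < q.2 by rewrite lt_def eq_sym ne.
have d0 : 0 < q.2 - z.2 by lra.
pose t := (g - z.2) / (q.2 - z.2).
have eg : g = (1 - t) * z.2 + t * q.2 by rewrite /t; field; rewrite gt_eqF.
move: lt; rewrite eg !xat_lin !xat_r ?lt_eqF //; [|lra|lra].
by rewrite -z1 -z1' ltxx.
Qed.

Lemma fan_bot b q q' (g : R) z : b.2 < g < q.2 -> b.2 < g < q'.2 -> xat b q g < xat b q' g ->
  seg b q z -> seg b q' z -> z = b.
Proof.
move=> h1 h2 lt hz hz'.
have [/andP[zb _] z1] : b.2 <= z.2 <= q.2 /\ z.1 = xat b q z.2 by apply: seg_y => //; lra.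
have [_ z1'] : b.2 <= z.2 <= q'.2 /\ z.1 = xat b q' z.2 by apply: seg_y => //; lra.
have [e|ne] := eqVneq z.2 b.2.
  by rewrite [z]surjective_pairing z1 e xat_l -surjective_pairing.
exfalso.
have zb' : b.2 < z.2 by rewrite lt_def ne.
have d0 : 0 < z.2 - b.2 by lra.
pose t := (g - b.2) / (z.2 - b.2).
have eg : g = (1 - t) * b.2 + t * z.2 by rewrite /t; field; rewrite gt_eqF.
by move: lt; rewrite eg !xat_lin !xat_l -z1 -z1' ltxx.
Qed.

Lemma order_disjoint b v b' v' (g : R) y : b.2 < g < v.2 -> b'.2 < g < v'.2 ->
  (forall z, seg b v z -> ~ seg b' v' z) -> xat b v g < xat b' v' g ->
  b.2 <= y <= v.2 -> b'.2 <= y <= v'.2 -> xat b v y < xat b' v' y.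
Proof.
move=> h1 h2 dis lt hy hy'; rewrite ltNge; apply/negP => le.
have [||||||t [_ [_ s1 s2]]] := @xat_cross R b' v' b v g y _ _ _ _ _ _ lt le.
- by rewrite lt_eqF //; lra.
- by rewrite lt_eqF //; lra.
- by left; lra.
- by left.
- by left; lra.
- by left.
exact: dis s2 s1.
Qed.

(* The curves number 1, ..., [i] cut into [2 ^ i - 1] strands, numbered by [d] from left to right
   along the gate; strand [d] joins [bt d] below the gate to [tp d] above it. The numbers 0 and
   [2 ^ i] stand for the two side walls. *)
Record arr (i : nat) (tp bt : nat -> pt) : Prop := Arr {
  arr_bt : forall d, (0 < d < 2 ^ i)%N -> (bt d).2 < gate;
  arr_tp : forall d, (0 < d < 2 ^ i)%N -> gate < (tp d).2;
  arr_lt : forall d d', (0 < d)%N -> (d < d')%N -> (d' < 2 ^ i)%N ->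
    xat (bt d) (tp d) gate < xat (bt d') (tp d') gate;
  (* The middle strands, [2 ^ (i - 1)] above the gate and [3 * 2 ^ (j - 1)] in each block below it,
     are their own partners; these ends are free and lie at the vertices [v_m]. *)
  arr_top : forall d d', (0 < d)%N -> (0 < d')%N -> (d + d' = 2 ^ i)%N -> tp d = tp d';
  arr_bot : forall d d' j, (d < 2 ^ i)%N -> (2 ^ j < d < 2 ^ j.+1)%N -> (d + d' = 3 * 2 ^ j)%N ->
    bt d = bt d';
  arr_disj : forall d d' z, (0 < d)%N -> (d < d')%N -> (d' < 2 ^ i)%N ->
    seg (bt d) (tp d) z -> seg (bt d') (tp d') z ->
    (d + d' = 2 ^ i /\ z = tp d)%N \/
    exists j, [/\ (2 ^ j < d)%N, (d' < 2 ^ j.+1)%N, (d + d' = 3 * 2 ^ j)%N & z = bt d];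
  arr_tin : forall d, (0 < d < 2 ^ i)%N -> inside (tp d);
  arr_bin : forall d j, (d < 2 ^ i)%N -> (2 ^ j < d < 2 ^ j.+1)%N -> inside (bt d);
  arr_w : forall m, (1 <= m <= i)%N -> bt (2 ^ (i - m))%N = wp m;
  arr_v : forall m, (2 <= m <= i)%N -> bt (3 * 2 ^ (i - m))%N = vp m;
  arr_v1 : tp (2 ^ (i - 1))%N = vp 1
}.

Section Consequences.
Variables (i : nat) (tp bt : nat -> pt).
Hypotheses (A : arr i tp bt) (ik : (i <= k)%N).

Definition X d y := xat (bt d) (tp d) y.
Definition str d := seg (bt d) (tp d).

Lemma bt_lt_tp d : (0 < d < 2 ^ i)%N -> (bt d).2 < (tp d).2.
Proof. by move=> hd; exact: lt_trans (arr_bt A hd) (arr_tp A hd). Qed.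

(** Reversing the order found on the gate would force a common point of the two strands, which can
    only be a shared end, and there the abscissas agree. *)
Lemma X_le d d' y : (0 < d)%N -> (d < d')%N -> (d' < 2 ^ i)%N ->
  (bt d).2 <= y <= (tp d).2 -> (bt d').2 <= y <= (tp d').2 -> X d y <= X d' y.
Proof.
move=> d0 dd di hy hy'; rewrite leNgt; apply/negP => lt.
have hd : (0 < d < 2 ^ i)%N by rewrite d0 (ltn_trans dd).
have hd' : (0 < d' < 2 ^ i)%N by rewrite di (ltn_trans d0).
have b1 := arr_bt A hd; have b2 := arr_bt A hd'; have t1 := arr_tp A hd; have t2 := arr_tp A hd'.
have lg := arr_lt A d0 dd di.
have [||||||t [ht /= [ex s1 s2]]] := @xat_cross R (bt d) (tp d) (bt d') (tp d') y gate _ _ _ _ _ _ lt (ltW lg).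
- by rewrite lt_eqF // bt_lt_tp.
- by rewrite lt_eqF // bt_lt_tp.
- by left.
- by left; lra.
- by left.
- by left; lra.
set y' := (1 - t) * y + t * gate in ex s1 s2.
have t1' : t < 1.
  rewrite lt_neqAle; case/andP: ht => _ ->; rewrite andbT; apply/eqP => t1'.
  have ey : y' = gate by rewrite /y' t1'; ring.
  by move: lg; rewrite -ey ex ltxx.
have tt : 0 <= t by case/andP: ht.
case: (arr_disj A d0 dd di s1 s2) => [[e ez]|[j [j1 j2 e ez]]].
  have ey : y' = (tp d).2 by rewrite -ez.
  have yt : y = (tp d).2 by rewrite /y' in ey; nra.
  have et : tp d = tp d' by apply: (arr_top A) => //; exact: ltn_trans dd.
  have e1 : X d y = (tp d).1 by rewrite /X yt xat_r // lt_eqF // bt_lt_tp.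
  have e2 : X d' y = (tp d').1 by rewrite /X yt et xat_r // lt_eqF // bt_lt_tp.
  by move: lt; rewrite e1 e2 et ltxx.
have ey : y' = (bt d).2 by rewrite -ez.
have yt : y = (bt d).2 by rewrite /y' in ey; nra.
have et : bt d = bt d' by apply: (arr_bot A (j := j)) => //; [exact: ltn_trans di | rewrite j1 (ltn_trans dd)].
have e1 : X d y = (bt d).1 by rewrite /X yt xat_l.
have e2 : X d' y = (bt d').1 by rewrite /X yt et xat_l.
by move: lt; rewrite e1 e2 et ltxx.
Qed.

Lemma X_lt d d' y : (0 < d)%N -> (d < d')%N -> (d' < 2 ^ i)%N ->
  (bt d).2 <= y <= (tp d).2 -> (bt d').2 <= y <= (tp d').2 ->
  ((d + d' = 2 ^ i)%N -> y <> (tp d).2) ->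
  (forall j, (2 ^ j < d)%N -> (d' < 2 ^ j.+1)%N -> (d + d' = 3 * 2 ^ j)%N -> y <> (bt d).2) ->
  X d y < X d' y.
Proof.
move=> d0 dd di hy hy' nt nb; rewrite lt_neqAle X_le // andbT; apply/eqP => e.
have hd : (0 < d < 2 ^ i)%N by rewrite d0 (ltn_trans dd).
have hd' : (0 < d' < 2 ^ i)%N by rewrite di (ltn_trans d0).
have s1 : seg (bt d) (tp d) (X d y, y) by apply: seg_x => //; apply: bt_lt_tp.
have s2 : seg (bt d') (tp d') (X d y, y) by rewrite e; apply: seg_x => //; apply: bt_lt_tp.
case: (arr_disj A d0 dd di s1 s2) => [[e' ez]|[j [j1 j2 e' ez]]].
  by apply: nt => //; rewrite -ez.
by apply: (nb j) => //; rewrite -ez.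
Qed.

(** At the height of the common bend of [d1] and [d2], a strand between them that reached so high
    would be squeezed between two equal abscissas. *)
Lemma top_nested d1 d d2 : (0 < d1)%N -> (d1 < d)%N -> (d < d2)%N -> (d1 + d2 = 2 ^ i)%N ->
  (tp d).2 < (tp d1).2.
Proof.
move=> p1 l1 l2 e; rewrite ltNge; apply/negP => le.
have h1 : (0 < d1 < 2 ^ i)%N by nlia.
have h : (0 < d < 2 ^ i)%N by nlia.
have h2 : (0 < d2 < 2 ^ i)%N by nlia.
have et : tp d1 = tp d2 by apply: (arr_top A) => //; nlia.
have y1 := arr_tp A h1; have y0 := arr_bt A h; have y2 := arr_bt A h2; have y3 := arr_bt A h1.
have r1 : (bt d1).2 <= (tp d1).2 <= (tp d1).2 by rewrite lexx ltW //; exact: bt_lt_tp.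
have r : (bt d).2 <= (tp d1).2 <= (tp d).2 by rewrite le andbT; lra.
have r2 : (bt d2).2 <= (tp d1).2 <= (tp d2).2 by rewrite et lexx ltW //; exact: bt_lt_tp.
have a1 : X d1 (tp d1).2 < X d (tp d1).2.
  have hd : (d < 2 ^ i)%N by nlia.
  apply: X_lt => //; first by move=> e'; nlia.
  by move=> j _ _ _; apply/eqP; rewrite gt_eqF //; lra.
have a2 : X d (tp d1).2 <= X d2 (tp d1).2 by apply: X_le => //; nlia.
have e1 : X d1 (tp d1).2 = (tp d1).1 by rewrite /X xat_r // lt_eqF // bt_lt_tp.
have e2 : X d2 (tp d1).2 = (tp d2).1 by rewrite /X et xat_r // lt_eqF // bt_lt_tp.
by have := lt_le_trans a1 a2; rewrite e1 e2 et ltxx.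
Qed.

Lemma bot_nested d1 d d2 j : (2 ^ j < d1)%N -> (d1 < d)%N -> (d < d2)%N -> (d2 < 2 ^ j.+1)%N ->
  (d2 < 2 ^ i)%N -> (d1 + d2 = 3 * 2 ^ j)%N -> (bt d1).2 < (bt d).2.
Proof.
move=> p1 l1 l2 p2 p3 e; rewrite ltNge; apply/negP => le.
have h1 : (0 < d1 < 2 ^ i)%N by nlia.
have h : (0 < d < 2 ^ i)%N by nlia.
have h2 : (0 < d2 < 2 ^ i)%N by nlia.
have et : bt d1 = bt d2 by apply: (arr_bot A (j := j)) => //; nlia.
have y1 := arr_bt A h1; have y0 := arr_tp A h; have y2 := arr_tp A h2; have y3 := arr_tp A h1.
have r1 : (bt d1).2 <= (bt d1).2 <= (tp d1).2 by rewrite lexx ltW //; exact: bt_lt_tp.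
have r : (bt d).2 <= (bt d1).2 <= (tp d).2 by rewrite le; lra.
have r2 : (bt d2).2 <= (bt d1).2 <= (tp d2).2 by rewrite et lexx ltW //; exact: bt_lt_tp.
have a1 : X d1 (bt d1).2 < X d (bt d1).2.
  have hd : (d < 2 ^ i)%N by nlia.
  have hd1 : (0 < d1)%N by nlia.
  apply: X_lt => //; first by move=> _; apply/eqP; rewrite lt_eqF //; lra.
  move=> j' j1 j2 e'; exfalso.
  have jj : j = j'.
    apply: (@pow2_uniq _ _ d1); first by rewrite (ltnW p1) (ltn_trans l1) // (ltn_trans l2).
    by rewrite (ltnW j1) (ltn_trans l1).
  by clear -e e' jj l2; move: e e'; rewrite jj => e e'; nlia.
have a2 : X d (bt d1).2 <= X d2 (bt d1).2 by apply: X_le => //; nlia.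
have e1 : X d1 (bt d1).2 = (bt d1).1 by rewrite /X xat_l.
have e2 : X d2 (bt d1).2 = (bt d2).1 by rewrite /X et xat_l.
by have := lt_le_trans a1 a2; rewrite e1 e2 et ltxx.
Qed.

Lemma arr_bt_w m : (1 <= m <= i)%N -> (0 < 2 ^ (i - m) < 2 ^ i)%N.
Proof. by move=> hm; rewrite expn_gt0 /= ltn_exp2l //; nlia. Qed.

(** The upper end is higher than the gate and less than [width] away sideways, so the strand moves
    by less than 1 sideways while it rises by 1. *)
Lemma X_w m y : (1 <= m <= i)%N -> 0 <= y <= 1 ->
  - (2 * m%:R) - 1 < X (2 ^ (i - m))%N y < - (2 * m%:R) + 1.
Proof.
move=> hm hy; have hd := arr_bt_w hm.
have [/andP[x1 x2] _] := arr_tin A hd; have g1 := arr_tp A hd.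
have k0 := @natk0 R k.
have m1 : 1 <= m%:R :> R by apply: (natrR R (m := 1)); nlia.
have mk : m%:R <= k%:R :> R by apply: natrR; nlia.
rewrite /X /xat (arr_w A hm) wpE /= subr0 subr0 opprK.
rewrite gateE in g1; rewrite widthE in x1.
set u := (tp _).1 in x1 x2 *; set v := (tp _).2 in g1 *.
have v0 : 0 < v by lra.
have r1 : - 1 < (u + 2 * m%:R) / v < 1 by rewrite ltr_pdivlMr // ltr_pdivrMr //; lra.
set r := (_ / v) in r1 *; nra.
Qed.

End Consequences.
End Arrangement.

(** * Upper bound: a new edge with one segment in each gap *)

Section NewStrands.
Variables (R : realType) (k : nat).
Local Notation pt := (R * R)%type.
Implicit Types (a b p q z : pt) (y : R) (d t : nat).
Local Notation wp := (@wp R).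
Local Notation vp := (@vp R k).
Local Notation gate := (@gate R k).
Local Notation inside := (@inside R k).
Variables (i : nat) (tp bt : nat -> pt).
Hypotheses (A : arr k i tp bt) (i0 : (0 < i)%N) (ik : (i < k)%N).
Local Notation X := (X tp bt).
Local Notation str d := (seg (bt d) (tp d)).

Let ik' : (i <= k)%N. Proof. exact: ltnW. Qed.
Let M := (2 ^ (i - 1))%N.
Let iM : (2 ^ i = 2 * M)%N.
Proof. by rewrite /M -expnS; congr expn; nlia. Qed.
Let M0 : (0 < M)%N. Proof. by rewrite expn_gt0. Qed.

Definition lb (t : nat) := locked (trunc_log 2 t).
Lemma lbP t : (0 < t)%N -> (2 ^ lb t <= t < 2 ^ (lb t).+1)%N.
Proof. by move=> t0; rewrite /lb -lock; apply: trunc_log_bounds. Qed.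

Lemma lbE t j : (2 ^ j <= t < 2 ^ j.+1)%N -> lb t = j.
Proof.
move=> h; apply: (pow2_uniq (d := t)) => //; apply: lbP.
by have := pow2 j; nlia.
Qed.

(* Of the two strands bounding a gap, the one whose upper (lower) end is the nearer to the gate. *)
Definition topd t := if (t < M)%N then t.+1 else t.
Definition botd t := if (2 * t.+1 <= 3 * 2 ^ lb t)%N then t.+1 else t.

(** In the limit the new strand ends at the bend of the neighbour that ends closer to the gate; the
    actual ends are obtained by a small shift along [utop] and [ubot]. *)
Definition atop t : pt := tp (topd t).
(** The sum of the upward directions of the two segments at the old bend: it leads away from both
    and is the same for the two strands. At a free end both summands coincide, and the shift
    prolongs the strand. *)
Definition utop t : pt :=
  (2 * (tp (topd t)).1 - (bt (topd t)).1 - (bt (2 ^ i - topd t)%N).1,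
   2 * (tp (topd t)).2 - (bt (topd t)).2 - (bt (2 ^ i - topd t)%N).2).
(** Gaps 0 and 1 contain the two ends of the new edge itself, which are fixed points; accordingly
    [ubot] vanishes there. *)
Definition abot t : pt :=
  if t is 0 then wp i.+1 else if t is 1 then vp i.+1 else bt (botd t).
Definition ubot t : pt := if (t < 2)%N then (0, 0) else
  (2 * (bt (botd t)).1 - (tp (botd t)).1 - (tp (3 * 2 ^ lb t - botd t)%N).1,
   2 * (bt (botd t)).2 - (tp (botd t)).2 - (tp (3 * 2 ^ lb t - botd t)%N).2).

Definition shift (p u : pt) (e : R) : pt := (p.1 + e * u.1, p.2 + e * u.2).
Lemma shift0 p e : shift p (0, 0) e = p.
Proof. by rewrite /shift /= !mulr0 !addr0 -surjective_pairing. Qed.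

Definition topQ e t := shift (atop t) (utop t) e.
Definition botQ e t := shift (abot t) (ubot t) e.
Definition ns e t := seg (botQ e t) (topQ e t).

Lemma vpS : vp i.+1 = (1 - 2 * i%:R, 1).
Proof. by rewrite vpE // -natr1; congr (_, _); ring. Qed.

Lemma topd_range t : (t < 2 ^ i)%N -> (0 < topd t < 2 ^ i)%N.
Proof. by rewrite /topd; case: ifP; nlia. Qed.

Lemma lb_gt0 t : (1 < t)%N -> (0 < lb t)%N.
Proof. by move=> t1; rewrite /lb -lock trunc_log_gt0. Qed.

Lemma even_pow j : (0 < j)%N -> exists c, (2 ^ j = 2 * c)%N /\ (0 < c)%N.
Proof. by case: j => // j _; exists (2 ^ j)%N; rewrite expnS pow2. Qed.

Lemma lb_pow t : (0 < t)%N -> (t < 2 ^ i)%N -> (2 * 2 ^ lb t <= 2 ^ i)%N.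
Proof.
move=> t1 ti; rewrite -expnS leq_exp2l //; rewrite -(ltn_exp2l (m := 2)) //.
by apply: leq_ltn_trans ti; have := @lbP t t1; nlia.
Qed.

Lemma botd_range t : (1 < t)%N -> (t < 2 ^ i)%N ->
  (2 ^ lb t < botd t < 2 ^ (lb t).+1)%N /\ (botd t < 2 ^ i)%N.
Proof.
move=> t1 ti; have := @lbP t (ltnW t1); have [c [ec c0]] := even_pow (lb_gt0 t1).
have h := lb_pow (ltnW t1) ti.
by move: h; rewrite expnS ec /botd ec; case: ifP; nlia.
Qed.

Lemma no_center t j : (t + t.+1 = 3 * 2 ^ j)%N -> (2 ^ j < t)%N -> ~ (t.+1 < 2 ^ j.+1)%N.
Proof. by case: j => [|j]; rewrite ?expn0 ?expn1 ?expnS; lia. Qed.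

Lemma top_L t : (0 < t < 2 ^ i)%N -> topd t = t \/ ((atop t).2 < (tp t).2 /\ X t (atop t).2 < (atop t).1).
Proof.
move=> ht; rewrite /atop /topd; case: (ltnP t M) => tM; [right|by left].
have h : (tp t.+1).2 < (tp t).2.
  by apply: (top_nested A ik' (d2 := (2 ^ i - t)%N)); nlia.
split=> //.
have ht' : (0 < t.+1 < 2 ^ i)%N by nlia.
have g1 := arr_tp A ht'; have b1 := arr_bt A ht; have b2 := arr_bt A ht'.
have := @X_lt _ _ _ _ _ A t t.+1 (tp t.+1).2.
rewrite /X [xat (bt t.+1) _ _]xat_r ?lt_eqF ?bt_lt_tp //; last exact: (bt_lt_tp A).
apply=> //; try nlia.
- by rewrite (ltW h) andbT; lra.
- by rewrite lexx andbT; lra.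
- by move=> j _ _ _; apply/eqP; rewrite gt_eqF //; lra.
Qed.

Lemma top_R t : (t.+1 < 2 ^ i)%N -> topd t = t.+1 \/
  ((atop t).2 < (tp t.+1).2 /\ (atop t).1 < X t.+1 (atop t).2).
Proof.
move=> ht; rewrite /atop /topd; case: (ltnP t M) => tM; [by left|right].
have h : (tp t).2 < (tp t.+1).2.
  have <- : tp (2 ^ i - t.+1)%N = tp t.+1 by apply: (arr_top A); nlia.
  by apply: (top_nested A ik' (d2 := t.+1)); nlia.
split=> //.
have ht1 : (0 < t < 2 ^ i)%N by nlia.
have ht' : (0 < t.+1 < 2 ^ i)%N by nlia.
have g1 := arr_tp A ht1; have b1 := arr_bt A ht1; have b2 := arr_bt A ht'.
have := @X_lt _ _ _ _ _ A t t.+1 (tp t).2.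
rewrite /X [xat (bt t) _ _]xat_r ?lt_eqF ?bt_lt_tp //; last exact: (bt_lt_tp A).
apply=> //; try nlia.
- by rewrite lexx andbT; lra.
- by rewrite (ltW h) andbT; lra.
- by move=> j _ _ _; apply/eqP; rewrite gt_eqF //; lra.
Qed.

Lemma strand1 : bt 1%N = wp i.
Proof. by rewrite -(arr_w A (m := i)) ?subnn ?expn0 // i0 leqnn. Qed.

Lemma X1 y : 0 <= y <= 1 -> - (2 * i%:R) - 1 < X 1 y < - (2 * i%:R) + 1.
Proof. by move=> hy; have := X_w A ik' (m := i) _ hy; rewrite subnn expn0; apply; rewrite i0 leqnn. Qed.

Lemma bot_L t : (0 < t < 2 ^ i)%N -> (1 < t /\ botd t = t)%N \/
  ((bt t).2 < (abot t).2 /\ X t (abot t).2 < (abot t).1).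
Proof.
move=> ht; case: t ht => [|[|t]] ht; first by [].
  have -> : abot 1 = vp i.+1 by [].
  right; rewrite strand1 vpS wpE /=; split; first exact: ltr01.
  by have := X1 (y := 1); rewrite ler01 lexx => /(_ isT) /andP[_]; lra.
set t' := t.+2 in ht *; have t1 : (1 < t')%N by [].
have [c [ec c0]] := even_pow (lb_gt0 t1); have tb := lbP (ltnW t1); rewrite expnS in tb.
have pl := lb_pow (ltnW t1) (proj2 (andP ht)).
have [db dbi] := botd_range t1 (proj2 (andP ht)); rewrite expnS in db.
have -> : abot t' = bt (botd t') by [].
move: db dbi; rewrite /botd; case: (leqP (2 * t'.+1) (3 * 2 ^ lb t')) => tC db dbi; last (by left; split); right.
have ht' : (0 < t'.+1 < 2 ^ i)%N by nlia.
have h : (bt t').2 < (bt t'.+1).2.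
  (* The first strand of a block runs to the floor, below every bend in the room; the other strands
     are compared by nesting. *)
  have [e|ne] := eqVneq t' (2 ^ lb t')%N.
    have li : (lb t' < i)%N by rewrite -(ltn_exp2l (m := 2)) // -e; nlia.
    have e2 : t' = (2 ^ (i - (i - lb t')))%N by rewrite subKn // ltnW.
    rewrite [in X in X < _]e2 (arr_w A); last by nlia.
    have [_ /andP[]] // : inside (bt t'.+1).
    by apply: (arr_bin A (j := lb t')); rewrite ?expnS; nlia.
  by apply: (bot_nested A ik' (d2 := (3 * 2 ^ lb t' - t')%N) (j := lb t')); rewrite ?expnS; nlia.
split=> //.
have g1 := arr_bt A ht'; have b1 := arr_tp A ht; have b2 := arr_tp A ht'.
have := @X_lt _ _ _ _ _ A t' t'.+1 (bt t'.+1).2.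
rewrite /X [xat (bt t'.+1) _ _]xat_l.
apply=> //; try nlia.
- by rewrite (ltW h) /=; lra.
- by rewrite lexx /=; lra.
- by move=> j j1 j2 je; exfalso; exact: (no_center je j1 j2).
Qed.

Lemma bot_R t : (t.+1 < 2 ^ i)%N -> (1 < t /\ botd t = t.+1)%N \/
  ((bt t.+1).2 <= (abot t).2 /\ (abot t).1 < X t.+1 (abot t).2).
Proof.
move=> ht; case: t ht => [|[|t]] ht.
- have -> : abot 0 = wp i.+1 by [].
  right; rewrite strand1 !wpE /=; split; first exact: lexx.
  have -> : X 1 0 = - (2 * i%:R).
    by have := xat_l (bt 1%N) (tp 1%N); rewrite /X strand1 wpE.
  by rewrite -natr1; lra.
- right; have i1 : (1 < i)%N by rewrite -(ltn_exp2l (m := 2)) // expn1.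
  have hi : (1 <= i - 1 <= i)%N by nlia.
  have e2 : 2%N = (2 ^ (i - (i - 1)))%N by rewrite subKn // expn1.
  have -> : abot 1 = vp i.+1 by [].
  have -> : bt 2 = wp (i - 1) by rewrite [in LHS]e2 (arr_w A).
  rewrite wpE vpS /=; split; first exact: ler01.
  have := X_w A ik' hi (y := 1); rewrite -e2 ler01 lexx => /(_ isT) /andP[+ _].
  by rewrite natrB //; lra.
set t' := t.+2 in ht *; have t1 : (1 < t')%N by [].
have [c [ec c0]] := even_pow (lb_gt0 t1); have tb := lbP (ltnW t1); rewrite expnS in tb.
have [db dbi] := botd_range t1 (ltnW ht); rewrite expnS in db.
have -> : abot t' = bt (botd t') by [].
move: db dbi; rewrite /botd; case: (leqP (2 * t'.+1) (3 * 2 ^ lb t')) => tC db dbi; first (by left; split); right.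
have ht1 : (0 < t' < 2 ^ i)%N by nlia.
have ht' : (0 < t'.+1 < 2 ^ i)%N by nlia.
have h : (bt t'.+1).2 < (bt t').2.
  have [e|ne] := eqVneq t'.+1 (2 ^ (lb t').+1)%N.
    have li : ((lb t').+1 < i)%N by rewrite -(ltn_exp2l (m := 2)) // -e.
    have e2 : t'.+1 = (2 ^ (i - (i - (lb t').+1)))%N by rewrite subKn // ltnW.
    rewrite [in X in X < _]e2 (arr_w A); last by nlia.
    have [_ /andP[]] // : inside (bt t').
    by apply: (arr_bin A (j := lb t')); rewrite ?expnS; nlia.
  rewrite expnS in ne.
  have <- : bt (3 * 2 ^ lb t' - t'.+1)%N = bt t'.+1.
    by apply: (arr_bot A (j := lb t')); rewrite ?expnS; nlia.
  by apply: (bot_nested A ik' (d2 := t'.+1) (j := lb t')); rewrite ?expnS; nlia.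
split; first exact: ltW.
have g1 := arr_bt A ht1; have b1 := arr_tp A ht1; have b2 := arr_tp A ht'.
have := @X_lt _ _ _ _ _ A t' t'.+1 (bt t').2.
rewrite /X [xat (bt t') _ _]xat_l.
apply=> //; try nlia.
- by rewrite lexx /=; lra.
- by rewrite (ltW h) /=; lra.
- by move=> j j1 j2 je; exfalso; exact: (no_center je j1 j2).
Qed.

Definition sdd d p := sd (bt d) (tp d) p.

Lemma sd_shift b v p u e :
  sd b v (shift p u e) = sd b v p + e * (u.1 * (v.2 - b.2) - u.2 * (v.1 - b.1)).
Proof. by rewrite /sd /shift /=; ring. Qed.

Lemma small_sd_lt b v p u : sd b v p < 0 -> small (fun e => sd b v (shift p u e) < 0).
Proof. by move=> h; apply: small_imp (small_lt _ h) => e _; rewrite sd_shift; apply. Qed.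

Lemma small_sd_gt b v p u : 0 < sd b v p -> small (fun e => 0 < sd b v (shift p u e)).
Proof. by move=> h; apply: small_imp (small_gt _ h) => e _; rewrite sd_shift; apply. Qed.

Lemma gate_point d : (0 < d < 2 ^ i)%N -> exists s, 0 < s < 1 /\
  (X d gate, gate) = lerp (bt d) (tp d) s.
Proof.
move=> hd; have b := arr_bt A hd; have t := arr_tp A hd.
have [s [hs e]] : seg (bt d) (tp d) (X d gate, gate) by apply: seg_x; lra.
exists s; split=> //; case: e => _ e; case/andP: hs => h0 h1.
rewrite !lt_neqAle h0 h1 !andbT; apply/andP; split; apply/eqP => es; move: e.
  by rewrite -es; lra.
by rewrite es; lra.
Qed.

Lemma X_sdd d p : (0 < d < 2 ^ i)%N -> ((0 < sdd d p) = (X d p.2 < p.1)) *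
  ((sdd d p < 0) = (p.1 < X d p.2)) * ((sdd d p == 0) = (p.1 == X d p.2)).
Proof. by move=> hd; rewrite /sdd sd_gt0 ?sd_lt0 ?sd_eq0 ?(bt_lt_tp A). Qed.

Lemma mate_top_sd d d' : (0 < d)%N -> (d < d')%N -> (d + d' = 2 ^ i)%N ->
  0 < sdd d (bt d') /\ sdd d' (bt d) < 0.
Proof.
move=> d0 dd e; have hd : (0 < d < 2 ^ i)%N by nlia.
have hd' : (0 < d' < 2 ^ i)%N by nlia.
have et : tp d = tp d' by apply: (arr_top A) => //; nlia.
have lt : X d gate < X d' gate by apply: (arr_lt A) => //; nlia.
split.
  have [s [hs es]] := gate_point hd'.
  have : 0 < sdd d (X d' gate, gate) by rewrite X_sdd.
  by rewrite es /sdd sd_lerp -et sd_r; nra.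
have [s [hs es]] := gate_point hd.
have : sdd d' (X d gate, gate) < 0 by rewrite X_sdd.
by rewrite es /sdd sd_lerp et sd_r; nra.
Qed.

Lemma mate_bot_sd d d' j : (2 ^ j < d)%N -> (d < d')%N -> (d' < 2 ^ i)%N -> (d + d' = 3 * 2 ^ j)%N ->
  0 < sdd d (tp d') /\ sdd d' (tp d) < 0.
Proof.
move=> d0 dd di e; have p := pow2 j; have hd : (0 < d < 2 ^ i)%N by nlia.
have hd' : (0 < d' < 2 ^ i)%N by nlia.
have et : bt d = bt d' by apply: (arr_bot A (j := j)) => //; rewrite ?expnS; nlia.
have lt : X d gate < X d' gate by apply: (arr_lt A) => //; nlia.
split.
  have [s [hs es]] := gate_point hd'.
  have : 0 < sdd d (X d' gate, gate) by rewrite X_sdd.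
  by rewrite es /sdd sd_lerp -et sd_l; nra.
have [s [hs es]] := gate_point hd.
have : sdd d' (X d gate, gate) < 0 by rewrite X_sdd.
by rewrite es /sdd sd_lerp et sd_l; nra.
Qed.

(** The strands with a free lower end, at some [v_m] with [m >= 2]: the new edge turns round
    them. *)
Definition bcenter d := exists j, (2 ^ j < d < 2 ^ j.+1)%N /\ (2 * d = 3 * 2 ^ j)%N.

(** The shifted bend lies on the side of the strand opposite to its partner. A strand that is its
    own partner gives 0: the shifted point is on its line. *)
Lemma topQ_sd e t : sdd (topd t) (topQ e t) = - (e * sdd (topd t) (bt (2 ^ i - topd t)%N)).
Proof. by rewrite /sdd /topQ sd_shift /atop sd_r /utop /sd /=; ring. Qed.

Lemma botQ_sd e t : (1 < t)%N -> sdd (botd t) (botQ e t) = - (e * sdd (botd t) (tp (3 * 2 ^ lb t - botd t)%N)).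
Proof.
case: t => [|[|t]] // _; rewrite /sdd /botQ sd_shift.
have -> : abot t.+2 = bt (botd t.+2) by [].
by rewrite sd_l /ubot /sd /=; ring.
Qed.

Lemma topQ_tip e t : 0 < e -> (t < 2 ^ i)%N -> topd t = M ->
  sdd M (topQ e t) = 0 /\ (tp M).2 < (topQ e t).2.
Proof.
move=> e0 ht eM; have MM : (2 ^ i - M)%N = M by nlia.
split; first by have := topQ_sd e t; rewrite eM MM /sdd sd_l mulr0 oppr0.
have hM : (0 < M < 2 ^ i)%N by nlia.
have := bt_lt_tp A hM.
by rewrite /topQ /shift /atop /utop eM MM /=; nra.
Qed.

Lemma botQ_tip e t : 0 < e -> (1 < t < 2 ^ i)%N -> (2 * botd t = 3 * 2 ^ lb t)%N ->
  [/\ sdd (botd t) (botQ e t) = 0, (botQ e t).2 < (bt (botd t)).2 & bcenter (botd t)].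
Proof.
move=> e0 /andP[t1 ti] eM; have [db dbi] := botd_range t1 ti.
have MM : (3 * 2 ^ lb t - botd t)%N = botd t by nlia.
split; last by exists (lb t).
- by have := botQ_sd e t1; rewrite MM /sdd sd_r mulr0 oppr0.
- have hM : (0 < botd t < 2 ^ i)%N by nlia.
  have := bt_lt_tp A hM; move: t1 MM; case: t {ti eM db dbi hM} => [|[|t]] // _ MM.
  have -> : (botQ e t.+2).2 = (bt (botd t.+2)).2 + e * (2 * (bt (botd t.+2)).2 - (tp (botd t.+2)).2 - (tp (3 * 2 ^ lb t.+2 - botd t.+2)%N).2) by [].
  by rewrite MM; nra.
Qed.

Lemma topR_sign t : (t.+1 < 2 ^ i)%N -> small (fun e => sdd t.+1 (topQ e t) < 0 \/
  [/\ sdd t.+1 (topQ e t) = 0, t.+1 = M & (tp t.+1).2 < (topQ e t).2]).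
Proof.
move=> ht; case: (top_R ht) => [et|[h1 h2]]; last first.
  apply: small_imp (small_sd_lt (utop t) (p := atop t) (b := bt t.+1) (v := tp t.+1) _).
    by move=> e _ h; left.
  by rewrite -/(sdd _ _) X_sdd //; nlia.
apply: small_true => e e0.
have tM : (t < M)%N by move: et; rewrite /topd; case: ltnP => //; nlia.
have [eM|nM] := eqVneq t.+1 M.
  by right; have [] := @topQ_tip e t e0 (ltnW ht); rewrite ?et eM.
left; have := topQ_sd e t; rewrite et => ->.
have [h _] := @mate_top_sd t.+1 (2 ^ i - t.+1)%N ltac:(nlia) ltac:(nlia) ltac:(nlia).
by rewrite oppr_lt0 mulr_gt0.
Qed.

Lemma topL_sign t : (0 < t < 2 ^ i)%N -> small (fun e => 0 < sdd t (topQ e t) \/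
  [/\ sdd t (topQ e t) = 0, t = M & (tp t).2 < (topQ e t).2]).
Proof.
move=> ht; case: (top_L ht) => [et|[h1 h2]]; last first.
  apply: small_imp (small_sd_gt (utop t) (p := atop t) (b := bt t) (v := tp t) _).
    by move=> e _ h; left.
  by rewrite -/(sdd _ _) X_sdd.
apply: small_true => e e0.
have tM : (M <= t)%N by move: et; rewrite /topd; case: ltnP => //; nlia.
have [eM|nM] := eqVneq t M.
  by right; have [] := @topQ_tip e t e0 (proj2 (andP ht)); rewrite ?et -eM.
left; have := topQ_sd e t; rewrite et => ->.
have [_ h] := @mate_top_sd (2 ^ i - t)%N t ltac:(nlia) ltac:(nlia) ltac:(nlia).
by rewrite oppr_gt0 pmulr_rlt0.
Qed.

Lemma botR_sign t : (t.+1 < 2 ^ i)%N -> small (fun e => sdd t.+1 (botQ e t) < 0 \/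
  [/\ sdd t.+1 (botQ e t) = 0, bcenter t.+1 & (botQ e t).2 < (bt t.+1).2]).
Proof.
move=> ht; case: (bot_R ht) => [[t1 et]|[h1 h2]]; last first.
  apply: small_imp (small_sd_lt (ubot t) (p := abot t) (b := bt t.+1) (v := tp t.+1) _).
    by move=> e _ h; left.
  by rewrite -/(sdd _ _) X_sdd //; nlia.
apply: small_true => e e0.
have tM : (2 * t.+1 <= 3 * 2 ^ lb t)%N.
  by move: et; rewrite /botd; case: leqP => //; nlia.
have [db dbi] := botd_range t1 (ltnW ht); rewrite et in db dbi.
have [eM|nM] := eqVneq (2 * t.+1)%N (3 * 2 ^ lb t)%N.
  right; have [] := @botQ_tip e t e0 _ _; rewrite ?et //; first by nlia.
left; have := botQ_sd e t1; rewrite et => ->.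
have pl := lb_pow (ltnW t1) (ltnW ht).
have [h _] := @mate_bot_sd t.+1 (3 * 2 ^ lb t - t.+1)%N (lb t) ltac:(nlia) ltac:(nlia) ltac:(nlia) ltac:(nlia).
by rewrite oppr_lt0 mulr_gt0.
Qed.

Lemma botL_sign t : (0 < t < 2 ^ i)%N -> small (fun e => 0 < sdd t (botQ e t) \/
  [/\ sdd t (botQ e t) = 0, bcenter t & (botQ e t).2 < (bt t).2]).
Proof.
move=> ht; case: (bot_L ht) => [[t1 et]|[h1 h2]]; last first.
  apply: small_imp (small_sd_gt (ubot t) (p := abot t) (b := bt t) (v := tp t) _).
    by move=> e _ h; left.
  by rewrite -/(sdd _ _) X_sdd.
apply: small_true => e e0; have ti : (t < 2 ^ i)%N by nlia.
have tM : (3 * 2 ^ lb t < 2 * t.+1)%N.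
  by move: et; rewrite /botd; case: leqP => //; nlia.
have [c [ec c0]] := even_pow (lb_gt0 t1).
have [db dbi] := botd_range t1 ti; rewrite et in db dbi.
have [eM|nM] := eqVneq (2 * t)%N (3 * 2 ^ lb t)%N.
  right; have [] := @botQ_tip e t e0 _ _; rewrite ?et //; first by nlia.
left; have := botQ_sd e t1; rewrite et => ->.
have pl := lb_pow (ltnW t1) ti; rewrite expnS in db.
have [_ h] := @mate_bot_sd (3 * 2 ^ lb t - t)%N t (lb t) ltac:(nlia) ltac:(nlia) ltac:(nlia) ltac:(nlia).
by rewrite oppr_gt0 pmulr_rlt0.
Qed.

Lemma seg_neg b v p q z (P Q : Prop) : (sd b v p < 0 \/ (sd b v p = 0 /\ P)) ->
  (sd b v q < 0 \/ (sd b v q = 0 /\ Q)) -> ~ (P /\ Q) -> seg p q z ->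
  sd b v z < 0 \/ (sd b v z = 0 /\ ((z = p /\ P) \/ (z = q /\ Q))).
Proof.
move=> hp hq nPQ [s [hs ->]]; rewrite -/(lerp p q s) sd_lerp.
case: hp => [hp|[hp P1]]; case: hq => [hq|[hq Q1]].
- by left; nra.
- have [e|ne] := eqVneq s 1; first by right; rewrite e hq lerp1; split; [lra|right].
  by left; rewrite hq mulr0 addr0 pmulr_rlt0 // subr_gt0 lt_neqAle ne; case/andP: hs.
- have [e|ne] := eqVneq s 0; first by right; rewrite e hp lerp0; split; [lra|left].
  by left; rewrite hp mulr0 add0r pmulr_rlt0 // lt_neqAle eq_sym ne; case/andP: hs.
- by exfalso; apply: nPQ.
Qed.

Lemma sd_flip b v p : sd v b p = - sd b v p.
Proof. by rewrite /sd; ring. Qed.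

Lemma bcenter_M : ~ bcenter M.
Proof. by move=> [j [_]]; rewrite -iM; exact: pow2_neq3. Qed.

(** Strictly on the near side of the right neighbour, except that an end of the new strand may lie
    on the line of that neighbour beyond its free end. *)
Definition okR e t := forall z, ns e t z -> sdd t.+1 z < 0 \/ (sdd t.+1 z = 0 /\
  ([/\ z = botQ e t, bcenter t.+1 & z.2 < (bt t.+1).2] \/
   [/\ z = topQ e t, t.+1 = M & (tp t.+1).2 < z.2])).

Definition okL e t := forall z, ns e t z -> 0 < sdd t z \/ (sdd t z = 0 /\
  ([/\ z = botQ e t, bcenter t & z.2 < (bt t).2] \/
   [/\ z = topQ e t, t = M & (tp t).2 < z.2])).

Lemma okR_small t : (t.+1 < 2 ^ i)%N -> small (fun e => okR e t).
Proof.
move=> ht; apply: small_imp (small_and (topR_sign ht) (botR_sign ht)) => e e0 [h1 h2] z hz.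
have := @seg_neg (bt t.+1) (tp t.+1) (botQ e t) (topQ e t) z
  (bcenter t.+1 /\ (botQ e t).2 < (bt t.+1).2) (t.+1 = M /\ (tp t.+1).2 < (topQ e t).2).
case.
- by case: h2 => [|[]]; [left|right].
- by case: h1 => [|[]]; [left|right].
- by move=> [[bc _] [eM _]]; apply: bcenter_M; rewrite -eM.
- exact: hz.
- by left.
- by move=> [z0 [[ez [b1 b2]]|[ez [b1 b2]]]]; right; split=> //; [left|right]; rewrite ez.
Qed.

Lemma okL_small t : (0 < t < 2 ^ i)%N -> small (fun e => okL e t).
Proof.
move=> ht; apply: small_imp (small_and (topL_sign ht) (botL_sign ht)) => e e0 [h1 h2] z hz.
have := @seg_neg (tp t) (bt t) (botQ e t) (topQ e t) z
  (bcenter t /\ (botQ e t).2 < (bt t).2) (t = M /\ (tp t).2 < (topQ e t).2).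
rewrite !(sd_flip (bt t)) !oppr_lt0 -!/(sdd _ _); case.
- by case: h2 => [|[e1 e2 e3]]; [left|right; rewrite e1 oppr0].
- by case: h1 => [|[e1 e2 e3]]; [left|right; rewrite e1 oppr0].
- by move=> [[bc _] [eM _]]; apply: bcenter_M; rewrite -eM.
- exact: hz.
- by left.
- move=> [/eqP + [[ez [b1 b2]]|[ez [b1 b2]]]]; rewrite oppr_eq0 => /eqP z0; right; split=> //; [left|right];
    by rewrite ez.
Qed.

Definition hts e t := (botQ e t).2 < gate /\ gate < (topQ e t).2.

Lemma abot_lt t : (t < 2 ^ i)%N -> (abot t).2 < gate.
Proof.
move=> ht; have k0 := @natk0 R k; case: t ht => [|[|t]] ht.
- have -> : abot 0 = wp i.+1 by [].
  by rewrite wpE gateE /=; lra.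
- have -> : abot 1 = vp i.+1 by [].
  by rewrite vpS gateE /=; lra.
have [db dbi] := botd_range (isT : (1 < t.+2)%N) ht.
have -> : abot t.+2 = bt (botd t.+2) by [].
by apply: (arr_bt A); nlia.
Qed.

Lemma atop_gt t : (t < 2 ^ i)%N -> gate < (atop t).2.
Proof. by move=> ht; apply: (arr_tp A); exact: topd_range. Qed.

Lemma hts_small t : (t < 2 ^ i)%N -> small (fun e => hts e t).
Proof.
move=> ht; apply: small_imp (small_and (small_lt (ubot t).2 (abot_lt ht)) (small_gt (utop t).2 (atop_gt ht))).
by move=> e e0 [].
Qed.

Lemma sdd_str d z : (0 < d < 2 ^ i)%N -> str d z ->
  [/\ sdd d z = 0, (bt d).2 <= z.2 <= (tp d).2 & z.1 = X d z.2].
Proof.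
move=> hd hz; have [h1 h2] := seg_y (bt_lt_tp A hd) hz; split=> //.
by apply/eqP; rewrite X_sdd // h2.
Qed.

Lemma lim_L t z : (0 < t < 2 ^ i)%N -> seg (abot t) (atop t) z ->
  (bt t).2 <= z.2 <= (tp t).2 /\ X t z.2 <= z.1.
Proof.
move=> ht hz; have ti : (t < 2 ^ i)%N by nlia.
have at_lt : (abot t).2 < (atop t).2 by exact: lt_trans (abot_lt ti) (atop_gt ti).
have [hy _] := seg_y at_lt hz.
have [t1 t2] : (atop t).2 <= (tp t).2 /\ 0 <= sdd t (atop t).
  case: (top_L ht) => [e|[h1 h2]]; first by rewrite /atop e /sdd sd_r.
  by split; rewrite ltW ?X_sdd.
have [b1 b2] : (bt t).2 <= (abot t).2 /\ 0 <= sdd t (abot t).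
  case: (bot_L ht) => [[l1 e]|[h1 h2]]; last by split; rewrite ltW ?X_sdd.
  by case: t l1 e {ht hz ti at_lt hy t1 t2} => [|[|t]] // _ e; rewrite /abot e /sdd sd_l.
split; first by lra.
have : 0 <= sdd t z.
  by case: hz => s [hs ->]; rewrite -/(lerp _ _ _) /sdd sd_lerp; rewrite /sdd in t2 b2; nra.
by rewrite leNgt X_sdd // -leNgt.
Qed.

Lemma lim_R t z : (t.+1 < 2 ^ i)%N -> seg (abot t) (atop t) z ->
  (bt t.+1).2 <= z.2 <= (tp t.+1).2 /\ z.1 <= X t.+1 z.2.
Proof.
move=> ht hz; have ti : (t < 2 ^ i)%N by nlia.
have ht' : (0 < t.+1 < 2 ^ i)%N by nlia.
have at_lt : (abot t).2 < (atop t).2 by exact: lt_trans (abot_lt ti) (atop_gt ti).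
have [hy _] := seg_y at_lt hz.
have [t1 t2] : (atop t).2 <= (tp t.+1).2 /\ sdd t.+1 (atop t) <= 0.
  case: (top_R ht) => [e|[h1 h2]]; first by rewrite /atop e /sdd sd_r.
  by split; rewrite ltW ?X_sdd.
have [b1 b2] : (bt t.+1).2 <= (abot t).2 /\ sdd t.+1 (abot t) <= 0.
  case: (bot_R ht) => [[l1 e]|[h1 h2]]; last by split; rewrite ?h1 // ltW ?X_sdd.
  by case: t l1 e {ht ht' hz ti at_lt hy t1 t2} => [|[|t]] // _ e; rewrite /abot e /sdd sd_l.
split; first by lra.
have : sdd t.+1 z <= 0.
  by case: hz => s [hs ->]; rewrite -/(lerp _ _ _) /sdd sd_lerp; rewrite /sdd in t2 b2; nra.
by rewrite leNgt X_sdd // -leNgt.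
Qed.

(** By the order of the strands, a common point with a more distant strand also lies on the
    neighbour, so it is an end that the two old strands share. *)
Lemma lim_str t d z : (t < 2 ^ i)%N -> (0 < d < 2 ^ i)%N -> d != t -> d != t.+1 ->
  seg (abot t) (atop t) z -> str d z ->
  (d + topd t = 2 ^ i)%N \/ (1 < t)%N /\ (d + botd t = 3 * 2 ^ lb t)%N.
Proof.
move=> ht hd n1 n2 hz hs.
have at_lt : (abot t).2 < (atop t).2 by exact: lt_trans (abot_lt ht) (atop_gt ht).
have [hy _] := seg_y at_lt hz.
have [s0 sy sx] := sdd_str hd hs.
case: (ltngtP d t) n1 => // dt _.
  have ht' : (0 < t < 2 ^ i)%N by nlia.
  have [ly lx] := lim_L ht' hz.
  have le : X d z.2 <= X t z.2 by apply: (X_le A) => //; nlia.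
  have ex : X t z.2 = z.1 by lra.
  have st : str t z by rewrite [z]surjective_pairing -ex; apply: seg_x => //; exact: (bt_lt_tp A).
  have [||] := arr_disj A _ dt ht hs st; first by nlia.
    move=> [e ez]; left.
    have et : tp d = tp t by apply: (arr_top A) => //; nlia.
    case: (top_L ht') => [->//|[h1 _]]; exfalso.
    by have : z.2 = (tp t).2 by [rewrite ez et]; lra.
  move=> [j [j1 j2 e ez]]; right.
  have et : bt d = bt t by apply: (arr_bot A (j := j)) => //; nlia.
  case: (bot_L ht') => [[l1 ->]|[h1 _]]; last first.
    by exfalso; have : z.2 = (bt t).2 by [rewrite ez et]; lra.
  split=> //; rewrite e; congr (3 * 2 ^ _)%N; apply: (pow2_uniq (d := t)).
    by nlia.
  by apply: lbP; nlia.
have ht1 : (t.+1 < 2 ^ i)%N by nlia.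
have ht' : (0 < t.+1 < 2 ^ i)%N by nlia.
have dt' : (t.+1 < d)%N by nlia.
have [ly lx] := lim_R ht1 hz.
have le : X t.+1 z.2 <= X d z.2 by apply: (X_le A) => //; nlia.
have ex : X t.+1 z.2 = z.1 by lra.
have st : str t.+1 z by rewrite [z]surjective_pairing -ex; apply: seg_x => //; exact: (bt_lt_tp A).
have [] := arr_disj A (isT : (0 < t.+1)%N) dt' (proj2 (andP hd)) st hs.
  move=> [e ez]; left.
  case: (top_R ht1) => [->|[h1 _]]; first by nlia.
  by exfalso; have : z.2 = (tp t.+1).2 by [rewrite ez]; lra.
move=> [j [j1 j2 e ez]]; right.
case: (bot_R ht1) => [[l1 ->]|[h1 h2]]; last first.
  exfalso; have ez2 : z.2 = (bt t.+1).2 by rewrite ez.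
  have za : z = abot t.
    have [s [hs' es]] := hz; have zy : z.2 = (abot t).2 by lra.
    move: zy; rewrite es /= => zy; have s00 : s = 0 by nra.
    by rewrite s00 -[(_, _)]/(lerp (abot t) (atop t) 0) lerp0.
  by move: h2; rewrite -za ex ltxx.
split=> //; have -> : lb t = j by apply: lbE; nlia.
nlia.
Qed.

Lemma okR_str e t z : (t.+1 < 2 ^ i)%N -> okR e t -> ns e t z -> ~ str t.+1 z.
Proof.
move=> ht ok hz hs; have ht' : (0 < t.+1 < 2 ^ i)%N by nlia.
have [s0 /andP[y1 y2] _] := sdd_str ht' hs.
case: (ok z hz) => [|[_ [[_ _]|[_ _]]]]; first by rewrite s0 ltxx.
  by rewrite ltNge y1.
by rewrite ltNge y2.
Qed.

Lemma okL_str e t z : (0 < t < 2 ^ i)%N -> okL e t -> ns e t z -> ~ str t z.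
Proof.
move=> ht ok hz hs; have [s0 /andP[y1 y2] _] := sdd_str ht hs.
case: (ok z hz) => [|[_ [[_ _]|[_ _]]]]; first by rewrite s0 ltxx.
  by rewrite ltNge y1.
by rewrite ltNge y2.
Qed.

(** From the common bend the partner runs on the far side of strand [t.+1], so the sign that keeps
    the new strand on the near side also separates it from the partner. *)
Lemma okR_mate e t d z : (t.+1 < d < 2 ^ i)%N ->
  ((t.+1 + d = 2 ^ i)%N \/ exists j, [/\ (2 ^ j < t.+1)%N, (d < 2 ^ j.+1)%N & (t.+1 + d = 3 * 2 ^ j)%N]) ->
  okR e t -> ns e t z -> ~ str d z.
Proof.
move=> /andP[td di] hm ok hz hs.
have hd : (0 < d < 2 ^ i)%N by nlia.
have ht1 : (0 < t.+1 < 2 ^ i)%N by nlia.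
have gt := arr_tp A hd; have gb := arr_bt A hd; have gt1 := arr_tp A ht1; have gb1 := arr_bt A ht1.
have [s [hs' ez]] := hs; rewrite -/(lerp _ _ _) in ez.
case: hm => [e1|[j [j1 j2 e1]]].
  have [h _] := mate_top_sd (isT : (0 < t.+1)%N) td e1.
  have et : tp t.+1 = tp d by apply: (arr_top A) => //; nlia.
  have sz : sdd t.+1 z = (1 - s) * sdd t.+1 (bt d).
    by rewrite ez /sdd sd_lerp -et sd_r mulr0 addr0.
  case: (ok z hz) => [lt|[z0 [[_ _ zb]|[_ eM _]]]]; [by nra| |by nlia].
  have s1 : s = 1 by nra.
  by move: zb; rewrite ez s1 lerp1; lra.
have [h _] := mate_bot_sd j1 td di e1.
have et : bt t.+1 = bt d by apply: (arr_bot A (j := j)) => //; nlia.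
have sz : sdd t.+1 z = s * sdd t.+1 (tp d).
  by rewrite ez /sdd sd_lerp -et sd_l mulr0 add0r.
case: (ok z hz) => [lt|[z0 [[_ [j' [k1 k2]] _]|[_ eM zt]]]]; [by nra| |].
  have jj : j' = j by apply: (pow2_uniq (d := t.+1)); nlia.
  by rewrite jj in k2; nlia.
have s1 : s = 0 by nra.
by move: zt; rewrite ez s1 lerp0; lra.
Qed.

Lemma okL_mate e t d z : (0 < d < t)%N -> (t < 2 ^ i)%N ->
  ((d + t = 2 ^ i)%N \/ exists j, [/\ (2 ^ j < d)%N, (t < 2 ^ j.+1)%N & (d + t = 3 * 2 ^ j)%N]) ->
  okL e t -> ns e t z -> ~ str d z.
Proof.
move=> /andP[d0 td] ti hm ok hz hs.
have hd : (0 < d < 2 ^ i)%N by nlia.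
have ht1 : (0 < t < 2 ^ i)%N by nlia.
have gt := arr_tp A hd; have gb := arr_bt A hd; have gt1 := arr_tp A ht1; have gb1 := arr_bt A ht1.
have [s [hs' ez]] := hs; rewrite -/(lerp _ _ _) in ez.
case: hm => [e1|[j [j1 j2 e1]]].
  have [_ h] := mate_top_sd d0 td e1.
  have et : tp d = tp t by apply: (arr_top A) => //; nlia.
  have sz : sdd t z = (1 - s) * sdd t (bt d).
    by rewrite ez /sdd sd_lerp et sd_r mulr0 addr0.
  case: (ok z hz) => [lt|[z0 [[_ _ zb]|[_ eM _]]]]; [by nra| |by nlia].
  have s1 : s = 1 by nra.
  by move: zb; rewrite ez s1 lerp1; lra.
have [_ h] := mate_bot_sd j1 td ti e1.
have et : bt d = bt t by apply: (arr_bot A (j := j)) => //; nlia.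
have sz : sdd t z = s * sdd t (tp d).
  by rewrite ez /sdd sd_lerp et sd_l mulr0 add0r.
case: (ok z hz) => [lt|[z0 [[_ [j' [k1 k2]] _]|[_ eM zt]]]]; [by nra| |].
  have jj : j' = j by apply: (pow2_uniq (d := t)); nlia.
  by rewrite jj in k2; nlia.
have s1 : s = 0 by nra.
by move: zt; rewrite ez s1 lerp0; lra.
Qed.

(** Strands missed by the limit position stay disjoint by compactness; the neighbours and their
    partners, which may be touched in the limit, are handled by signs. *)
Lemma ns_str t d : (t < 2 ^ i)%N -> (0 < d < 2 ^ i)%N ->
  small (fun e => forall z, ns e t z -> ~ str d z).
Proof.
move=> ht hd.
have [e1|n1] := eqVneq d t.
  rewrite e1 in hd *; apply: small_imp (okL_small hd) => e _ ok z; exact: okL_str.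
have [e1|n2] := eqVneq d t.+1.
  rewrite e1 in hd *; have hd' : (t.+1 < 2 ^ i)%N by nlia.
  apply: small_imp (okR_small hd') => e _ ok z; exact: okR_str.
have [hm|hm] := pselect ((d + topd t = 2 ^ i)%N \/ (1 < t)%N /\ (d + botd t = 3 * 2 ^ lb t)%N); last first.
  apply: small_imp (small_disjoint (p := abot t) (q := atop t) (p' := bt d) (q' := tp d) (ubot t) (utop t) (0, 0) (0, 0) _); last first.
    by move=> z h1 h2; apply: hm; apply: lim_str h1 h2.
  by move=> e _ h z h1 h2; apply: (h z h1); rewrite -!/(shift _ (0, 0) e) !shift0.
case: (ltngtP d t) n1 => // dt _.
  have ht' : (0 < t < 2 ^ i)%N by nlia.
  apply: small_imp (okL_small ht') => e _ ok z; apply: okL_mate => //; first by nlia.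
  case: hm => [e1|[t1 e1]].
    by left; move: e1; rewrite /topd; case: ltnP; nlia.
  have := lbP (ltnW t1) => lbt; have [c [ec c0]] := even_pow (lb_gt0 t1).
  rewrite expnS in lbt; right; exists (lb t); rewrite expnS.
  by move: e1; rewrite /botd; case: (leqP (2 * t.+1) (3 * 2 ^ lb t)) => h1 h2; split; nlia.
have dt' : (t.+1 < d)%N by nlia.
have ht' : (t.+1 < 2 ^ i)%N by nlia.
apply: small_imp (okR_small ht') => e _ ok z; apply: okR_mate => //; first by nlia.
case: hm => [e1|[t1 e1]].
  by left; move: e1; rewrite /topd; case: ltnP; nlia.
have := lbP (ltnW t1) => lbt; have [c [ec c0]] := even_pow (lb_gt0 t1).
rewrite expnS in lbt; right; exists (lb t); rewrite expnS.
by move: e1; rewrite /botd; case: (leqP (2 * t.+1) (3 * 2 ^ lb t)) => h1 h2; split; nlia.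
Qed.

Lemma topQ_mate e t t' : (t + t' + 1 = 2 ^ i)%N -> topQ e t = topQ e t'.
Proof.
move=> h; have hd : (topd t + topd t' = 2 ^ i)%N.
  by rewrite /topd; case: ltnP => h1; case: ltnP => h2; nlia.
have p1 : (0 < topd t)%N by rewrite /topd; case: (ltnP t M); nlia.
have p2 : (0 < topd t')%N by rewrite /topd; case: (ltnP t' M); nlia.
have et : tp (topd t) = tp (topd t') by apply: (arr_top A).
have e1 : (2 ^ i - topd t)%N = topd t' by nlia.
have e2 : (2 ^ i - topd t')%N = topd t by nlia.
by rewrite /topQ /shift /atop /utop e1 e2 et /=; congr (_, _); ring.
Qed.

Lemma botQ_mate e t t' j : (0 < j)%N -> (t < 2 ^ i)%N -> (2 ^ j <= t < 2 ^ j.+1)%N ->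
  (t + t' + 1 = 3 * 2 ^ j)%N -> botQ e t = botQ e t'.
Proof.
move=> j0 ti hj h; have [c [ec c0]] := even_pow j0; have hj' : (2 ^ j <= t' < 2 ^ j.+1)%N by move: hj; rewrite expnS; nlia.
have t1 : (1 < t)%N by nlia. have t1' : (1 < t')%N by nlia.
have l1 := lbE hj; have l2 := lbE hj'; have pl := lb_pow (ltnW t1) ti; rewrite l1 in pl.
have [b1 b2] := botd_range t1 ti; rewrite l1 in b1.
have hd : (botd t + botd t' = 3 * 2 ^ j)%N.
  rewrite /botd l1 l2; case: (leqP (2 * t.+1) (3 * 2 ^ j)) => h1;
    case: (leqP (2 * t'.+1) (3 * 2 ^ j)) => h2; nlia.
have et : bt (botd t) = bt (botd t') by apply: (arr_bot A (j := j)).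
have e1 : (3 * 2 ^ j - botd t)%N = botd t' by nlia.
have e2 : (3 * 2 ^ j - botd t')%N = botd t by nlia.
have Q u : (1 < u)%N -> botQ e u = shift (bt (botd u))
  (2 * (bt (botd u)).1 - (tp (botd u)).1 - (tp (3 * 2 ^ lb u - botd u)%N).1,
   2 * (bt (botd u)).2 - (tp (botd u)).2 - (tp (3 * 2 ^ lb u - botd u)%N).2) e.
  by case: u => [|[|u]].
by rewrite !Q // l1 l2 e1 e2 et /shift /=; congr (_, _); ring.
Qed.

Lemma ns_gateR e t : (t.+1 < 2 ^ i)%N -> hts e t -> okR e t -> xat (botQ e t) (topQ e t) gate < X t.+1 gate.
Proof.
move=> ht [h1 h2] ok; have ht' : (0 < t.+1 < 2 ^ i)%N by nlia.
have hz : ns e t (xat (botQ e t) (topQ e t) gate, gate) by apply: seg_x; lra.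
have := arr_bt A ht'; have := arr_tp A ht'.
case: (ok _ hz) => [|[_ [[_ _ /= l]|[_ _ /= l]]]]; [by rewrite X_sdd | lra | lra].
Qed.

Lemma ns_gateL e t : (0 < t < 2 ^ i)%N -> hts e t -> okL e t -> X t gate < xat (botQ e t) (topQ e t) gate.
Proof.
move=> ht' [h1 h2] ok.
have hz : ns e t (xat (botQ e t) (topQ e t) gate, gate) by apply: seg_x; lra.
have := arr_bt A ht'; have := arr_tp A ht'.
case: (ok _ hz) => [|[_ [[_ _ /= l]|[_ _ /= l]]]]; [by rewrite X_sdd | lra | lra].
Qed.

Lemma lim_lim t t' z : (t.+1 < t')%N -> (t' < 2 ^ i)%N -> seg (abot t) (atop t) z ->
  seg (abot t') (atop t') z ->
  (t.+1 + t' = 2 ^ i)%N \/ exists j, [/\ (2 ^ j < t.+1)%N, (t' < 2 ^ j.+1)%N & (t.+1 + t' = 3 * 2 ^ j)%N].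
Proof.
move=> tt ti hz hz'.
have ht : (t.+1 < 2 ^ i)%N by nlia. have ht1 : (0 < t.+1 < 2 ^ i)%N by nlia.
have ht' : (0 < t' < 2 ^ i)%N by nlia.
have [y1 x1] := lim_R ht hz; have [y2 x2] := lim_L ht' hz'.
have le : X t.+1 z.2 <= X t' z.2 by apply: (X_le A) => //.
have e1 : X t.+1 z.2 = z.1 by lra.
have e2 : X t' z.2 = z.1 by lra.
have s1 : str t.+1 z by rewrite [z]surjective_pairing -e1; apply: seg_x => //; exact: (bt_lt_tp A).
have s2 : str t' z by rewrite [z]surjective_pairing -e2; apply: seg_x => //; exact: (bt_lt_tp A).
case: (arr_disj A (isT : (0 < t.+1)%N) tt ti s1 s2) => [[e _]|[j [j1 j2 e _]]]; first by left.
by right; exists j.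
Qed.

(** New strands in adjacent gaps lie on different sides of the old strand between them and can meet
    only beyond its free end. Otherwise either the limits are disjoint, or the two strands share a
    bend and form a fan. *)
Lemma ns_ns t t' : (t < t')%N -> (t' < 2 ^ i)%N -> small (fun e => forall z, ns e t z -> ns e t' z ->
  (t + t' + 1 = 2 ^ i)%N /\ z = topQ e t \/
  exists j, [/\ (0 < j)%N, (2 ^ j <= t < 2 ^ j.+1)%N, (t + t' + 1 = 3 * 2 ^ j)%N & z = botQ e t]).
Proof.
move=> tt ti; have ht : (t.+1 < 2 ^ i)%N by nlia.
have ht' : (0 < t' < 2 ^ i)%N by nlia. have ht0 : (t < 2 ^ i)%N by nlia.
have base := small_and (small_and (okR_small ht) (okL_small ht')) (small_and (hts_small ht0) (hts_small ti)).
have [e1|n1] := eqVneq t' t.+1.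
  rewrite e1 in base ti ht' *; apply: small_imp base => e e0 [[oR oL] _] z hz hz'.
  case: (oR z hz) => [lt|[z0 tip]].
    by exfalso; case: (oL z hz') => [lt'|[z0' _]]; [have := lt_trans lt lt'; rewrite ltxx | move: lt; rewrite z0' ltxx].
  case: tip => [[ez [j [j1 j2]] _]|[ez eM _]]; [right|left].
    have [c [ec c0]] : exists c, (2 ^ j = 2 * c)%N /\ (0 < c)%N.
      by apply: even_pow; case: j j1 j2 => //; rewrite expn0; nlia.
    exists j; split=> //; try nlia.
    by case: j {j2} j1 ec => //; rewrite expn0; nlia.
  by split=> //; nlia.
have tt' : (t.+1 < t')%N by nlia.
have [hm|hm] := pselect ((t.+1 + t' = 2 ^ i)%N \/
   exists j, [/\ (2 ^ j < t.+1)%N, (t' < 2 ^ j.+1)%N & (t.+1 + t' = 3 * 2 ^ j)%N]); last first.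
  apply: small_imp (small_disjoint (p := abot t) (q := atop t) (p' := abot t') (q' := atop t') (ubot t) (utop t) (ubot t') (utop t') _); last first.
    by move=> z h1 h2; apply: hm; apply: lim_lim h1 h2.
  by move=> e _ h z h1 h2; exfalso; apply: (h z h1).
apply: small_imp base => e e0 [[oR oL] [hh hh']] z hz hz'.
have lt : xat (botQ e t) (topQ e t) gate < xat (botQ e t') (topQ e t') gate.
  apply: lt_trans (ns_gateR ht hh oR) _; apply: lt_trans (ns_gateL ht' hh' oL).
  by apply: (arr_lt A).
move: hh hh' => [b1 t1] [b2 t2]; rewrite /ns in hz hz'.
case: hm => [e1|[j [j1 j2 e1]]]; [left|right].
  split; first by nlia.
  have et : topQ e t = topQ e t' by apply: topQ_mate; nlia.
  rewrite et in b1 t1 lt hz *.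
  by apply: (fan_top _ _ lt hz hz'); rewrite ?b1 ?b2 ?t1 ?t2.
have j0 : (0 < j)%N by case: j j1 j2 e1 => //; rewrite expn0 expn1; nlia.
exists j; split=> //; try nlia.
have eb : botQ e t = botQ e t' by apply: (botQ_mate e (j := j)) => //; nlia.
rewrite eb in b1 t1 lt hz *.
by apply: (fan_bot _ _ lt hz hz'); rewrite ?b1 ?b2 ?t1 ?t2.
Qed.

(** At height 1 the strand in gap 0 is less than 1 away from the abscissa of [w_(i+1)], an even
    integer, while [v_l] has an odd one. The other gaps lie to the right of strand 1, which itself
    passes to the right of [v_l]. *)
Lemma ns_vp t l : (t < 2 ^ i)%N -> (i.+1 < l)%N -> small (fun e => ~ ns e t (vp l)).
Proof.
move=> ht il.
have lR : i%:R + 2 <= l%:R :> R by have := natrR R il; rewrite -!natr1; lra.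
have l2 : (2 <= l)%N by nlia.
suff lim : ~ seg (abot t) (atop t) (vp l).
  apply: small_imp (small_disjoint (p := abot t) (q := atop t) (p' := vp l) (q' := vp l) (ubot t) (utop t) (0, 0) (0, 0) _); last first.
    by move=> z h1 /segxx e; apply: lim; rewrite -e.
  by move=> e _ h h1; apply: (h _ h1); rewrite -!/(shift _ (0, 0) e) !shift0; exact: seg_l.
have one : 0 <= (1 : R) <= 1 by rewrite ler01 lexx.
case: (posnP t) => [t0|t0] hz.
  have h1 := atop_gt (t := 0) ltac:(rewrite expn_gt0 //).
  have k0 := @natk0 R k.
  have [/andP[x1 x2] _] : inside (atop 0) by apply: (arr_tin A); apply: topd_range; rewrite expn_gt0.
  have ea : abot 0 = wp i.+1 by [].
  move: hz; rewrite t0 vpE // ea wpE => -[s [hs [/= ex ey]]].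
  rewrite mulr0 add0r in ey.
  rewrite gateE in h1; rewrite widthE in x1; rewrite -natr1 in ex.
  have ikR : i%:R + 1 <= k%:R :> R by have := natrR R ik; rewrite -natr1.
  have s0 : 0 < s by nra.
  have i00 : 0 <= i%:R :> R by exact: ler0n.
  have : s * ((atop 0).1 + 2 * i%:R + 2) < 1 by nra.
  have : - 1 < s * ((atop 0).1 + 2 * i%:R + 2) by nra.
  move=> b1 b2; have el : 3 - 2 * l%:R = - (2 * i%:R) - 2 + s * ((atop 0).1 + 2 * i%:R + 2) by lra.
  have l3 : (i.+2 < l)%N.
    by rewrite ltn_neqAle il andbT; apply/eqP => e; move: el; rewrite -e -!natr1; lra.
  by have := natrR R l3; rewrite -!natr1; lra.
have ht' : (0 < t < 2 ^ i)%N by nlia.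
have [y1 x1] := lim_L ht' hz; rewrite vpE //= in y1 x1.
have := X1 one => /andP[x2 _].
have hi1 : (0 < 1 < 2 ^ i)%N by nlia.
have : X 1 1 <= X t 1.
  case: (ltngtP t 1) => [t2|t2|->]; [by exfalso; nlia| |by []].
  apply: (X_le A) => //.
  by rewrite strand1 wpE /= ler01; have := arr_tp A hi1; have := @natk0 R k; rewrite gateE; lra.
lra.
Qed.

Lemma small_impl (C : Prop) (Q : R -> Prop) : (C -> small Q) -> small (fun e => C -> Q e).
Proof.
move=> h; have [c|c] := pselect C; first by apply: small_imp (h c) => e _ q _.
by apply: small_true => e _ /c.
Qed.

Lemma inside_small p u : inside p -> small (fun e => inside (shift p u e)).
Proof.
move=> [/andP[h1 h2] /andP[h3 h4]].
apply: small_imp (small_and (small_and (small_gt u.1 h1) (small_lt u.1 h2))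
  (small_and (small_gt u.2 h3) (small_lt u.2 h4))) => e _ [[a1 a2] [a3 a4]].
by rewrite /inside /shift /= a1 a2 a3 a4.
Qed.

Lemma abot_in t : (0 < t < 2 ^ i)%N -> inside (abot t).
Proof.
case: t => [|[|t]] // ht; first by apply: vp_inside; nlia.
have [db dbi] := botd_range (isT : (1 < t.+2)%N) (proj2 (andP ht)).
exact: (arr_bin A dbi db).
Qed.

Definition good e := [/\ forall t, (t < 2 ^ i)%N -> hts e t,
  forall t, (t < 2 ^ i)%N -> inside (topQ e t) /\ ((0 < t)%N -> inside (botQ e t)),
  forall t, (t < 2 ^ i)%N -> forall d, (d < 2 ^ i)%N -> (0 < d)%N -> forall z, ns e t z -> ~ str d z,
  forall t', (t' < 2 ^ i)%N -> forall t, (t < t')%N -> forall z, ns e t z -> ns e t' z ->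
    (t + t' + 1 = 2 ^ i)%N /\ z = topQ e t \/
    exists j, [/\ (0 < j)%N, (2 ^ j <= t < 2 ^ j.+1)%N, (t + t' + 1 = 3 * 2 ^ j)%N & z = botQ e t] &
  forall t, (t < 2 ^ i)%N -> forall l, (l < k.+1)%N -> (i.+1 < l)%N -> ~ ns e t (vp l)].

Lemma good_ex : exists e, 0 < e /\ good e.
Proof.
apply: small_ex.
have g1 : small (fun e => forall t, (t < 2 ^ i)%N -> hts e t) by apply: small_all => t; exact: hts_small.
have g2 : small (fun e => forall t, (t < 2 ^ i)%N -> inside (topQ e t) /\ ((0 < t)%N -> inside (botQ e t))).
  apply: small_all => t ht; apply: small_and; first by apply: inside_small; apply: (arr_tin A); exact: topd_range.
  by apply: small_impl => t0; apply: inside_small; apply: abot_in; rewrite t0.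
have g3 : small (fun e => forall t, (t < 2 ^ i)%N -> forall d, (d < 2 ^ i)%N -> (0 < d)%N ->
    forall z, ns e t z -> ~ str d z).
  apply: small_all => t ht; apply: small_all => d hd; apply: small_impl => d0.
  by apply: ns_str => //; rewrite d0.
have g4 : small (fun e => forall t', (t' < 2 ^ i)%N -> forall t, (t < t')%N -> forall z, ns e t z -> ns e t' z ->
    (t + t' + 1 = 2 ^ i)%N /\ z = topQ e t \/
    exists j, [/\ (0 < j)%N, (2 ^ j <= t < 2 ^ j.+1)%N, (t + t' + 1 = 3 * 2 ^ j)%N & z = botQ e t]).
  by apply: small_all => t' ht'; apply: small_all => t ht; exact: ns_ns.
have g5 : small (fun e => forall t, (t < 2 ^ i)%N -> forall l, (l < k.+1)%N -> (i.+1 < l)%N -> ~ ns e t (vp l)).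
  by apply: small_all => t ht; apply: small_all => l _; apply: small_impl => il; exact: ns_vp.
apply: small_imp (small_and (small_and g1 g2) (small_and (small_and g3 g4) g5)) => e e0.
by move=> [[h1 h2] [[h3 h4] h5]]; split.
Qed.

(** New strands are numbered [2 * t + 1], so halving gives the gap [t]. *)
Let tw (a : nat) := (walk i a)./2.

Lemma tw_walk (a : nat) : (a < 2 ^ i)%N -> walk i a = (2 * tw a + 1)%N /\ (tw a < 2 ^ i)%N.
Proof.
move=> ha; have [od lt] := walk_odd ha; rewrite expnS in lt.
have e : walk i a = (2 * tw a + 1)%N by rewrite /tw -[LHS]odd_double_half od; nlia.
by split=> //; nlia.
Qed.

Lemma tw_inj (a b : nat) : (a < 2 ^ i)%N -> (b < 2 ^ i)%N -> tw a = tw b -> a = b.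
Proof.
move=> ha hb e; apply: (walk_inj (s := i)) => //.
by have [-> _] := tw_walk ha; have [-> _] := tw_walk hb; rewrite e.
Qed.

Lemma tw_top (a : nat) : ~~ odd a -> (a.+1 < 2 ^ i)%N -> (tw a + tw a.+1 + 1 = 2 ^ i)%N.
Proof.
move=> oa ha; have := walk_top oa ha; rewrite expnS.
by have [-> _] := tw_walk (ltnW ha); have [-> _] := tw_walk ha; nlia.
Qed.

Lemma tw_bot (a : nat) : odd a -> (a.+1 < 2 ^ i)%N -> exists j, [/\ (0 < j)%N,
  (2 ^ j <= tw a < 2 ^ j.+1)%N & (tw a + tw a.+1 + 1 = 3 * 2 ^ j)%N].
Proof.
move=> oa ha; have := walk_bot oa ha.
have [-> _] := tw_walk (ltnW ha); have [-> _] := tw_walk ha.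
(* In terms of gaps the block index drops by one. Index 1 would place two different segments in gap
   1, against injectivity. *)
move=> [[|[|j]] []]; rewrite ?expn0 ?expn1 ?expnS => h1 h2; first by nlia.
  have e : tw a = tw a.+1 by move: h1; rewrite ?expnS ?expn1 ?expn0; nlia.
  by have := tw_inj (ltnW ha) ha e; nlia.
by exists j.+1; rewrite !expnS; split=> //; nlia.
Qed.

Lemma tw0 : tw 0 = 0%N. Proof. by rewrite /tw walk0. Qed.

Lemma tw_last : tw (2 ^ i - 1) = 1%N.
Proof. by rewrite /tw; case: i i0 => // s _; rewrite walk_last. Qed.

Definition pth e : seq pt :=
  mkseq (fun a : nat => if (a < 2 ^ i)%N then (if odd a then topQ e (tw a) else botQ e (tw a)) else vp i.+1) (2 ^ i).+1.

Lemma botQ1 e : botQ e 1 = vp i.+1.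
Proof. by rewrite /botQ shift0. Qed.

Lemma botQ0 e : botQ e 0 = wp i.+1.
Proof. by rewrite /botQ shift0. Qed.

Lemma pth_nth e (a : nat) : (a < 2 ^ i)%N ->
  nth (0, 0) (pth e) a = (if odd a then topQ e (tw a) else botQ e (tw a)) /\
  nth (0, 0) (pth e) a.+1 = (if odd a then botQ e (tw a) else topQ e (tw a)).
Proof.
move=> ha; rewrite !nth_mkseq //; last exact: ltnW.
rewrite ha; split=> //; case: (ltnP a.+1 (2 ^ i)%N) => ha'.
  rewrite /=; case: (boolP (odd a)) => oa /=.
    have [j [j0 hj e1]] := tw_bot oa ha'.
    by apply: esym; apply: (botQ_mate e j0 _ hj e1); have [] := tw_walk (ltnW ha').
  by apply: esym; apply: topQ_mate; exact: tw_top.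
have ea : a = (2 ^ i - 1)%N by nlia.
have oa : odd a by nlia.
by rewrite oa ea tw_last botQ1.
Qed.

Lemma pth_seg e (a : nat) : (a < 2 ^ i)%N ->
  seg (nth (0, 0) (pth e) a) (nth (0, 0) (pth e) a.+1) = ns e (tw a).
Proof.
move=> ha; have [-> ->] := pth_nth e ha; case: ifP => // _; exact: seg_sym.
Qed.

Lemma pth_polyline e z : polyline (pth e) z -> exists2 t, (t < 2 ^ i)%N & ns e t z.
Proof.
move=> [a [ha hz]]; rewrite size_mkseq in ha; rewrite pth_seg in hz; last by nlia.
by exists (tw a) => //; have [] := @tw_walk a ltac:(nlia).
Qed.

Lemma ns_mate e (a b : nat) z : good e -> (a < 2 ^ i)%N -> (b < 2 ^ i)%N -> a != b -> ns e (tw a) z -> ns e (tw b) z ->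
  (tw a + tw b + 1 = 2 ^ i)%N /\ z = topQ e (tw a) \/
  exists j, [/\ (0 < j)%N, (2 ^ j <= tw a < 2 ^ j.+1)%N, (tw a + tw b + 1 = 3 * 2 ^ j)%N & z = botQ e (tw a)].
Proof.
move=> [_ _ _ nn _] ha hb ab hz hz'.
have [_ ta] := tw_walk ha; have [_ tb] := tw_walk hb.
case: (ltngtP (tw a) (tw b)) => tab.
- exact: (nn _ tb _ tab).
- case: (nn _ ta _ tab _ hz' hz) => [[e1 ez]|[j [j0 j1 e1 ez]]].
    by left; split; [nlia | rewrite ez; apply: topQ_mate; nlia].
  right; exists j; split=> //; [by move: j1; rewrite expnS; nlia | by nlia |].
  by rewrite ez; apply: (botQ_mate e j0 tb j1 e1).
- by exfalso; move/eqP: ab; apply; exact: tw_inj.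
Qed.

(** New strands meet only in bends shared by partners, and the partners of a gap are its neighbours
    in the walk. *)
Lemma pth_simple e : good e -> simple_polyline (pth e).
Proof.
move=> ge; rewrite /simple_polyline size_mkseq; have p := pow2 i; split; first by nlia.
have [hg _ _ _ _] := ge.
split.
  move=> a ha; have ha' : (a < 2 ^ i)%N by nlia.
  have [-> ->] := pth_nth e ha'; have [_ ta] := tw_walk ha'; have [h1 h2] := hg _ ta.
  by apply/eqP => /(congr1 snd) ee; case: ifP ee => _ ee; move: h1 h2; rewrite ee => h1 h2;
    have := lt_trans h1 h2; rewrite ltxx.
move=> a b ab hb /=; have hb' : (b < 2 ^ i)%N by nlia.
have ha' : (a < 2 ^ i)%N by nlia. have nab : a != b by nlia.
rewrite !pth_seg //; split.
  move=> eb; subst b; apply/seteqP; split=> z.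
    move=> [h1 h2]; have [_ en] := pth_nth e ha'; change (z = nth (0, 0) (pth e) a.+1); rewrite en.
    case: (ns_mate ge ha' hb' nab h1 h2) => [[e1 ->]|[j [j0 j1 e1 ->]]].
      case: ifP => // oa; exfalso; have [j [_ _ e2]] := tw_bot oa hb'.
      by apply: (@pow2_neq3 i j); rewrite -e1 e2.
    case: ifP => // /negbT oa; exfalso.
    by apply: (@pow2_neq3 i j); rewrite -e1 tw_top.
  move=> /= ->; split; first by rewrite -pth_seg //; exact: seg_r.
  by rewrite -pth_seg //; exact: seg_l.
move=> ab1; apply/seteqP; split=> z // -[h1 h2]; exfalso.
have [tb _] := (tw_walk hb').
case: (ns_mate ge ha' hb' nab h1 h2) => [[e1 _]|[j [j0 j1 e1 _]]].
  case: (boolP (odd a)) => oa.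
    have a0 : (a.-1.+1 = a)%N by nlia.
    have := @tw_top a.-1 ltac:(nlia) ltac:(nlia); rewrite a0 => e2.
    have : a.-1 = b by apply: tw_inj => //; nlia.
    by nlia.
  have e2 := @tw_top a oa ltac:(nlia).
  have : a.+1 = b by apply: tw_inj => //; nlia.
  by nlia.
case: (boolP (odd a)) => oa.
  have [j' [j0' j1' e2]] := @tw_bot a oa ltac:(nlia).
  have jj : j' = j by apply: (pow2_uniq (d := tw a)).
  have : a.+1 = b by apply: tw_inj => //; rewrite jj in e2; nlia.
  by nlia.
case: (posnP a) => a0.
  by move: j1; rewrite a0 tw0; have := pow2 j; nlia.
have a1 : (a.-1.+1 = a)%N by nlia.
have [j' [j0' j1' e2]] := @tw_bot a.-1 ltac:(nlia) ltac:(nlia); rewrite a1 in e2.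
have jj : j' = j.
  by apply: (pow2_uniq (d := tw a)) => //; move: j1'; rewrite expnS; nlia.
have : a.-1 = b by apply: tw_inj => //; rewrite jj in e2; nlia.
by nlia.
Qed.

Lemma conv_lt (l u v s : R) : l < u -> l < v -> 0 <= s <= 1 -> l < (1 - s) * u + s * v.
Proof.
move=> lu lv /andP[s0 s1]; have [->|sn] := eqVneq s 0; first by lra.
have sp : 0 < s by rewrite lt_def sn.
have := mulr_gt0 sp (_ : 0 < v - l); rewrite subr_gt0 => /(_ lv) h.
have : 0 <= (1 - s) * (u - l) by apply: mulr_ge0; lra.
by lra.
Qed.

Lemma conv_gt (l u v s : R) : u < l -> v < l -> 0 <= s <= 1 -> (1 - s) * u + s * v < l.
Proof.
move=> lu lv hs; have : - l < (1 - s) * (- u) + s * (- v) by apply: conv_lt; lra.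
by lra.
Qed.

Lemma inside_seg p q z : inside p -> inside q -> seg p q z -> inside z.
Proof.
move=> [/andP[a1 a2] /andP[a3 a4]] [/andP[b1 b2] /andP[b3 b4]] [s [hs ->]].
by rewrite /inside /= !conv_lt // !conv_gt.
Qed.

Lemma new_path_ex : exists Q : seq pt, [/\ size Q = (2 ^ i).+1, simple_polyline Q,
  exists s, Q = wp i.+1 :: rcons s (vp i.+1),
  forall z, polyline Q z -> z = wp i.+1 \/ inside z &
  (forall d z, (0 < d < 2 ^ i)%N -> polyline Q z -> ~ str d z) /\
  forall l, (i.+1 < l <= k)%N -> ~ polyline Q (vp l)].
Proof.
have [e [e0 ge]] := good_ex; exists (pth e); have [g1 g2 g3 g4 g5] := ge.
have p := pow2 i; split.
- by rewrite size_mkseq.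
- exact: pth_simple.
- have e1 : nth (0, 0) (pth e) 0 = wp i.+1 by have [-> _] := pth_nth e p; rewrite /= tw0 botQ0.
  have e2 : nth (0, 0) (pth e) (2 ^ i)%N = vp i.+1 by rewrite nth_mkseq // ltnn.
  have sz : size (pth e) = (2 ^ i).+1 by rewrite size_mkseq.
  case/lastP: (pth e) e1 e2 sz => [|Q x]; first by [].
  rewrite size_rcons => e1 e2 [sz]; move: e2; rewrite -sz nth_rcons ltnn eqxx => <-.
  by case: Q sz e1 => [|y Q] /= sz; [nlia | move=> <-; exists Q].
- move=> z /pth_polyline[t ht hz].
  have [hi1 hi2] := g2 t ht.
  have [t0|t0] := posnP t; last first.
    by right; exact: inside_seg (hi2 t0) hi1 hz.
  case: hz => s [hs ->]; rewrite -/(lerp _ _ _) t0 botQ0.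
  have [s0|s0] := eqVneq s 0; [by left; rewrite s0 lerp0 | right].
  have sp : 0 < s by rewrite lt_def s0; case/andP: hs.
  rewrite t0 in hi1; rewrite wpE -natr1 /inside /lerp /=; move: hi1 => [/andP[a1 a2] /andP[a3 a4]].
  rewrite widthE in a1 *; rewrite heightE in a4 *.
  have ikR : i%:R + 1 <= k%:R :> R by have := natrR R ik; rewrite -natr1.
  have i00 : 0 <= i%:R :> R by exact: ler0n.
  split; apply/andP; split; [by apply: conv_lt => //; lra|by apply: conv_gt => //; lra| |].
    by rewrite mulr0 add0r; exact: mulr_gt0.
  by apply: conv_gt => //; lra.
- split; first by move=> d z /andP[d0 di] /pth_polyline[t ht hz]; exact: g3 hz.
  by move=> l /andP[l1 l2] /pth_polyline[t ht hz]; exact: g5 hz.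
Qed.

End NewStrands.

(** * Which strands belong to which edge *)

(** There are as many odd numbers below [2 ^ s.+1] as indices, and the walk is injective. *)
Lemma walk_surj s w : odd w -> (w < 2 ^ s.+1)%N -> exists2 a, (a < 2 ^ s)%N & walk s a = w.
Proof.
move=> ow lw; pose l := [seq (walk s a)./2 | a <- iota 0 (2 ^ s)].
have ul : uniq l.
  rewrite map_inj_in_uniq ?iota_uniq // => a b; rewrite !mem_iota /= !add0n => ha hb e.
  have [oa _] := walk_odd ha; have [ob _] := walk_odd hb.
  apply: (walk_inj (s := s)) => //.
  by rewrite -[LHS]odd_double_half -[RHS]odd_double_half oa ob e.
have sl : {subset l <= iota 0 (2 ^ s)}.
  move=> x /mapP[a]; rewrite !mem_iota /= !add0n => ha ->.
  by have [_] := walk_odd ha; rewrite expnS; lia.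
have [_ el] := uniq_min_size ul sl ltac:(by rewrite size_map).
have : w./2 \in l by rewrite el mem_iota /= add0n; move: lw; rewrite expnS; lia.
case/mapP => a; rewrite mem_iota /= add0n => ha e; exists a => //.
have [oa _] := walk_odd ha.
by rewrite -[LHS]odd_double_half -[RHS]odd_double_half oa ow e.
Qed.

(** The strands of edge [m] are the odd multiples of [2 ^ (i - m)]. Following the edge from its
    foot, the two sharing rules keep the colour [c] constant, so it is true exactly on the last
    edge. *)
Lemma strand_parity i (c : nat -> bool) :
  (forall d d', (0 < d)%N -> (0 < d')%N -> (d + d' = 2 ^ i)%N -> c d = c d') ->
  (forall d d' j, (d < 2 ^ i)%N -> (2 ^ j < d < 2 ^ j.+1)%N -> (d + d' = 3 * 2 ^ j)%N -> c d = c d') ->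
  (forall m, (1 <= m <= i)%N -> c (2 ^ (i - m))%N = (m == i)) ->
  forall d, (0 < d < 2 ^ i)%N -> c d = odd d.
Proof.
move=> ct cb cw d /andP[d0 di].
have [w ow ed] := pfactor_coprime (isT : prime 2) d0; rewrite coprime2n in ow.
move: (logn 2 d) ed => u ed; rewrite ed in di *; clear d0 ed d.
have pu := pow2 u.
have w0 : (0 < w)%N by case: w ow {di}.
have ui : (u < i)%N by rewrite -(ltn_exp2l u i (isT : (1 < 2)%N)); nia.
pose s := (i - u).-1; have es : (s.+1 + u = i)%N by rewrite /s; lia.
have lw : (w < 2 ^ s.+1)%N by move: di; rewrite -es expnD ltn_pmul2r.
have [a ha <-] := walk_surj ow lw.
have -> : odd (walk s a * 2 ^ u) = (u == 0%N).
  by have [oa _] := walk_odd ha; rewrite oddM oa odd_pow2.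
elim: a ha => [|a IH] ha.
  rewrite walk0 mul1n; have := cw (i - u)%N ltac:(lia); rewrite subKn; last by lia.
  by move=> ->; apply/eqP/eqP; lia.
rewrite -(IH (ltnW ha)); apply: esym.
have [_ /andP[a0 a1]] := walk_odd (ltnW ha); have [_ /andP[b0 b1]] := walk_odd ha.
case: (boolP (odd a)) => oa.
  have [j [hj ej]] := walk_bot oa ha.
  apply: (cb _ _ (j + u)%N).
  - by rewrite -es expnD ltn_pmul2r.
  - by rewrite -addSn !expnD !ltn_pmul2r.
  - by rewrite -mulnDl ej expnD mulnA.
by apply: ct; rewrite ?muln_gt0 ?a0 ?b0 ?pu // -mulnDl (walk_top oa ha) -es expnD.
Qed.

(** * Lower bound: every next edge passes through all gaps *)

Section LowerBound.
Variables (R : realType) (k : nat).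
Local Notation pt := (R * R)%type.
Implicit Types (p z : pt) (y : R) (d t a b : nat).
Local Notation wp := (@wp R).
Local Notation vp := (@vp R k).
Local Notation gate := (@gate R k).
Local Notation width := (@width R k).
Local Notation inside := (@inside R k).
Variables (i : nat) (tp bt : nat -> pt) (s0 : seq pt).
Hypotheses (A : arr k i tp bt) (i0 : (0 < i)%N) (ik : (i < k)%N).
Let Q := wp i.+1 :: rcons s0 (vp i.+1).
Local Notation X := (X tp bt).
Local Notation str d := (seg (bt d) (tp d)).
Hypotheses (Qin : forall z, polyline Q z -> z = wp i.+1 \/ inside z)
  (Qdis : forall d z, (0 < d < 2 ^ i)%N -> polyline Q z -> ~ str d z)
  (Qsim : simple_polyline Q).

Let ik' : (i <= k)%N. Proof. exact: ltnW. Qed.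
Let N0 : (0 < 2 ^ i)%N. Proof. exact: pow2. Qed.
Let iR : 1 <= i%:R :> R. Proof. exact: (natrR R (m := 1)). Qed.
Let ikR : i%:R + 1 <= k%:R :> R. Proof. by have := natrR R ik; rewrite -natr1. Qed.
Let vpi : vp i.+1 = (1 - 2 * i%:R, 1).
Proof. by rewrite vpE // -natr1; congr pair; ring. Qed.
Let wpi : wp i.+1 = (- (2 * i%:R) - 2, 0).
Proof. by rewrite wpE -natr1; congr pair; ring. Qed.

(** The descent at abscissa [1 - 2 * i] runs halfway between [w_i] and [w_(i-1)], and thus separates
    the foot of the last edge from all earlier ones. *)
Let c1 : pt := (1 - 2 * i%:R, -1).
Let c2 : pt := (- (2 * i%:R) - 2, -1).
Let loop := rcons (rcons (rcons s0 (vp i.+1)) c1) c2.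

Lemma loop_polyline z : polyline (wp i.+1 :: rcons loop (wp i.+1)) z ->
  polyline Q z \/ (z.2 <= 0 /\ z.2 < 0 \/ z = wp i.+1) \/ (z.1 = 1 - 2 * i%:R /\ z.2 <= 1).
Proof.
rewrite /loop -!rcons_cons polyline_rcons => -[|]; last first.
  rewrite wpi /c2; case=> t [ht ->] /=; right; left.
  have [->|t1] := eqVneq t 1; first by right; congr pair; ring.
  have : t < 1 by rewrite lt_neqAle t1; case/andP: ht.
  by move=> t1'; left; split; lra.
rewrite polyline_rcons => -[|]; last first.
  by rewrite /c1 /c2 => -[t [ht ->]] /=; right; left; left; split; lra.
rewrite polyline_rcons => -[|]; first by left.
by rewrite vpi /c1 => -[t [ht ->]] /=; right; right; split; lra.
Qed.

Local Notation q a := (nth (0, 0) Q a).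
Local Notation sg a := (seg (q a) (q a.+1)).

Lemma sg_Q a z : (a.+1 < size Q)%N -> sg a z -> polyline Q z.
Proof. by move=> ha hz; exists a. Qed.

Lemma q_inside a : (0 < a < size Q)%N -> inside (q a).
Proof.
case: a => // a ha; have qa : polyline Q (q a.+1) by apply: (sg_Q ha); exact: seg_r.
case: (Qin qa) => // e; exfalso.
have [_ [ne dis]] := Qsim.
case: a ha e {qa} => [|a] ha e; first by have := ne 0%N ha; rewrite e /= eqxx.
have [d1 d2] := dis 0%N a.+1 isT ha; move: d1 d2 => /=.
have w0 : seg (q 0) (q 1) (wp i.+1) by exact: seg_l.
have wa : seg (q a.+1) (q a.+2) (wp i.+1) by rewrite -e; exact: seg_r.
case: (posnP a) => [a0|a0] d1 d2.
  have := d1 (congr1 S a0); move: (ne 0%N ltac:(rewrite a0 in ha; exact: ltnW)).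
  move=> n01 es; have : ([set q a.+1] : set pt) (wp i.+1) by rewrite -es.
  by rewrite /= a0 => e1; move: n01; rewrite /= -e1 eqxx.
by have := d2 ltac:(by rewrite ltnS); move/seteqP => [/(_ (wp i.+1)) h _]; apply: h.
Qed.

Lemma hits_above p s (x : R) : (forall r, r \in p :: s -> 0 < r.2) -> hits p s (x, 0) = false.
Proof.
elim: s p => // r s IH p h /=; rewrite IH; last first.
  by move=> r' hr; apply: h; rewrite in_cons hr orbT.
rewrite addbF /hitr /= !leNgt (h p) ?mem_head // (h r) //.
by rewrite !in_cons eqxx orbT.
Qed.

(** All vertices of [Q] but the first are above the floor. A ray along the floor therefore sees only
    the first segment, at its foot, and the descent from [v_(i+1)]. *)
Lemma loop_hits (x : R) : hits (wp i.+1) (rcons loop (wp i.+1)) (x, 0) =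
  (x < - (2 * i%:R) - 2) (+) (x < 1 - 2 * i%:R).
Proof.
rewrite /loop !hits_rcons !last_rcons.
have hv : (vp i.+1).2 = 1 by rewrite vpi.
have -> : hitr c2 (wp i.+1) (x, 0) = false by rewrite /hitr wpi /= lexx lerN10.
have -> : hitr c1 c2 (x, 0) = false by rewrite /hitr /= eqxx.
have -> : hitr (vp i.+1) c1 (x, 0) = (x < 1 - 2 * i%:R).
  rewrite /hitr vpi /c1 /xat /= lerN10 ler10 /=; congr (_ < _).
  by rewrite subrr mul0r mulr0 addr0.
rewrite !addbF; congr addb.
rewrite -hits_rcons.
have pos r : r \in rcons s0 (vp i.+1) -> 0 < r.2.
  move=> hr; have := @q_inside (index r (rcons s0 (vp i.+1))).+1.
  rewrite /Q /= nth_index // ltnS index_mem => /(_ hr) [_ /andP[h _]].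
  exact: h.
case E : (rcons s0 (vp i.+1)) pos => [|r s] pos; first by case: (s0) E.
rewrite /= hits_above // addbF /hitr wpi /= lexx leNgt (pos r) ?mem_head //=.
have r0 := pos r (mem_head _ _).
by congr (_ < _); rewrite /xat /= subrr mul0r addr0.
Qed.

Lemma strand_y d z : (0 < d < 2 ^ i)%N -> str d z ->
  [/\ 0 <= z.2, z.1 = X d z.2, (bt d).2 <= z.2 <= (tp d).2 & z.2 = 0 -> exists2 m, (1 <= m <= i)%N & z = wp m].
Proof.
move=> hd hz; have lt := bt_lt_tp A hd.
have [hy ex] := seg_y lt hz.
have [j hj] := pow2_bracket (proj1 (andP hd)).
have [e|ne] := eqVneq d (2 ^ j)%N.
  have ji : (j < i)%N by rewrite -(ltn_exp2l j i (isT : (1 < 2)%N)) -e; case/andP: hd.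
  have bw : bt d = wp (i - j) by rewrite e -(arr_w A) ?subKn //; nlia.
  rewrite bw in hy; split=> //; [by move: hy; rewrite wpE /=; lra | by rewrite bw |].
  move=> z0; exists (i - j)%N; first by nlia.
  by rewrite [z]surjective_pairing ex z0 /xat bw wpE /= subr0 mul0r addr0.
have bin : inside (bt d) by apply: (arr_bin A (j := j)); [case/andP: hd|nlia].
have b0 : 0 < (bt d).2 by case: bin => _ /andP[].
split=> //; first by lra.
by move=> z0; exfalso; move: hy; rewrite z0 => /andP[+ _]; rewrite leNgt b0.
Qed.

(** Only the descent needs an estimate: up to height 1, strand 1 stays to its left and strand 2,
    hence every later one, to its right, by [X_w]. *)
Lemma strand_loop d z : (0 < d < 2 ^ i)%N -> str d z -> ~ polyline (wp i.+1 :: rcons loop (wp i.+1)) z.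
Proof.
move=> hd hz; have [y0 ex hy zw] := strand_y hd hz.
move=> /loop_polyline[hq|[[[_ neg]|e]|[e1 e2]]].
- exact: Qdis hq hz.
- by lra.
- have [|m hm e'] := zw; first by rewrite e wpi.
  have : m%:R = i%:R + 1 :> R by move: e'; rewrite e wpi wpE => -[]; lra.
  by rewrite natr1 => /eqP; rewrite eqr_nat; nlia.
have y1 : 0 <= z.2 <= 1 by rewrite y0.
case/andP: (hd) => d0 di.
have [d1|d1] := eqVneq d 1%N.
  have hi : (1 <= i <= i)%N by rewrite i0 leqnn.
  have := X_w A ik' hi y1; rewrite subnn expn0 (_ : X 1 z.2 = z.1); last by rewrite ex d1.
  by rewrite e1; lra.
have i1 : (1 < i)%N by case: i di => [|[|//]]; rewrite ?expn0 ?expn1; nlia.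
have := @X_w _ _ _ _ _ A ik' (i - 1)%N z.2 ltac:(nlia) y1.
rewrite subKn // expn1 natrB // => /andP[h2 _].
have : X 2 z.2 <= X d z.2.
  case: (ltngtP d 2) => [|d2|-> //]; first by nlia.
  apply: (X_le A) => //.
  have := arr_w A (m := i - 1) ltac:(nlia); rewrite subKn // expn1 => ->.
  have := arr_tp A (d := 2) ltac:(nlia); rewrite gateE wpE /=.
  by have := @natk0 R k; lra.
by rewrite -ex e1; lra.
Qed.

Local Notation par z := (hits (wp i.+1) (rcons loop (wp i.+1)) z).

(** Parity is constant along each earlier edge, so it is decided at the feet, of which only [w_i] is
    enclosed. *)
Lemma strand_par d z : (0 < d < 2 ^ i)%N -> str d z -> par z = odd d.
Proof.
move=> hd hz.
have pz d' z' : (0 < d' < 2 ^ i)%N -> str d' z' -> par (bt d') = par z'.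
  move=> hd' hz'; apply: closed_parity => r hr hr'; apply: (strand_loop hd' _ hr).
  by apply: seg_sub hr' => //; exact: seg_l.
rewrite -(pz _ _ hd hz); move: d hd {hz}; apply: (@strand_parity i (fun d => par (bt d))).
- move=> d d' d0 d0' e; rewrite (pz d (tp d)) ?(pz d' (tp d')); [|nlia|exact: seg_r|nlia|exact: seg_r].
  by rewrite (arr_top A d0 d0' e).
- by move=> d d' j di hj e; rewrite (arr_bot A di hj e).
move=> m hm; rewrite (arr_w A hm) (wpE _ m) loop_hits.
have mi : m%:R <= i%:R :> R by apply: natrR; nlia.
have -> : (- (2 * m%:R) < - (2 * i%:R) - 2 :> R) = false by apply/negbTE; rewrite -leNgt; lra.
case: eqVneq => [->|ne] /=; first by lra.
have := natrR R (_ : (m < i)%N); rewrite -natr1 => /(_ ltac:(nlia)) h.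
by apply/negbTE; rewrite -leNgt; lra.
Qed.

Definition wall t : R := if t == 0%N then - width else if t == (2 ^ i)%N then 0 else X t gate.

Lemma loop_x z : polyline (wp i.+1 :: rcons loop (wp i.+1)) z -> 0 <= z.2 -> - width < z.1 < 0.
Proof.
move=> hz z0; have hi := iR; have hk := ikR.
case: (loop_polyline hz) => [/Qin[->|[]//]|[[[_ z1]|->]|[-> _]]]; rewrite ?wpi ?widthE /=.
- by lra.
- by move: z1; rewrite ltNge z0.
- by lra.
- by lra.
Qed.

Lemma gate_gt : 1 < gate /\ 0 <= gate.
Proof. by have := @natk0 R k; rewrite gateE; split; lra. Qed.

Lemma gate_str d : (0 < d < 2 ^ i)%N -> str d (X d gate, gate).
Proof.
move=> hd; apply: seg_x; first exact: (bt_lt_tp A).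
by have := arr_bt A hd; have := arr_tp A hd; lra.
Qed.

Lemma wall_par t : (t <= 2 ^ i)%N -> par (wall t, gate) = odd t.
Proof.
(* Along a side wall the parity does not change, so it can be read off at the floor. *)
move=> ht; have [g1 g0] := gate_gt; have hi := iR; have hk := ikR.
have side x : x = - width \/ x = 0 -> par (x, 0) = par (x, gate).
  move=> hx; apply: closed_parity => r hr [u [hu er]].
  have r1 : r.1 = x by rewrite er /=; ring.
  have r2 : 0 <= r.2 by rewrite er /= mulr0 add0r mulr_ge0 //; case/andP: hu.
  by have := loop_x hr r2; rewrite r1; case: hx => ->; lra.
rewrite /wall; case: eqVneq => [->|t0].
  rewrite -side; last by left.
  rewrite loop_hits widthE.
  have -> : - (2 * k%:R + 2) < - (2 * i%:R) - 2 :> R by lra.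
  by have -> : - (2 * k%:R + 2) < 1 - 2 * i%:R :> R by lra.
case: eqVneq => [->|tN].
  rewrite -side; last by right.
  rewrite loop_hits odd_pow2 (_ : (i == 0)%N = false); last by nlia.
  have -> : (0 < - (2 * i%:R) - 2 :> R) = false by apply/negbTE; rewrite -leNgt; lra.
  by have -> : (0 < 1 - 2 * i%:R :> R) = false by apply/negbTE; rewrite -leNgt; lra.
have hd : (0 < t < 2 ^ i)%N by nlia.
by apply: strand_par (gate_str hd).
Qed.

Lemma wall_X d : (0 < d < 2 ^ i)%N -> wall d = X d gate.
Proof. by move=> hd; rewrite /wall !ifF //; apply/eqP; nlia. Qed.

Lemma wall_lt t t' : (t < t' <= 2 ^ i)%N -> wall t < wall t'.
Proof.
have wd : 0 < width by have := @natk0 R k; rewrite widthE; lra.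
have Xin d : (0 < d < 2 ^ i)%N -> - width < X d gate < 0.
  move=> hd; have bin : - width < (bt d).1 < 0.
    have [j hj] := pow2_bracket (proj1 (andP hd)).
    have [e|ne] := eqVneq d (2 ^ j)%N; last first.
      have dN : (d < 2 ^ i)%N by case/andP: hd.
      by have [] := arr_bin A (d := d) (j := j) dN ltac:(nlia).
    have ji : (j < i)%N by rewrite -(ltn_exp2l j i (isT : (1 < 2)%N)) -e; case/andP: hd.
    have -> : bt d = wp (i - j) by rewrite e -(arr_w A) ?subKn //; nlia.
    have := natrR R (_ : (i - j <= k)%N); have := natrR R (_ : (1 <= i - j)%N).
    by rewrite wpE widthE /= => /(_ ltac:(nlia)) h1 /(_ ltac:(nlia)) h2; lra.
  have [tin _] := arr_tin A hd.
  have [u [hu /(congr1 fst) /= ->]] := gate_str hd.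
  by rewrite conv_lt ?conv_gt //; lra.
case/andP=> tt tN; rewrite {1}/wall; case: eqVneq => [t0|t0].
  rewrite /wall ifF; last by apply/eqP; nlia.
  case: eqVneq => [_|n]; first by lra.
  by have := Xin t' ltac:(nlia); lra.
rewrite ifF; last by apply/eqP; nlia.
rewrite /wall ifF; last by apply/eqP; nlia.
case: eqVneq => [_|n]; first by have := Xin t ltac:(nlia); lra.
by apply: (arr_lt A) => //; nlia.
Qed.

Lemma Q_wall x d : (d <= 2 ^ i)%N -> polyline Q (x, gate) -> x != wall d.
Proof.
move=> hd hq; have [g1 g0] := gate_gt; apply/eqP => e.
have [e'|[/= hx _]] := Qin hq; first by move/(congr1 snd): e'; rewrite wpi /=; lra.
case: (posnP d) => [d0|d0]; first by move: hx; rewrite e d0 /wall /= ltxx.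
case: (eqVneq d (2 ^ i)%N) => [dN|dN].
  by move: hx; rewrite e dN /wall eqxx ifF ?ltxx ?andbF //; apply/eqP; nlia.
have hd' : (0 < d < 2 ^ i)%N by nlia.
by apply: (Qdis hd' hq); rewrite e wall_X //; exact: gate_str.
Qed.

(* The ends of a gap have different parities, so the closed curve separates them. *)
Lemma gap_met t : (t < 2 ^ i)%N -> exists2 x, wall t < x < wall t.+1 & polyline Q (x, gate).
Proof.
move=> ht; apply: contrapT => no; have [g1 g0] := gate_gt.
have lw : wall t < wall t.+1 by apply: wall_lt; rewrite ltnSn.
suff : par (wall t, gate) = par (wall t.+1, gate).
  by rewrite !wall_par //= ?(ltnW ht) //; case: (odd t).
apply: closed_parity => r hr [u [/andP[u0 u1] er]].
have r2 : r.2 = gate by rewrite er /=; ring.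
have r1 : r.1 = (1 - u) * wall t + u * wall t.+1 by rewrite er.
have rQ : polyline Q (r.1, gate).
  rewrite -r2 -surjective_pairing.
  by case: (loop_polyline hr) => [//|[[[_ ?]|e]|[_ ?]]]; [lra| |lra]; move: r2; rewrite e wpi /=; lra.
apply: no; exists r.1 => //.
have n1 := Q_wall (ltnW ht) rQ; have n2 := Q_wall ht rQ.
rewrite (lt_neqAle (wall t)) eq_sym n1 (lt_neqAle r.1) n2 /= r1.
by apply/andP; split; nra.
Qed.

Lemma Q_gap x : polyline Q (x, gate) -> exists2 t, (t < 2 ^ i)%N & wall t < x < wall t.+1.
Proof.
move=> hq; have [g1 g0] := gate_gt.
have [e'|[/= hx _]] := Qin hq; first by move/(congr1 snd): e'; rewrite wpi /=; lra.
have : x < wall (2 ^ i) by rewrite /wall eqxx ifF; [lra|apply/eqP; nlia].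
suff H n : (n <= 2 ^ i)%N -> x < wall n -> exists2 t, (t < 2 ^ i)%N & wall t < x < wall t.+1 by exact: H.
elim: n => [|n IH] hn; first by rewrite {1}/wall /=; lra.
case: (ltP x (wall n)) => [lt|ge] lt'; first by apply: IH => //; exact: ltnW.
by exists n => //; rewrite lt' andbT lt_neqAle ge eq_sym Q_wall // ltnW.
Qed.

(** A straight segment through two gaps would contain the point of the gate where a strand between
    them crosses. *)
Lemma gap_uniq t t' x x' a : (t < 2 ^ i)%N -> (t' < 2 ^ i)%N -> (a.+1 < size Q)%N ->
  wall t < x < wall t.+1 -> wall t' < x' < wall t'.+1 -> sg a (x, gate) -> sg a (x', gate) -> t = t'.
Proof.
wlog tt : t t' x x' / (t < t')%N.
  move=> H ht ht' ha hx hx' s1 s2; case: (ltngtP t t') => // tt.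
    exact: H tt ht ht' ha hx hx' s1 s2.
  by apply: esym; exact: H tt ht' ht ha hx' hx s2 s1.
move=> ht ht' ha hx hx' s1 s2; exfalso.
have hd : (0 < t' < 2 ^ i)%N by nlia.
apply: (Qdis hd (z := (X t' gate, gate))); last exact: gate_str.
apply: (sg_Q ha); apply: (seg_sub s1 s2).
have w1 : wall t.+1 <= wall t'.
  case: (ltngtP t.+1 t') => [lt|gt|->//]; last by nlia.
  by apply: ltW; apply: wall_lt; rewrite lt ltnW.
rewrite -(wall_X hd); have xx : 0 < x' - x by lra.
exists ((wall t' - x) / (x' - x)); split.
  by rewrite ler_pdivlMr // ler_pdivrMr //; lra.
by congr pair; rewrite /=; field; rewrite gt_eqF.
Qed.

Lemma gap_seg t : (t < 2 ^ i)%N ->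
  exists a x, [/\ (a.+1 < size Q)%N, wall t < x < wall t.+1 & sg a (x, gate)].
Proof. by move=> ht; have [x hx [a [ha hz]]] := gap_met ht; exists a, x. Qed.

Lemma gap_choice : exists c : 'I_(2 ^ i) -> 'I_(size Q).-1, injective c /\
  forall t : 'I_(2 ^ i), exists2 x, wall t < x < wall t.+1 & sg (c t) (x, gate).
Proof.
have H (t : 'I_(2 ^ i)) : exists a : 'I_(size Q).-1, exists2 x, wall t < x < wall t.+1 & sg a (x, gate).
  have [a [x [ha hx hz]]] := gap_seg (ltn_ord t).
  have ha' : (a < (size Q).-1)%N by nlia.
  by exists (Ordinal ha'), x.
have [c hc] := choice H; exists c; split=> // t t' e; apply: val_inj.
have [x hx hz] := hc t; have [x' hx' hz'] := hc t'; rewrite -e in hz'.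
have ha : ((c t).+1 < size Q)%N by have := ltn_ord (c t); nlia.
exact: (gap_uniq (ltn_ord t) (ltn_ord t') ha hx hx' hz hz').
Qed.

Lemma many_segments : (2 ^ i < size Q)%N.
Proof.
have [c [ci _]] := gap_choice; have := leq_card c ci; rewrite !card_ord.
by rewrite {2}/Q /=; nlia.
Qed.

(** * Rigidity: an edge with the least number of segments reproduces the arrangement *)

Section Tight.
Hypothesis sz : size Q = (2 ^ i).+1.

(** An injection from the gaps into equally many segments is a bijection; [c] leads from gaps to
    segments, [g] back, both with value 0 out of range. *)
Lemma gap_perm : exists c g : nat -> nat, [/\
  forall t, (t < 2 ^ i)%N -> (c t < 2 ^ i)%N /\ g (c t) = t,
  forall a, (a < 2 ^ i)%N -> (g a < 2 ^ i)%N /\ c (g a) = a &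
  forall a, (a < 2 ^ i)%N -> exists2 x, wall (g a) < x < wall (g a).+1 & sg a (x, gate)].
Proof.
have [] := gap_choice; rewrite sz => /= c [ci hc].
have [g cK gK] := injF_bij ci.
exists (fun t => oapp (fun u => val (c u)) 0%N (insub t)), (fun a => oapp (fun u => val (g u)) 0%N (insub a)).
split.
- by move=> t ht; rewrite insubT /= valK /= cK ltn_ord.
- by move=> a ha; rewrite insubT /= valK /= gK ltn_ord.
by move=> a ha; rewrite insubT /=; have := hc (g (Sub a ha)); rewrite gK.
Qed.

Variables (c g : nat -> nat).
Hypotheses (cP : forall t, (t < 2 ^ i)%N -> (c t < 2 ^ i)%N /\ g (c t) = t)
  (gP : forall a, (a < 2 ^ i)%N -> (g a < 2 ^ i)%N /\ c (g a) = a)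
  (gx : forall a, (a < 2 ^ i)%N -> exists2 x, wall (g a) < x < wall (g a).+1 & sg a (x, gate)).

Let szS a : (a < 2 ^ i)%N -> (a.+1 < size Q)%N. Proof. by rewrite sz. Qed.

Lemma g_inj a b : (a < 2 ^ i)%N -> (b < 2 ^ i)%N -> g a = g b -> a = b.
Proof. by move=> /gP[_ ea] /gP[_ eb] e; rewrite -ea -eb e. Qed.

Lemma sg_gap a x : (a < 2 ^ i)%N -> sg a (x, gate) -> wall (g a) < x < wall (g a).+1.
Proof.
move=> ha hx; have [t ht hxt] := Q_gap (sg_Q (szS ha) hx).
have [x' hx' sx'] := gx ha; have [hg _] := gP ha.
by have <- : t = g a by exact: (gap_uniq ht hg (szS ha) hxt hx' hx sx').
Qed.

(** A bend on the gate would place two segments in the same gap. *)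
Lemma q_off_gate a : (0 < a < 2 ^ i)%N -> (q a).2 != gate.
Proof.
case: a => // a ha; apply/eqP => e; have ha' : (a < 2 ^ i)%N by exact: ltnW.
have eq : q a.+1 = ((q a.+1).1, gate) by rewrite -e -surjective_pairing.
have s1 : sg a ((q a.+1).1, gate) by rewrite -eq; exact: seg_r.
have s2 : sg a.+1 ((q a.+1).1, gate) by rewrite -eq; exact: seg_l.
have [t ht hxt] := Q_gap (sg_Q (szS ha') s1).
have [hg _] := gP ha'; have [hg' _] := gP (ha : (a.+1 < 2 ^ i)%N).
have e1 := gap_uniq ht hg (szS ha') hxt (sg_gap ha' s1) s1 s1.
have e2 := gap_uniq ht hg' (szS ha) hxt (sg_gap ha s2) s2 s2.
by have := g_inj ha' ha (etrans (esym e1) e2); nlia.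
Qed.

Lemma q0 : q 0 = wp i.+1. Proof. by []. Qed.
Lemma qN : q (2 ^ i)%N = vp i.+1.
Proof.
move: sz; rewrite /Q /= size_rcons => -[e].
by rewrite -e /= nth_rcons ltnn eqxx.
Qed.

Lemma q_alt a : (a <= 2 ^ i)%N -> if odd a then gate < (q a).2 else (q a).2 < gate.
Proof.
have [g1 g0] := gate_gt.
elim: a => [_|a IH ha]; first by rewrite q0 wpi /=; lra.
have {}IH := IH (ltnW ha); have [x _ hx] := gx ha.
have bw := seg_btw hx; rewrite /btw /= in bw.
have eN : a.+1 = (2 ^ i)%N -> (q a.+1).2 = 1 by move=> ->; rewrite qN vpi.
have off : a.+1 <> (2 ^ i)%N -> (q a.+1).2 != gate by move=> ne; apply: q_off_gate; nlia.
rewrite [odd a.+1]/=; case: (boolP (odd a)) IH => oa IH /=.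
  case: (eqVneq a.+1 (2 ^ i)%N) => [/eN|/eqP/off] e; first by rewrite /= in e; lra.
  by rewrite lt_neqAle e /=; case: bw; lra.
case: (eqVneq a.+1 (2 ^ i)%N) => [e|/eqP/off e].
  by exfalso; have := odd_pow2 i; rewrite -e /= oa; nlia.
by rewrite lt_neqAle eq_sym e /=; case: bw; lra.
Qed.

Definition lo a := if odd a then q a.+1 else q a.
Definition hi a := if odd a then q a else q a.+1.
Local Notation Y a y := (xat (lo a) (hi a) y).

Lemma sgE a : sg a = seg (lo a) (hi a).
Proof. by rewrite /lo /hi; case: ifP => // _; exact: seg_sym. Qed.

Lemma lohi a : (a < 2 ^ i)%N -> (lo a).2 < gate < (hi a).2.
Proof.
move=> ha; have := q_alt (ltnW ha); have := q_alt ha; rewrite /lo /hi [odd a.+1]/=.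
by case: (odd a) => /= -> ->.
Qed.

Lemma Y_gap a : (a < 2 ^ i)%N -> wall (g a) < Y a gate < wall (g a).+1.
Proof.
move=> ha; have := lohi ha => h; apply: sg_gap => //; rewrite sgE; apply: seg_x; lra.
Qed.

Lemma wall_le t t' : (t <= t' <= 2 ^ i)%N -> wall t <= wall t'.
Proof.
by case/andP; rewrite leq_eqVlt => /orP[/eqP->//|lt le]; apply: ltW; apply: wall_lt; rewrite lt.
Qed.

Lemma Y_right a d y : (a < 2 ^ i)%N -> (0 < d)%N -> (d <= g a)%N ->
  (bt d).2 <= y <= (tp d).2 -> (lo a).2 <= y <= (hi a).2 -> X d y < Y a y.
Proof.
move=> ha d0 da hy hy'; have [ga _] := gP ha; have hd : (0 < d < 2 ^ i)%N by nlia.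
apply: (order_disjoint (g := gate)) hy hy'.
- by have := arr_bt A hd; have := arr_tp A hd; move=> h1 h2; rewrite h1 h2.
- exact: lohi.
- by move=> z hz; rewrite -sgE => /(sg_Q (szS ha)) /(Qdis hd).
rewrite -/(X d gate) -(wall_X hd); have /andP[h _] := Y_gap ha.
by apply: le_lt_trans h; apply: wall_le; rewrite da ltnW.
Qed.

Lemma Y_left a d y : (a < 2 ^ i)%N -> (g a < d)%N -> (d < 2 ^ i)%N ->
  (bt d).2 <= y <= (tp d).2 -> (lo a).2 <= y <= (hi a).2 -> Y a y < X d y.
Proof.
move=> ha da dN hy hy'; have [ga _] := gP ha; have hd : (0 < d < 2 ^ i)%N by nlia.
apply: (order_disjoint (g := gate)) hy' hy.
- exact: lohi.
- by have := arr_bt A hd; have := arr_tp A hd; move=> h1 h2; rewrite h1 h2.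
- by move=> z + hz; rewrite -sgE => /(sg_Q (szS ha)) /(Qdis hd); exact.
rewrite -/(X d gate) -(wall_X hd); have /andP[_ h] := Y_gap ha.
by apply: (lt_le_trans h); apply: wall_le; rewrite da ltnW.
Qed.

Lemma X_tp d : (0 < d < 2 ^ i)%N -> X d (tp d).2 = (tp d).1.
Proof. by move=> hd; rewrite /X xat_r // lt_eqF // (bt_lt_tp A). Qed.

Lemma Y_hi a : (a < 2 ^ i)%N -> Y a (hi a).2 = (hi a).1.
Proof. by move=> ha; have := lohi ha => h; rewrite xat_r // lt_eqF //; lra. Qed.

(** A strand between two segments that are joined above cannot escape over their bend; its partner
    shares its upper end and is trapped as well. *)
Lemma top_enclosed a b d : (a < 2 ^ i)%N -> (b < 2 ^ i)%N -> hi a = hi b -> (g a < d <= g b)%N ->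
  (tp d).2 < (hi a).2 /\ (g a < 2 ^ i - d <= g b)%N.
Proof.
move=> ha hb e /andP[d1 d2]; have [ga _] := gP ha; have [gb _] := gP hb.
have hd : (0 < d < 2 ^ i)%N by nlia.
have [dp dN] := andP hd.
have la := lohi ha; have lb := lohi hb; have b1 := arr_bt A hd; have t1 := arr_tp A hd.
have lt : (tp d).2 < (hi a).2.
  rewrite ltNge; apply/negP => le.
  have r : (bt d).2 <= (hi a).2 <= (tp d).2 by rewrite le andbT; lra.
  have ra : (lo a).2 <= (hi a).2 <= (hi a).2 by lra.
  have rb : (lo b).2 <= (hi a).2 <= (hi b).2 by rewrite e lexx; lra.
  have h1 := Y_left ha d1 dN r ra; have h2 := Y_right hb dp d2 r rb.
  by have := lt_trans h1 h2; rewrite Y_hi // e Y_hi // ltxx.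
split=> //.
have hd' : (0 < 2 ^ i - d < 2 ^ i)%N by nlia.
have et : tp d = tp (2 ^ i - d) by apply: (arr_top A) => //; nlia.
have b2 := arr_bt A hd'.
have [dp' dN'] := andP hd'.
have r : (bt d).2 <= (tp d).2 <= (tp d).2 by lra.
have r' : (bt (2 ^ i - d)%N).2 <= (tp d).2 <= (tp (2 ^ i - d)%N).2 by rewrite -et lexx; lra.
have ra : (lo a).2 <= (tp d).2 <= (hi a).2 by lra.
have rb : (lo b).2 <= (tp d).2 <= (hi b).2 by rewrite -e; lra.
apply/andP; split; rewrite leqNgt; apply/negP => lt'.
  have := lt_trans (Y_right ha dp' lt' r' ra) (Y_left ha d1 dN r ra).
  by rewrite X_tp // et X_tp // ltxx.
have := lt_trans (Y_right hb dp d2 r rb) (Y_left hb lt' dN' r' rb).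
by rewrite X_tp // et X_tp // ltxx.
Qed.

(** The enclosed strands form an interval invariant under [d -> 2 ^ i - d]; comparing its two ends
    gives the sum. *)
Lemma top_mates a b : (a < 2 ^ i)%N -> (b < 2 ^ i)%N -> hi a = hi b -> (g a < g b)%N ->
  (g a + g b + 1 = 2 ^ i)%N.
Proof.
move=> ha hb e lt; have [ga _] := gP ha; have [gb _] := gP hb.
have [_ h1] := top_enclosed ha hb e (d := (g a).+1) ltac:(nlia).
have [_ h2] := top_enclosed ha hb e (d := g b) ltac:(nlia).
by nlia.
Qed.

Lemma bot_above a b d : (a < 2 ^ i)%N -> (b < 2 ^ i)%N -> lo a = lo b -> (g a < d <= g b)%N ->
  (lo a).2 < (bt d).2.
Proof.
move=> ha hb e /andP[d1 d2]; have [ga _] := gP ha; have [gb _] := gP hb.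
have hd : (0 < d < 2 ^ i)%N by nlia.
have [dp dN] := andP hd.
have la := lohi ha; have lb := lohi hb; have b1 := arr_bt A hd; have t1 := arr_tp A hd.
rewrite ltNge; apply/negP => le.
have r : (bt d).2 <= (lo a).2 <= (tp d).2 by rewrite le /=; lra.
have ra : (lo a).2 <= (lo a).2 <= (hi a).2 by lra.
have rb : (lo b).2 <= (lo a).2 <= (hi b).2 by rewrite e lexx; lra.
have h1 := Y_left ha d1 dN r ra; have h2 := Y_right hb dp d2 r rb.
by have := lt_trans h1 h2; rewrite xat_l e xat_l ltxx.
Qed.

Lemma bot_enclosed a b d d' : (a < 2 ^ i)%N -> (b < 2 ^ i)%N -> lo a = lo b -> (g a < d <= g b)%N ->
  (0 < d' < 2 ^ i)%N -> bt d = bt d' -> (g a < d' <= g b)%N.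
Proof.
move=> ha hb e dab hd' et; have := bot_above ha hb e dab => lt; case/andP: dab => d1 d2.
have [ga _] := gP ha; have [gb _] := gP hb.
have hd : (0 < d < 2 ^ i)%N by nlia.
have [dp dN] := andP hd; have [dp' dN'] := andP hd'.
have la := lohi ha; have lb := lohi hb; have b1 := arr_bt A hd; have t1 := arr_tp A hd.
have t2 := arr_tp A hd'.
have r : (bt d).2 <= (bt d).2 <= (tp d).2 by lra.
have r' : (bt d').2 <= (bt d).2 <= (tp d').2 by rewrite -et lexx; lra.
have ra : (lo a).2 <= (bt d).2 <= (hi a).2 by lra.
have rb : (lo b).2 <= (bt d).2 <= (hi b).2 by rewrite -e; lra.
apply/andP; split; rewrite leqNgt; apply/negP => lt'.
  have := lt_trans (Y_right ha dp' lt' r' ra) (Y_left ha d1 dN r ra).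
  by rewrite /X xat_l et xat_l ltxx.
have := lt_trans (Y_right hb dp d2 r rb) (Y_left hb lt' dN' r' rb).
by rewrite /X xat_l et xat_l ltxx.
Qed.

Lemma lo_ge0 a : (a < 2 ^ i)%N -> 0 <= (lo a).2.
Proof.
move=> ha; have h b : (b <= 2 ^ i)%N -> 0 <= (q b).2.
  case: b => [|b] hb; first by rewrite q0 wpi.
  by have [|_ /andP[/ltW]//] := @q_inside b.+1; rewrite sz.
by rewrite /lo; case: ifP => _; apply: h => //; exact: ltnW.
Qed.

(** Strands numbered by powers of two reach the floor and cannot be enclosed. Hence the enclosed
    interval lies in one block, and its invariance under [d -> 3 * 2 ^ j - d] gives the sum. *)
Lemma bot_mates a b : (a < 2 ^ i)%N -> (b < 2 ^ i)%N -> lo a = lo b -> (g a < g b)%N ->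
  exists j, [/\ (2 ^ j <= g a)%N, (g b < 2 ^ j.+1)%N & (g a + g b + 1 = 3 * 2 ^ j)%N].
Proof.
move=> ha hb e lt; have [ga _] := gP ha; have [gb _] := gP hb.
have npow d j : (g a < d <= g b)%N -> d <> (2 ^ j)%N.
  move=> hd ed; have := bot_above ha hb e hd; have := lo_ge0 ha.
  have ji : (j < i)%N by rewrite -(ltn_exp2l j i (isT : (1 < 2)%N)) -ed; nlia.
  have -> : bt d = wp (i - j) by rewrite ed -(arr_w A) ?subKn //; nlia.
  by rewrite wpE /=; lra.
have a0 : (0 < g a)%N by rewrite lt0n; apply/eqP => a0; apply: (@npow 1%N 0%N); rewrite ?expn0 //; nlia.
have [j /andP[j1 j2]] := pow2_bracket a0.
have jb : (g b < 2 ^ j.+1)%N by rewrite ltnNge; apply/negP => h; apply: (@npow (2 ^ j.+1)%N j.+1); nlia.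
have h d : (g a < d <= g b)%N -> (g a < 3 * 2 ^ j - d <= g b)%N.
  move=> hd; have ej : (2 ^ j.+1 = 2 * 2 ^ j)%N by rewrite expnS.
  have e1 : bt d = bt (3 * 2 ^ j - d).
    by apply: (arr_bot A (j := j)); nlia.
  apply: (bot_enclosed ha hb e hd _ e1).
  have ji : (j < i)%N by rewrite -(ltn_exp2l j i (isT : (1 < 2)%N)); nlia.
  have : (2 ^ j.+1 <= 2 ^ i)%N by rewrite leq_exp2l.
  by nlia.
exists j; split=> //.
have h1 := h (g a).+1 ltac:(nlia); have h2 := h (g b) ltac:(nlia).
by nlia.
Qed.

(** The new foot lies to the left of [w_i], where strand 1 starts. *)
Lemma g_first : g 0 = 0%N.
Proof.
apply/eqP; rewrite -leqn0 leqNgt; apply/negP => h.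
have hi1 : (1 <= i <= i)%N by rewrite i0 leqnn.
have bw := arr_w A hi1; rewrite subnn expn0 in bw.
have h1 : (0 < 1 < 2 ^ i)%N by have [? _] := gP N0; nlia.
have := arr_tp A h1; have := lohi N0; rewrite gateE => l1 t1; have k0 := @natk0 R k.
have := @Y_right 0%N 1%N 0 N0 isT h; have -> : (bt 1%N).2 = 0 by rewrite bw.
have lo0 : lo 0 = (- (2 * i%:R) - 2, 0) by rewrite /lo /= wpi.
rewrite lo0 /X /xat bw wpE /= subrr !mul0r => /(_ ltac:(lra) ltac:(lra)); lra.
Qed.

(** At height 1 the vertex [v_(i+1)] lies between strands 1 and 2, which start at [w_i] and
    [w_(i-1)] and have moved sideways by less than 1. *)
Lemma g_last : g (2 ^ i - 1) = 1%N.
Proof.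
have k0 := @natk0 R k.
have ha : (2 ^ i - 1 < 2 ^ i)%N by nlia.
have oa : odd (2 ^ i - 1) by have := odd_pow2 i; nlia.
have la := lohi ha; have lov : lo (2 ^ i - 1) = vp i.+1.
  by rewrite /lo oa (_ : (2 ^ i - 1).+1 = 2 ^ i)%N ?qN //; nlia.
have [ga _] := gP ha.
have r : (lo (2 ^ i - 1)).2 <= 1 <= (hi (2 ^ i - 1)).2.
  by move: la; rewrite lov vpi gateE /=; lra.
have Yv : Y (2 ^ i - 1)%N 1 = 1 - 2 * i%:R.
  by rewrite lov vpi /xat /= subrr mul0r addr0.
have hw m : (1 <= m <= i)%N -> - (2 * m%:R) - 1 < X (2 ^ (i - m))%N 1 < - (2 * m%:R) + 1 /\
    (bt (2 ^ (i - m))%N).2 <= 1 <= (tp (2 ^ (i - m))%N).2.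
  move=> hm; split; first by apply: (X_w A ik') => //; rewrite ler01 lexx.
  have := arr_tp A (arr_bt_w ik' hm); rewrite (arr_w A hm) wpE gateE /= => h; lra.
apply/eqP; rewrite eqn_leq; apply/andP; split; rewrite leqNgt; apply/negP => h.
  have i2 : (1 < i)%N by rewrite -(ltn_exp2l 1 i (isT : (1 < 2)%N)) expn1; nlia.
  have [h1 h2] := hw (i - 1)%N ltac:(nlia); rewrite subKn // expn1 in h1 h2.
  have := Y_right ha (isT : (0 < 2)%N) h h2 r; rewrite Yv.
  by move: h1; rewrite natrB //; lra.
have [h1 h2] := hw i ltac:(nlia); rewrite subnn expn0 in h1 h2.
have g1 : (g (2 ^ i - 1) < 1)%N by nlia.
have N1 : (1 < 2 ^ i)%N by rewrite -{1}(expn0 2) ltn_exp2l.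
by have := Y_left ha g1 N1 h2 r; rewrite Yv; lra.
Qed.

Lemma top_step a : ~~ odd a -> (a.+1 < 2 ^ i)%N ->
  hi a = hi a.+1 /\ (g a + g a.+1 + 1 = 2 ^ i)%N.
Proof.
move=> oa ha; have e : hi a = hi a.+1 by rewrite /hi /= oa (negbTE oa).
split=> //; have ha' := ltnW ha; case: (ltngtP (g a) (g a.+1)) => lt.
- exact: top_mates lt.
- by have := top_mates ha ha' (esym e) lt; nlia.
- by have := g_inj ha' ha lt; nlia.
Qed.

Lemma bot_step a : odd a -> (a.+1 < 2 ^ i)%N -> lo a = lo a.+1 /\ exists j,
  [/\ (2 ^ j <= g a < 2 ^ j.+1)%N, (2 ^ j <= g a.+1 < 2 ^ j.+1)%N & (g a + g a.+1 + 1 = 3 * 2 ^ j)%N].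
Proof.
move=> oa ha; have e : lo a = lo a.+1 by rewrite /lo /= oa.
split=> //; have ha' := ltnW ha; case: (ltngtP (g a) (g a.+1)) => lt.
- by have [j [h1 h2 h3]] := bot_mates ha' ha e lt; exists j; split=> //; nlia.
- by have [j [h1 h2 h3]] := bot_mates ha ha' (esym e) lt; exists j; split=> //; nlia.
- by have := g_inj ha' ha lt; nlia.
Qed.

Lemma even_S a : ~~ odd a -> (a < 2 ^ i)%N -> (a.+1 < 2 ^ i)%N.
Proof.
move=> oa ha; rewrite ltn_neqAle ha andbT; apply/eqP => e.
by have := odd_pow2 i; rewrite -e /= oa; nlia.
Qed.

(** Since the number of segments is even, each is joined above to a neighbour on the path; the sum
    rule and injectivity identify the gap of that neighbour as [t']. *)
Lemma c_top t t' : (t + t' + 1 = 2 ^ i)%N -> hi (c t) = hi (c t').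
Proof.
move=> e; have [ct gt] := @cP t ltac:(nlia); have [ct' gt'] := @cP t' ltac:(nlia).
case: (boolP (odd (c t))) => oa.
  have ea : (c t).-1.+1 = c t by case: (c t) oa.
  have oa' : ~~ odd (c t).-1 by rewrite -ea /= in oa.
  have [e1 e2] := @top_step (c t).-1 oa' ltac:(by rewrite ea); rewrite ea in e1 e2.
  have -> : c t' = (c t).-1 by apply: g_inj => //; nlia.
  by rewrite e1.
have ha := even_S oa ct; have [e1 e2] := top_step oa ha.
by have -> : c t' = (c t).+1 by apply: g_inj => //; nlia.
Qed.

Lemma c_bot t t' j : (t < 2 ^ i)%N -> (2 ^ j <= t < 2 ^ j.+1)%N -> (t + t' + 1 = 3 * 2 ^ j)%N ->
  lo (c t) = lo (c t') /\ (t' < 2 ^ i)%N.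
Proof.
move=> ht hj e; have ej : (2 ^ j.+1 = 2 * 2 ^ j)%N by rewrite expnS.
have t'N : (t' < 2 ^ i)%N.
  have ji : (j < i)%N by rewrite -(ltn_exp2l j i (isT : (1 < 2)%N)); nlia.
  have : (2 ^ j.+1 <= 2 ^ i)%N by rewrite leq_exp2l.
  by nlia.
split=> //; have [ct gt] := cP ht; have [ct' gt'] := cP t'N.
have nxt j' : (2 ^ j' <= t < 2 ^ j'.+1)%N -> (2 ^ j' = 2 ^ j)%N.
  by move=> hj'; rewrite (pow2_uniq hj' hj).
case: (boolP (odd (c t))) => oa.
  case: (ltnP (c t).+1 (2 ^ i)) => ha.
    have [e1 [j' [h1 _ h3]]] := bot_step oa ha; rewrite gt in h1 h3; have ee := nxt _ h1.
    by have -> : c t' = (c t).+1 by apply: g_inj => //; nlia.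
  (* The last segment has no successor; it lies in gap 1, which is a block of its own and its own
     partner. *)
  have cl : c t = (2 ^ i - 1)%N by nlia.
  have t1 : t = 1%N by rewrite -gt cl g_last.
  have j0 : j = 0%N by rewrite t1 in hj; exact: (pow2_uniq (j' := 0) hj).
  by have -> : t' = t by move: e; rewrite t1 j0 expn0; nlia.
case: (posnP (c t)) => [c0|cp].
  by move: hj; rewrite -gt c0 g_first; have := pow2 j; nlia.
have ea : (c t).-1.+1 = c t by case: (c t) cp.
have oa' : odd (c t).-1 by rewrite -ea /= negbK in oa.
have [e1 [j' [_ h1 h3]]] := @bot_step (c t).-1 oa' ltac:(by rewrite ea).
rewrite ea gt in e1 h1 h3; have ee := nxt _ h1.
have -> : c t' = (c t).-1 by apply: g_inj => //; nlia.
by rewrite e1.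
Qed.

Lemma c_first : c 0 = 0%N.
Proof. by have [_] := gP N0; rewrite g_first. Qed.

Lemma c_last : c 1 = (2 ^ i - 1)%N.
Proof. by have [_] := @gP (2 ^ i - 1) ltac:(nlia); rewrite g_last. Qed.

Lemma sg_disj a b z : (a < 2 ^ i)%N -> (b < 2 ^ i)%N -> a != b -> sg a z -> sg b z ->
  (g a + g b + 1 = 2 ^ i)%N /\ z = hi a \/
  exists j, [/\ (2 ^ j <= g a < 2 ^ j.+1)%N, (2 ^ j <= g b < 2 ^ j.+1)%N,
    (g a + g b + 1 = 3 * 2 ^ j)%N & z = lo a].
Proof.
wlog ab : a b / (a < b)%N.
  move=> H ha hb nab sa sb; case: (ltngtP a b) => ab; first exact: H.
    case: (H b a ab hb ha ltac:(by rewrite eq_sym) sb sa) => [[e ->]|[j [h1 h2 h3 ->]]].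
      have : hi b = hi a by have := @c_top (g b) (g a) e; have [_ ->] := gP ha; have [_ ->] := gP hb.
      by move=> ->; left; split=> //; nlia.
    have : lo b = lo a.
      by have := @c_bot (g b) (g a) j ltac:(by have [] := gP hb) h1 h3; have [_ ->] := gP ha; have [_ ->] := gP hb => -[].
    by move=> ->; right; exists j; split=> //; nlia.
  by rewrite ab eqxx in nab.
move=> ha hb _ sa sb; have [_ [_ dis]] := Qsim.
have [d1 d2] := dis a b ab (szS hb); move: d1 d2 => /=.
case: (eqVneq b a.+1) => [e|ne] d1 d2; last first.
  by move/seteqP: (d2 ltac:(nlia)) => -[/(_ z) h _]; case: (h (conj sa sb)).
have ez : z = q b by move/seteqP: (d1 e) => -[/(_ z) h _]; exact: (h (conj sa sb)).
rewrite ez e; rewrite e in hb; case: (boolP (odd a)) => oa.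
  by have [_ [j [h1 h2 h3]]] := bot_step oa hb; right; exists j; rewrite /lo oa.
by have [_ h] := top_step oa hb; left; rewrite /hi (negbTE oa).
Qed.

(** The numbering from left to right after the step: an old strand [d] becomes [2 * d], the segment
    in gap [t] becomes [2 * t + 1]. *)
Definition tpS d := if odd d then hi (c d./2) else tp d./2.
Definition btS d := if odd d then lo (c d./2) else bt d./2.

Lemma tpS_odd t : tpS (2 * t + 1) = hi (c t) /\ btS (2 * t + 1) = lo (c t).
Proof.
have e : (2 * t + 1 = t.*2.+1)%N by nlia.
by rewrite /tpS /btS e /= odd_double /= uphalf_double.
Qed.

Lemma tpS_even d : tpS (2 * d) = tp d /\ btS (2 * d) = bt d.
Proof. by rewrite /tpS /btS mul2n odd_double doubleK. Qed.

Lemma parity_split d : (exists t, d = 2 * t + 1)%N \/ (exists t, d = 2 * t)%N.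
Proof.
by case: (boolP (odd d)) => od; [left|right]; exists d./2; nlia.
Qed.

Lemma YS_gap t : (t < 2 ^ i)%N -> wall t < xat (lo (c t)) (hi (c t)) gate < wall t.+1.
Proof. by move=> ht; have [ct e] := cP ht; have := Y_gap ct; rewrite e. Qed.

Lemma hi_inside a : (a < 2 ^ i)%N -> inside (hi a).
Proof.
move=> ha; rewrite /hi; case: (boolP (odd a)) => oa; apply: q_inside; rewrite sz; last by nlia.
by case: a oa ha => //= a _ ha; rewrite ltnS ltnW.
Qed.

Lemma lo_inside t : (0 < t < 2 ^ i)%N -> inside (lo (c t)).
Proof.
case/andP=> t0 ht; have [ct gt] := cP ht; rewrite /lo; case: (boolP (odd (c t))) => oa.
  by apply: q_inside; rewrite sz; nlia.
apply: q_inside; rewrite sz ltnS (ltnW ct) andbT lt0n; apply/eqP => c0.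
by move: t0; rewrite -gt c0 g_first.
Qed.

Lemma arr_step : arr k i.+1 tpS btS.
Proof.
have e2 := expnS 2 i; split.
- move=> d; rewrite e2 => hd; case: (parity_split d) => -[t ed]; subst d.
    have [_ ->] := tpS_odd t; have [ct _] := @cP t ltac:(nlia).
    by have /andP[] := lohi ct.
  by have [_ ->] := tpS_even t; apply: (arr_bt A); nlia.
- move=> d; rewrite e2 => hd; case: (parity_split d) => -[t ed]; subst d.
    have [-> _] := tpS_odd t; have [ct _] := @cP t ltac:(nlia).
    by have /andP[] := lohi ct.
  by have [-> _] := tpS_even t; apply: (arr_tp A); nlia.
- move=> d d'; rewrite e2 => d0 dd dN.
  case: (parity_split d) => -[t ed]; case: (parity_split d') => -[t' ed']; subst d d'.
  + have [-> ->] := tpS_odd t; have [-> ->] := tpS_odd t'.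
    have /andP[_ h1] := @YS_gap t ltac:(nlia); have /andP[h2 _] := @YS_gap t' ltac:(nlia).
    by apply: (lt_trans h1); apply: le_lt_trans h2; apply: wall_le; nlia.
  + have [-> ->] := tpS_odd t; have [-> ->] := tpS_even t'.
    have /andP[_ h1] := @YS_gap t ltac:(nlia); rewrite -/(X t' gate) -wall_X; last by nlia.
    by apply: (lt_le_trans h1); apply: wall_le; nlia.
  + have [-> ->] := tpS_even t; have [-> ->] := tpS_odd t'.
    have /andP[h2 _] := @YS_gap t' ltac:(nlia); rewrite -/(X t gate) -wall_X; last by nlia.
    by apply: le_lt_trans h2; apply: wall_le; nlia.
  + have [-> ->] := tpS_even t; have [-> ->] := tpS_even t'.
    by apply: (arr_lt A); nlia.
(* Partners have an even sum and hence equal parity, so new strands are paired with new ones and old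
   with old. *)
- move=> d d'; rewrite e2 => d0 d0' e.
  case: (parity_split d) => -[t ed]; case: (parity_split d') => -[t' ed']; subst d d'; try by exfalso; nlia.
  + by have [-> _] := tpS_odd t; have [-> _] := tpS_odd t'; apply: c_top; nlia.
  + by have [-> _] := tpS_even t; have [-> _] := tpS_even t'; apply: (arr_top A); nlia.
- move=> d d' [|j]; rewrite e2 => dN; first by rewrite expn0 expn1; nlia.
  rewrite !(expnS 2) => hj e.
  case: (parity_split d) => -[t ed]; case: (parity_split d') => -[t' ed']; subst d d'; try by exfalso; nlia.
  + have [_ ->] := tpS_odd t; have [_ ->] := tpS_odd t'.
    by have [] := @c_bot t t' j ltac:(nlia) ltac:(rewrite expnS; nlia) ltac:(nlia).
  + have [_ ->] := tpS_even t; have [_ ->] := tpS_even t'.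
    by apply: (arr_bot A (j := j)); rewrite ?expnS; nlia.
- move=> d d' z; rewrite e2 => d0 dd dN.
  case: (parity_split d) => -[t ed]; case: (parity_split d') => -[t' ed']; subst d d'.
  + have [-> ->] := tpS_odd t; have [-> ->] := tpS_odd t'.
    have [ct gt] := @cP t ltac:(nlia); have [ct' gt'] := @cP t' ltac:(nlia).
    rewrite -!sgE => s1 s2; have ne : c t != c t' by apply/eqP => e; move: dd; rewrite -gt -gt' e; nlia.
    case: (sg_disj ct ct' ne s1 s2); rewrite gt gt'.
      by move=> [e ->]; left; split=> //; nlia.
    by move=> [j [h1 h2 h3 ->]]; right; exists j.+1; rewrite !(expnS 2) in h1 h2 *; split=> //; nlia.
  + have [-> ->] := tpS_odd t; have [-> ->] := tpS_even t'.
    have [ct gt] := @cP t ltac:(nlia); rewrite -sgE => s1 s2; exfalso.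
    by apply: (Qdis (d := t') _ (sg_Q (szS ct) s1) s2); nlia.
  + have [-> ->] := tpS_even t; have [-> ->] := tpS_odd t'.
    have [ct gt] := @cP t' ltac:(nlia); rewrite -sgE => s1 s2; exfalso.
    by apply: (Qdis (d := t) _ (sg_Q (szS ct) s2) s1); nlia.
  + have [-> ->] := tpS_even t; have [-> ->] := tpS_even t' => s1 s2.
    case: (arr_disj A _ _ _ s1 s2); [nlia|nlia|nlia| |].
      by move=> [e ->]; left; split=> //; nlia.
    by move=> [j [h1 h2 h3 ->]]; right; exists j.+1; rewrite !(expnS 2) in h2 *; split=> //; nlia.
- move=> d; rewrite e2 => hd; case: (parity_split d) => -[t ed]; subst d.
    have [-> _] := tpS_odd t; have [ct _] := @cP t ltac:(nlia).
    exact: hi_inside.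
  by have [-> _] := tpS_even t; apply: (arr_tin A); nlia.
- move=> d [|j]; rewrite e2 => dN; first by rewrite expn0 expn1; nlia.
  rewrite !(expnS 2) => hj.
  have pj := pow2 j; case: (parity_split d) => -[t ed]; subst d.
    by have [_ ->] := tpS_odd t; apply: lo_inside; nlia.
  by have [_ ->] := tpS_even t; apply: (arr_bin A (j := j)); rewrite ?expnS; nlia.
- move=> m hm; case: (eqVneq m i.+1) => [->|ne].
    rewrite subnn expn0; have [_] := tpS_odd 0; rewrite muln0 => ->.
    by rewrite c_first.
  rewrite subSn; last by nlia.
  by rewrite expnS; have [_ ->] := tpS_even (2 ^ (i - m)); apply: (arr_w A); nlia.
- move=> m hm; case: (eqVneq m i.+1) => [->|ne].
    rewrite subnn expn0 muln1; have [_] := tpS_odd 1; rewrite muln1 => ->.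
    rewrite c_last /lo; have -> : odd (2 ^ i - 1) by have := odd_pow2 i; nlia.
    by rewrite -[(2 ^ i - 1).+1]addn1 subnK // qN.
  rewrite subSn; last by nlia.
  by rewrite expnS mulnCA; have [_ ->] := tpS_even (3 * 2 ^ (i - m)); apply: (arr_v A); nlia.
- rewrite subSS subn0 -(subnK i0) addn1 expnS.
  by have [-> _] := tpS_even (2 ^ (i - 1)); rewrite (arr_v1 A).
Qed.

Lemma arr_step_polyline z : (exists2 d, (0 < d < 2 ^ i.+1)%N & seg (btS d) (tpS d) z) <->
  (exists2 d, (0 < d < 2 ^ i)%N & str d z) \/ polyline Q z.
Proof.
split.
  move=> [d hd]; rewrite /btS /tpS; case: (boolP (odd d)) => od hz; last first.
    by left; exists d./2 => //; move: hd; rewrite expnS; nlia.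
  have [ct _] := @cP d./2 ltac:(by move: hd; rewrite expnS; nlia).
  by right; apply: (sg_Q (szS ct)); rewrite sgE.
move=> [[d hd hz]|[a [ha hz]]].
  exists d.*2; first by rewrite expnS; nlia.
  by rewrite /btS /tpS odd_double doubleK.
have ha' : (a < 2 ^ i)%N by move: ha; rewrite sz.
have [ga cg] := gP ha'.
exists (g a).*2.+1; first by rewrite expnS; nlia.
by rewrite /btS /tpS /= odd_double /= uphalf_double cg -sgE.
Qed.

End Tight.
Theorem tight_path : size Q = (2 ^ i).+1 -> exists tp' bt' : nat -> pt, arr k i.+1 tp' bt' /\
  forall z, (exists2 d, (0 < d < 2 ^ i.+1)%N & seg (bt' d) (tp' d) z) <->
    (exists2 d, (0 < d < 2 ^ i)%N & str d z) \/ polyline Q z.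
Proof.
move=> sz; have [c [g [cP gP gx]]] := gap_perm sz.
exists (tpS c), (btS c); split; first exact: (arr_step sz cP gP gx).
exact: (arr_step_polyline sz cP gP).
Qed.

End LowerBound.

(** * The rim of the room *)

Section Rim.
Variables (R : realType) (k : nat).
Local Notation pt := (R * R)%type.
Implicit Types (x y z p : pt) (j l m : nat) (e f : nat * nat).
Local Notation wp := (@wp R).
Local Notation width := (@width R k).
Local Notation height := (@height R k).
Local Notation inside := (@inside R k).

(** The extreme feet [w_0] and [w_(k+1)] are the lower corners; together with the two upper corners
    the rim has [k + 4] vertices. *)
Definition rim j : pt :=
  if (j <= k.+1)%N then wp j else if j == k.+2 then (- width, height) else (0, height).

Definition rims : seq (nat * nat) := rcons [seq (j, j.+1) | j <- iota 0 k.+3] (0%N, k.+3).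

Lemma rimsP e : e \in rims -> [\/ exists2 j, (j <= k)%N & e = (j, j.+1),
  e = (k.+1, k.+2), e = (k.+2, k.+3) | e = (0%N, k.+3)].
Proof.
rewrite mem_rcons in_cons => /orP[/eqP->|/mapP[j]]; first by constructor 4.
rewrite mem_iota add0n /= => hj ->; case: (ltngtP j k.+1) => h; last by rewrite h; constructor 2.
  by constructor 1; exists j.
have -> : j = k.+2 by nlia.
by constructor 3.
Qed.

Lemma rims_mem j : (j < k.+3)%N -> (j, j.+1) \in rims.
Proof.
move=> hj; rewrite mem_rcons in_cons; apply/orP; right; apply/mapP; exists j => //.
by rewrite mem_iota add0n.
Qed.

Lemma rims_mem0 : (0%N, k.+3) \in rims.
Proof. by rewrite mem_rcons mem_head. Qed.

Lemma rim_wp j : (j <= k.+1)%N -> rim j = wp j.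
Proof. by move=> hj; rewrite /rim hj. Qed.

Lemma rim2 : rim k.+2 = (- width, height).
Proof. by rewrite /rim ltnn eqxx. Qed.

Lemma rim3 : rim k.+3 = (0, height).
Proof. by rewrite /rim !ifF //; apply/negbTE; rewrite -?ltnNge //; nlia. Qed.

Lemma rim1 : rim k.+1 = (- width, 0).
Proof. by rewrite rim_wp // wpE widthE -natr1; congr pair; ring. Qed.

Lemma rim0 : rim 0 = (0, 0).
Proof. by rewrite rim_wp // wpE; congr pair; ring. Qed.

Lemma sizes : 0 < width /\ 0 < height.
Proof. by rewrite widthE heightE; have := @natk0 R k; split; lra. Qed.

Definition rimset e z := [\/ exists2 j, (j <= k)%N & e = (j, j.+1) /\ z.2 = 0 /\ - (2 * j%:R) - 2 <= z.1 <= - (2 * j%:R),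
  e = (k.+1, k.+2) /\ z.1 = - width /\ 0 <= z.2 <= height,
  e = (k.+2, k.+3) /\ z.2 = height /\ - width <= z.1 <= 0 |
  e = (0%N, k.+3) /\ z.1 = 0 /\ 0 <= z.2 <= height].

Lemma rim_seg e z : e \in rims -> seg (rim e.1) (rim e.2) z -> rimset e z.
Proof.
have [w0 h0] := sizes.
move=> /rimsP[[j jk]|||] -> [t [/andP[t0 t1] ->]]; rewrite /rimset.
- rewrite !rim_wp ?(leqW jk) // !wpE -natr1 /=; constructor 1; exists j => //; split=> //.
  by split; first ring; nra.
- by rewrite rim1 rim2; constructor 2; split=> //=; split; [ring|nra].
- by rewrite rim2 rim3; constructor 3; split=> //=; split; [ring|nra].
- by rewrite rim0 rim3; constructor 4; split=> //=; split; [ring|nra].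
Qed.

Lemma hor_seg x y z : x.2 = z.2 -> y.2 = z.2 -> y.1 < x.1 -> y.1 <= z.1 <= x.1 -> seg x y z.
Proof.
move=> e1 e2 lt hz; have d0 : 0 < x.1 - y.1 by lra.
exists ((x.1 - z.1) / (x.1 - y.1)); split; first by rewrite ler_pdivlMr // ler_pdivrMr //; lra.
rewrite e1 e2 [z in LHS]surjective_pairing; congr pair; last by ring.
by field; rewrite gt_eqF.
Qed.

Lemma ver_seg x y z : x.1 = z.1 -> y.1 = z.1 -> y.2 < x.2 -> y.2 <= z.2 <= x.2 -> seg x y z.
Proof.
move=> e1 e2 lt hz; have d0 : 0 < x.2 - y.2 by lra.
exists ((x.2 - z.2) / (x.2 - y.2)); split; first by rewrite ler_pdivlMr // ler_pdivrMr //; lra.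
rewrite e1 e2 [z in LHS]surjective_pairing; congr pair; first by ring.
by field; rewrite gt_eqF.
Qed.

Lemma rim_cover z : - width <= z.1 <= 0 -> 0 <= z.2 <= height -> ~ inside z ->
  exists2 e, e \in rims & seg (rim e.1) (rim e.2) z.
Proof.
have [w0 h0] := sizes; move=> hx hy nin.
have [e1|n1] := eqVneq z.1 (- width).
  exists (k.+1, k.+2); first exact: rims_mem.
  by rewrite seg_sym rim1 rim2; apply: ver_seg => /=; rewrite ?e1.
have [e2|n2] := eqVneq z.1 0.
  exists (0%N, k.+3); first exact: rims_mem0.
  by rewrite seg_sym rim0 rim3; apply: ver_seg => /=; rewrite ?e2.
have [e3|n3] := eqVneq z.2 height.
  exists (k.+2, k.+3); first exact: rims_mem.
  by rewrite seg_sym rim2 rim3; apply: hor_seg => /=; rewrite ?e3 //; lra.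
have z0 : z.2 = 0.
  apply/eqP; apply: contrapT => /negP n4; apply: nin.
  move: hx hy => /andP[x1 x2] /andP[y1 y2]; split; rewrite !lt_neqAle.
    by rewrite eq_sym n1 n2 x1 x2.
  by rewrite eq_sym n4 n3 y1 y2.
have : - (2 * k.+1%:R) <= z.1 by move: hx; rewrite widthE -natr1; lra.
have : (k.+1 <= k.+1)%N by [].
elim: {1 3}k.+1 => [|j IH] hj hz; first by move: n2 => /eqP []; lra.
have [le|lt] := lerP (- (2 * j%:R)) z.1; first by apply: IH => //; exact: ltnW.
exists (j, j.+1); first by apply: rims_mem; nlia.
rewrite (rim_wp (ltnW hj)) (rim_wp hj) !wpE -natr1; rewrite -natr1 in hz.
by apply: hor_seg; rewrite /= ?z0 //; lra.
Qed.

Lemma rim_out e z : e \in rims -> seg (rim e.1) (rim e.2) z -> ~ inside z /\ z.1 <= 0.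
Proof.
have [w0 h0] := sizes; rewrite -oppr_lt0 in w0.
move=> he hz; have := rim_seg he hz.
case=> [[j jk [_ [e1 /andP[_ e2]]]]|[_ [e1 _]]|[_ [e1 /andP[_ e2]]]|[_ [e1 _]]]; split.
- by case=> _; rewrite e1 ltxx.
- by apply: le_trans e2 _; rewrite oppr_le0 mulr_ge0 // ler0n.
- by case; rewrite e1 ltxx.
- by rewrite e1 ltW.
- by case=> _; rewrite e1 ltxx andbF.
- exact: e2.
- by case; rewrite e1 ltxx andbF.
- by rewrite e1.
Qed.

Lemma rim_cross e f z : e \in rims -> f \in rims -> e != f ->
  seg (rim e.1) (rim e.2) z -> seg (rim f.1) (rim f.2) z -> exists2 j, (j <= k.+3)%N & z = rim j.
Proof.
have [w0 h0] := sizes.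
move=> he hf /eqP nef /(rim_seg he) se /(rim_seg hf) sf.
have zp (u v : R) j : (j <= k.+3)%N -> rim j = (u, v) -> z.1 = u -> z.2 = v -> exists2 j, (j <= k.+3)%N & z = rim j.
  by move=> hj er e1 e2; exists j => //; rewrite er -e1 -e2 -surjective_pairing.
have ff j j' : (j <= k)%N -> (j' <= k)%N -> (j < j')%N -> z.2 = 0 -> - (2 * j%:R) - 2 <= z.1 <= - (2 * j%:R) ->
    - (2 * j'%:R) - 2 <= z.1 <= - (2 * j'%:R) -> exists2 j, (j <= k.+3)%N & z = rim j.
  move=> jk jk' jj z2 h1 h2; have := natrR R jj; rewrite -natr1 => h.
  have er : rim j.+1 = (- (2 * j.+1%:R), 0) by rewrite rim_wp ?wpE //; nlia.
  by apply: (zp _ _ j.+1 _ er) => //; [nlia | rewrite -natr1; lra].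
have k1 := leqW (leqW (leqnSn k)); have k2 := leqW (leqnSn k.+1).
case: se => [[j jk [e0 [e1 e2]]]|[e0 [e1 e2]]|[e0 [e1 e2]]|[e0 [e1 e2]]];
case: sf => [[j' jk' [f0 [f1 f2]]]|[f0 [f1 f2]]|[f0 [f1 f2]]|[f0 [f1 f2]]]; subst e f; try by case: nef.
- case: (ltngtP j j') => jj; [exact: ff jj _ _ _|exact: ff jj _ _ _|by case: nef; rewrite jj].
- exact: (zp _ _ _ k2 rim1).
- by exfalso; move: h0; rewrite -f1 e1 ltxx.
- exact: (zp _ _ _ _ rim0).
- exact: (zp _ _ _ k2 rim1).
- exact: (zp _ _ _ _ rim2).
- by exfalso; move: w0; rewrite -oppr_lt0 -e1 f1 ltxx.
- by exfalso; move: h0; rewrite -e1 f1 ltxx.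
- exact: (zp _ _ _ _ rim2).
- exact: (zp _ _ _ _ rim3).
- exact: (zp _ _ _ _ rim0).
- by exfalso; move: w0; rewrite -oppr_lt0 -f1 e1 ltxx.
- exact: (zp _ _ _ _ rim3).
Qed.

Lemma rimE m : (m <= k.+3)%N -> [\/ (m <= k.+1)%N /\ rim m = (- (2 * m%:R), 0),
    m = k.+2 /\ rim m = (- width, height) | m = k.+3 /\ rim m = (0, height)].
Proof.
move=> hm; case: (leqP m k.+1) => h; first by constructor 1; rewrite rim_wp // wpE.
case: (eqVneq m k.+2) => [->|ne]; first by constructor 2; rewrite rim2.
have -> : m = k.+3 by nlia.
by constructor 3; rewrite rim3.
Qed.

Lemma rim_inj j j' : (j <= k.+3)%N -> (j' <= k.+3)%N -> rim j = rim j' -> j = j'.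
Proof.
have [w0 h0] := sizes.
move=> /rimE h /rimE h' e.
case: h => -[hj ej]; case: h' => -[hj' ej']; rewrite ej ej' in e;
  have e1 := congr1 fst e; have e2 := congr1 snd e; rewrite /= in e1 e2.
- by have /eqP : j%:R = j'%:R :> R by [lra]; rewrite eqr_nat => /eqP.
- by exfalso; lra.
- by exfalso; lra.
- by exfalso; lra.
- by rewrite hj hj'.
- by exfalso; lra.
- by exfalso; lra.
- by exfalso; lra.
- by rewrite hj hj'.
Qed.

Lemma rim_vertex e j : e \in rims -> (j <= k.+3)%N -> seg (rim e.1) (rim e.2) (rim j) -> j = e.1 \/ j = e.2.
Proof.
have [w0 h0] := sizes.
move=> he hj /(rim_seg he).
case: (rimE hj) => -[h ->].
- case=> [[j' jk' [-> /= [_ /andP[e1 e2]]]]|[-> /= [e1 _]]|[-> /= [e1 _]]|[-> /= [e1 _]]].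
  + have j1 : (j <= j'.+1)%N by rewrite -(ler_nat R) -natr1; lra.
    have j2 : (j' <= j)%N by rewrite -(ler_nat R); lra.
    by case: (ltngtP j j') => ?; [nlia|right; nlia|left].
  + left; apply/eqP; rewrite -(eqr_nat R) -natr1; apply/eqP; move: e1; rewrite widthE; lra.
  + by exfalso; lra.
  + left; apply/eqP; rewrite -(eqr_nat R); apply/eqP; lra.
- case=> [[j' jk' [-> /= [e1 _]]]|[-> _]|[-> _]|[-> /= [e1 _]]]; rewrite ?h /=; try by [left|right].
    by exfalso; lra.
  by exfalso; lra.
- case=> [[j' jk' [-> /= [e1 _]]]|[-> /= [e1 _]]|[-> _]|[-> _]]; rewrite ?h /=; try by [left|right].
    by exfalso; lra.
  by exfalso; lra.
Qed.

Definition affine (m : pt -> R) := forall x y t, m (lerp x y t) = (1 - t) * m x + t * m y.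

(** The point [x] moves towards [y] just until it enters the half plane; convexity keeps it in any
    half plane that contains both [x] and [y]. *)
Lemma clip_halfplane (m : pt -> R) x y : affine m -> 0 < m y -> exists x', [/\ seg x y x', 0 <= m x',
  x' = x \/ m x' = 0 & forall m' : pt -> R, affine m' -> 0 < m' y -> 0 <= m' x -> 0 <= m' x'].
Proof.
move=> am my; have [mx|mx] := lerP 0 (m x).
  by exists x; split=> //; [exact: seg_l | left].
pose t := - m x / (m y - m x).
have ht : 0 <= t <= 1 by rewrite /t ler_pdivlMr ?ler_pdivrMr; lra.
have mt : m (lerp x y t) = 0 by rewrite am /t; field; rewrite gt_eqF //; lra.
exists (lerp x y t); rewrite mt; split=> //; [exact: seg_lerp | by right |].
by move=> m' am' my' mx'; rewrite am'; nra.
Qed.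

(** Clipping at the four walls in turn leads into the closed room, and the last clip that moves the
    point leaves it on a wall. *)
Lemma exit x y : inside y -> ~ inside x ->
  exists z e, [/\ seg x y z, e \in rims & seg (rim e.1) (rim e.2) z].
Proof.
move=> [/andP[y1 y2] /andP[y3 y4]] nx.
have a1 : affine (fun p => p.1 + width) by move=> u v t; rewrite /lerp /=; ring.
have a2 : affine (fun p => - p.1) by move=> u v t; rewrite /lerp /=; ring.
have a3 : affine (fun p => p.2) by move=> u v t; rewrite /lerp /=; ring.
have a4 : affine (fun p => height - p.2) by move=> u v t; rewrite /lerp /=; ring.
have b1 : 0 < y.1 + width by lra.
have b2 : 0 < - y.1 by lra.
have b4 : 0 < height - y.2 by lra.
have [x1 [s1 c1 d1 _]] := clip_halfplane x a1 b1.
have [x2 [s2 c2 d2 h2]] := clip_halfplane x1 a2 b2.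
have [x3 [s3 c3 d3 h3]] := clip_halfplane x2 a3 y3.
have [x4 [s4 c4 d4 h4]] := clip_halfplane x3 a4 b4.
have c14 := h4 _ a1 b1 (h3 _ a1 b1 (h2 _ a1 b1 c1)).
have c24 := h4 _ a2 b2 (h3 _ a2 b2 c2).
have c34 := h4 _ a3 y3 c3.
have n4 : ~ inside x4.
  case: d4 => [e4|e4]; last by move=> [_ /andP[_ ?]]; lra.
  rewrite e4; case: d3 => [e3|e3]; last by move=> [_ /andP[? _]]; lra.
  rewrite e3; case: d2 => [e2|e2]; last by move=> [/andP[_ ?] _]; lra.
  by rewrite e2; case: d1 => [->//|e1]; move=> [/andP[? _] _]; lra.
have [e he hz] := @rim_cover x4 ltac:(lra) ltac:(lra) n4.
exists x4, e; split=> //.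
have i1 := seg_sub s1 (@seg_r _ x y); have i2 := seg_sub s2 (@seg_r _ x1 y).
have i3 := seg_sub s3 (@seg_r _ x2 y).
by apply: i1; apply: i2; apply: i3.
Qed.
End Rim.

(** * Pendant edges and positions of all vertices *)

Section Pendants.
Variables (R : realType) (k : nat).
Local Notation pt := (R * R)%type.
Implicit Types (x y z p : pt) (a j l m : nat).
Local Notation wp := (@wp R).
Local Notation inside := (@inside R k).
Local Notation rim := (@rim R k).
Local Notation rims := (rims k).

Lemma simple_head (s : seq pt) a : simple_polyline s -> (0 < a)%N -> (a.+1 < size s)%N ->
  ~ seg (nth (0, 0) s a) (nth (0, 0) s a.+1) (nth (0, 0) s 0).
Proof.
move=> [_ [ne dis]] a0 ha wa; have [d1 d2] := dis 0%N a a0 ha; move: d1 d2 => /=.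
have w0 : seg (nth (0, 0) s 0) (nth (0, 0) s 1) (nth (0, 0) s 0) by exact: seg_l.
case: (eqVneq a 1%N) => [e|a1] d1 d2.
  have h := ne 0%N ltac:(nlia); move: (d1 e) => /seteqP[/(_ (nth (0, 0) s 0)) h' _].
  by move: h; rewrite (h' (conj w0 wa)) e eqxx.
by move: (d2 ltac:(nlia)) => /seteqP[/(_ (nth (0, 0) s 0)) h' _]; case: (h' (conj w0 wa)).
Qed.

Lemma seg_wp_inside l p z : (1 <= l <= k)%N -> inside p -> seg (wp l) p z -> z = wp l \/ inside z.
Proof.
move=> hl [/andP[a1 a2] /andP[a3 a4]] [s [hs ->]].
have [s0|s0] := eqVneq s 0.
  by left; rewrite s0 subr0 !mul1r !mul0r !addr0 -surjective_pairing.
have sp : 0 < s by rewrite lt_def s0; case/andP: hs.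
have l1 : 1 <= l%:R :> R by apply: (natrR R (m := 1)); nlia.
have lk : l%:R <= k%:R :> R by apply: natrR; nlia.
right; rewrite wpE /inside /=; rewrite widthE in a1 *; rewrite heightE in a4 *.
split; apply/andP; split; [by apply: conv_lt => //; lra|by apply: conv_gt => //; lra| |].
  by rewrite mulr0 add0r; exact: mulr_gt0.
by apply: conv_gt => //; lra.
Qed.

(** Traced back from [v], the first segment to leave the room would meet the rim, which is allowed
    only at the foot; but a simple path does not return to its foot. *)
Lemma confined l (s : seq pt) v : (1 <= l <= k)%N -> inside v -> simple_polyline (wp l :: rcons s v) ->
  (forall e z, e \in rims -> seg (rim e.1) (rim e.2) z -> polyline (wp l :: rcons s v) z -> z = wp l) ->
  forall z, polyline (wp l :: rcons s v) z -> z = wp l \/ inside z.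
Proof.
set Q := wp l :: rcons s v => hl vin sQ out.
have szQ : size Q = (size s).+2 by rewrite /= size_rcons.
have qin a : (a <= size s)%N -> inside (nth (0, 0) Q ((size s).+1 - a)).
  elim: a => [_|a IH ha]; first by rewrite subn0 /= nth_rcons ltnn eqxx.
  have {}IH := IH (ltnW ha).
  apply: contrapT => /(exit IH) [z [e [sz he ez]]].
  have hS : (((size s).+1 - a.+1).+1 = (size s).+1 - a)%N by nlia.
  rewrite -hS in sz.
  have zQ : polyline Q z by exists ((size s).+1 - a.+1)%N; split=> //; rewrite szQ; nlia.
  rewrite (out _ _ he ez zQ) in sz.
  by apply: (simple_head sQ _ _ sz); rewrite ?szQ; nlia.
have qin' a : (0 < a < size Q)%N -> inside (nth (0, 0) Q a).
  move=> ha; rewrite szQ in ha; have := qin ((size s).+1 - a)%N ltac:(nlia).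
  by rewrite subKn //; nlia.
move=> z [a [ha hz]]; case: (posnP a) => [a0|a0].
  by rewrite a0 in ha hz; apply: (seg_wp_inside hl _ hz); apply: qin'.
by right; apply: inside_seg hz; apply: qin'; nlia.
Qed.

(** What planarity means for the first [i] pendant edges once the rim is drawn straight. *)
Record pendants (V : nat -> pt) (i : nat) (pl : nat -> seq pt) : Prop := Pend {
  pd_simple : forall l, (1 <= l <= i)%N -> simple_polyline (pl l);
  pd_shape : forall l, (1 <= l <= i)%N -> exists s, pl l = wp l :: rcons s (V l);
  pd_in : forall l z, (1 <= l <= i)%N -> polyline (pl l) z -> z = wp l \/ inside z;
  pd_dis : forall l m z, (1 <= l <= i)%N -> (1 <= m <= i)%N -> l != m ->
    polyline (pl l) z -> ~ polyline (pl m) z;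
  pd_V : forall l m, (1 <= l <= i)%N -> (1 <= m <= k)%N -> l != m -> ~ polyline (pl l) (V m)
}.

(** Vertices beyond the [2 * k + 4] of the construction are isolated and lie to the right of the
    room, so that every large number of vertices occurs. *)
Definition place (V : nat -> pt) j : pt :=
  if (j <= k.+3)%N then rim j else if (j <= k.+3 + k)%N then V (j - k.+3)%N else (j%:R, 0).

Lemma place_rim V j : (j <= k.+3)%N -> place V j = rim j.
Proof. by rewrite /place => ->. Qed.

Lemma place_V V l : (1 <= l <= k)%N -> place V (k.+3 + l) = V l.
Proof.
move=> hl; rewrite /place ifF; last by apply/negbTE; nlia.
by rewrite leq_add2l (proj2 (andP hl)) addKn.
Qed.

Lemma placeP V j : [\/ (j <= k.+3)%N /\ place V j = rim j,
  exists2 l, (1 <= l <= k)%N & j = (k.+3 + l)%N /\ place V j = V l |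
  (k.+3 + k < j)%N /\ place V j = (j%:R, 0)].
Proof.
case: (leqP j k.+3) => h1; first by constructor 1; rewrite place_rim.
case: (leqP j (k.+3 + k)) => h2; last first.
  by constructor 3; split=> //; rewrite /place !ifF //; apply/negbTE; rewrite -ltnNge //; nlia.
constructor 2; exists (j - k.+3)%N; first by nlia.
have e : j = (k.+3 + (j - k.+3))%N by nlia.
by split=> //; rewrite [in LHS]e place_V //; nlia.
Qed.

Lemma rim_outj j : (j <= k.+3)%N -> ~ inside (rim j) /\ (rim j).1 <= 0.
Proof.
move=> hj; case: (ltngtP j k.+3) => [lt||e]; [|by rewrite ltnNge hj|].
  by apply: (rim_out (rims_mem lt)); exact: seg_l.
by rewrite e; apply: (rim_out (rims_mem0 k)); exact: seg_r.
Qed.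

Section Placement.
Variable V : nat -> pt.
Hypothesis Vin : forall l, (1 <= l <= k)%N -> inside (V l).
Hypothesis Vinj : forall l m, (1 <= l <= k)%N -> (1 <= m <= k)%N -> V l = V m -> l = m.

Lemma place_inj j j' : place V j = place V j' -> j = j'.
Proof.
have neg (u : nat) : (k.+3 + k < u)%N -> 0 < u%:R :> R by move=> h; rewrite ltr0n; nlia.
have x0 l : (1 <= l <= k)%N -> (V l).1 < 0 by move=> /Vin[/andP[]].
case: (placeP V j) => [[h ->]|[l hl [-> ->]]|[h ->]]; case: (placeP V j') => [[h' ->]|[l' hl' [-> ->]]|[h' ->]] e.
- exact: (@rim_inj R k).
- by exfalso; apply: (rim_outj h).1; rewrite e; exact: Vin.
- by exfalso; have := (rim_outj h).2; rewrite e /= leNgt neg.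
- by exfalso; apply: (rim_outj h').1; rewrite -e; exact: Vin.
- by rewrite (Vinj hl hl' e).
- by exfalso; have := x0 _ hl; rewrite e /=; have := neg _ h'; lra.
- by exfalso; have := (rim_outj h').2; rewrite -e /= leNgt neg.
- by exfalso; have := x0 _ hl'; rewrite -e /=; have := neg _ h; lra.
- by move/(congr1 fst): e => /= /eqP; rewrite eqr_nat => /eqP.
Qed.

Lemma place_on_rim e j : e \in rims -> seg (rim e.1) (rim e.2) (place V j) -> j = e.1 \/ j = e.2.
Proof.
move=> he; case: (placeP V j) => [[h ->]|[l hl [_ ->]]|[h ->]] hz.
- exact: rim_vertex hz.
- by exfalso; apply: (rim_out he hz).1; exact: Vin.
- by exfalso; have := (rim_out he hz).2 => /=; rewrite leNgt ltr0n; nlia.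
Qed.

Lemma place_inside j : inside (place V j) -> exists2 l, (1 <= l <= k)%N & j = (k.+3 + l)%N.
Proof.
case: (placeP V j) => [[h ->]|[l hl [-> _]]|[h ->]].
- by move/(rim_outj h).1.
- by exists l.
- by move=> [_]; rewrite /= ltxx.
Qed.

Lemma place_wp j l : (l <= k.+1)%N -> place V j = wp l -> j = l.
Proof.
by move=> hl e; apply: place_inj; rewrite e place_rim ?rim_wp //; nlia.
Qed.

End Placement.
End Pendants.

(** * Restricting drawings to fewer edges *)

Section Subdrawing.
Variables (R : realType) (n : nat).
Implicit Types (E : seq (edge n)) (b : edge n -> seq (R * R)).

Lemma valid_sub pos0 b0 pos E E' b : {subset E' <= E} ->
  valid_partial pos0 b0 pos E b -> valid_partial (R := R) pos0 b0 pos E' b.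
Proof.
move=> sE [[inj [h1 [h2 h3]]] [h [ih [hv he]]]]; split; last first.
  by exists h; split=> //; split=> // e /sE; exact: he.
split=> //; split; first by move=> e /sE; exact: h1.
split; first by move=> e v /sE; exact: h2.
by move=> e f /sE ee /sE ff; exact: h3.
Qed.

Lemma planar_eq pos E b b' : {in E, b =1 b'} -> planar_drawing pos E b -> planar_drawing (R := R) pos E b'.
Proof.
move=> eb [inj [h1 [h2 h3]]].
have ep e : e \in E -> edge_pts pos b e = edge_pts pos b' e by move=> he; rewrite /edge_pts eb.
have ec e : e \in E -> curve pos b e = curve pos b' e by move=> he; rewrite /curve ep.
split=> //; split; first by move=> e he; rewrite -ep //; exact: h1.
split; first by move=> e v he; rewrite -ec //; exact: h2.
by move=> e f he hf; rewrite -!ec //; exact: h3.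
Qed.

Lemma valid_eq pos0 b0 pos E b b' : {in E, b =1 b'} ->
  valid_partial pos0 b0 pos E b -> valid_partial (R := R) pos0 b0 pos E b'.
Proof.
move=> eb [pl [h [ih [hv he]]]]; split; first exact: planar_eq pl.
exists h; split=> //; split=> // e eE; rewrite he //.
by rewrite /curve /edge_pts eb.
Qed.
End Subdrawing.

(** * The plane graph, planarity, and respect for the embedding *)

Section Drawing.
Variables (R : realType) (k N : nat).
Hypothesis kN : (k.+3 + k < N.+1)%N.
Local Notation pt := (R * R)%type.
Local Notation n := N.+1.
Implicit Types (x y z p : pt) (a j l m i : nat).
Local Notation wp := (@wp R).
Local Notation vp := (@vp R k).
Local Notation vp0 := (@vp0 R).
Local Notation inside := (@inside R k).
Local Notation rim := (@rim R k).
Local Notation rims := (rims k).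

Definition mke (e : nat * nat) : edge n := (inord e.1, inord e.2).
Definition pend l : edge n := mke (l, k.+3 + l)%N.
(** The rim comes first, so the room is closed before any pendant edge is drawn. *)
Definition edges i : seq (edge n) := map mke rims ++ [seq pend l | l <- iota 1 i].
Definition pos (V : nat -> pt) (v : vertex n) : pt := place k V v.

Lemma rims_lt (e : nat * nat) : e \in rims -> (e.1 < e.2 <= k.+3)%N.
Proof. by move=> /rimsP[[j jk]|||] -> /=; nlia. Qed.

Lemma pos_mke V (e : nat * nat) : (e.1 < e.2 <= k.+3 + k)%N ->
  pos V (mke e).1 = place k V e.1 /\ pos V (mke e).2 = place k V e.2.
Proof.
move=> he; have h1 : (e.1 < N.+1)%N by nlia.
have h2 : (e.2 < N.+1)%N by nlia.
by rewrite /pos /mke /= !inordK.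
Qed.

Lemma pos_rims V (e : nat * nat) : e \in rims -> pos V (mke e).1 = rim e.1 /\ pos V (mke e).2 = rim e.2.
Proof.
move=> /rims_lt he; have [-> ->] := @pos_mke V e ltac:(nlia).
by rewrite !place_rim //; nlia.
Qed.

Lemma pos_pend V l : (1 <= l <= k)%N -> pos V (pend l).1 = wp l /\ pos V (pend l).2 = V l.
Proof.
move=> hl; have [-> ->] := @pos_mke V (l, k.+3 + l)%N ltac:(rewrite /=; nlia).
by rewrite /= place_V // place_rim ?rim_wp //; nlia.
Qed.

Lemma mke_inj (e f : nat * nat) : (e.1 < e.2 <= k.+3 + k)%N -> (f.1 < f.2 <= k.+3 + k)%N -> mke e = mke f -> e = f.
Proof.
have lt (u v : nat) : (u < v <= k.+3 + k)%N -> (u < N.+1)%N /\ (v < N.+1)%N by move=> h; split; nlia.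
move=> /lt[e1 e2] /lt[f1 f2] ef.
have := congr1 (fun g : edge n => nat_of_ord g.1) ef; have := congr1 (fun g : edge n => nat_of_ord g.2) ef.
rewrite /= !inordK // => h2 h1.
by rewrite [e]surjective_pairing [f]surjective_pairing h1 h2.
Qed.

Lemma pend_inj l m : (1 <= l <= k)%N -> (1 <= m <= k)%N -> pend l = pend m -> l = m.
Proof.
move=> hl hm e.
by have [] := @mke_inj (l, k.+3 + l)%N (m, k.+3 + m)%N ltac:(rewrite /=; nlia) ltac:(rewrite /=; nlia) e.
Qed.

Lemma pend_rims l (e : nat * nat) : (1 <= l <= k)%N -> e \in rims -> pend l <> mke e.
Proof.
move=> hl he; have := rims_lt he => h e'.
have e2 := @mke_inj (l, k.+3 + l)%N e ltac:(rewrite /=; nlia) ltac:(nlia) e'.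
by move: h; rewrite -e2 /=; nlia.
Qed.

Lemma edgesP i e : e \in edges i -> (exists2 f : nat * nat, f \in rims & e = mke f) \/
  (exists2 l, (1 <= l <= i)%N & e = pend l).
Proof.
rewrite mem_cat => /orP[/mapP[f hf ->]|/mapP[l]]; first by left; exists f.
by rewrite mem_iota => hl ->; right; exists l => //; nlia.
Qed.

Lemma edges_rims i f : f \in rims -> mke f \in edges i.
Proof. by move=> hf; rewrite mem_cat map_f. Qed.

Lemma edges_pend i l : (1 <= l <= i)%N -> pend l \in edges i.
Proof. by move=> hl; rewrite mem_cat map_f ?orbT // mem_iota; nlia. Qed.

Lemma edge_seq_edges : edge_seq (edges k).
Proof.
split.
  rewrite cat_uniq; apply/and3P; split.
  - rewrite map_inj_in_uniq.
      rewrite rcons_uniq map_inj_uniq ?iota_uniq ?andbT; last by move=> u v [].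
      by apply/mapP => -[j _ []]; nlia.
    by move=> e f /rims_lt he /rims_lt hf; apply: mke_inj; nlia.
  - apply/hasPn => e /mapP[l]; rewrite mem_iota => hl ->; apply/mapP => -[f hf].
    by apply: pend_rims hf; nlia.
  - rewrite map_inj_in_uniq ?iota_uniq // => l m; rewrite !mem_iota => hl hm.
    by apply: pend_inj; nlia.
move=> e /edgesP[[f /rims_lt hf ->]|[l hl ->]].
  by rewrite /mke /= !inordK; nlia.
by rewrite /pend /mke /= !inordK; nlia.
Qed.

Definition straight (b : edge n -> seq pt) := forall e, e \in rims -> b (mke e) = [::].
Definition legs V b l := edge_pts (pos V) b (pend l).

Lemma polyline2 x y : polyline [:: x; y] = seg x y.
Proof. by rewrite polyline_cons polyline1 setU0. Qed.

Lemma simple2 x y : x != y -> simple_polyline [:: x; y].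
Proof. by move=> xy; split=> //; split=> [[|?]//|] [|u] [|[|v]]. Qed.

Lemma curve_rims V b (e : nat * nat) : straight b -> e \in rims ->
  curve (pos V) b (mke e) = seg (rim e.1) (rim e.2).
Proof.
by move=> sb he; rewrite /curve /edge_pts sb //=; have [-> ->] := pos_rims V he; rewrite polyline2.
Qed.

Section Planar.
Variable V : nat -> pt.
Hypothesis Vin : forall l, (1 <= l <= k)%N -> inside (V l).
Hypothesis Vinj : forall l m, (1 <= l <= k)%N -> (1 <= m <= k)%N -> V l = V m -> l = m.

Lemma pos_inj : injective (pos V).
Proof. by move=> u v /(place_inj Vin Vinj) /val_inj. Qed.

Lemma ord_mke (e : nat * nat) (v : vertex n) : (e.1 < e.2 <= k.+3 + k)%N -> val v = e.1 \/ val v = e.2 ->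
  v = (mke e).1 \/ v = (mke e).2.
Proof. by move=> he [h|h]; [left|right]; rewrite /mke /= -h inord_val. Qed.

Lemma pendants_planar i b : (i <= k)%N -> straight b -> pendants k V i (legs V b) ->
  planar_drawing (pos V) (edges i) b.
Proof.
move=> ik sb [p1 p2 p3 p4 p5]; split; first exact: pos_inj.
have lk l : (1 <= l <= i)%N -> (1 <= l <= k)%N by move=> hl; nlia.
split.
  move=> e /edgesP[[f hf ->]|[l hl ->]]; last exact: p1.
  rewrite /edge_pts sb //=; have [-> ->] := pos_rims V hf; apply: simple2.
  by apply/eqP => /rim_inj; have := rims_lt hf => h e'; have := e' ltac:(nlia) ltac:(nlia); nlia.
split.
  move=> e v /edgesP[[f hf ->]|[l hl ->]].
    rewrite curve_rims // => /(place_on_rim Vin hf) h; apply: ord_mke => //.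
    by have := rims_lt hf; nlia.
  have hk := lk _ hl; move=> hz; apply: ord_mke; first by rewrite /=; nlia.
  case: (p3 l _ hl hz) => [e'|hin].
    by left; apply: (place_wp Vin Vinj _ e'); nlia.
  have [m hm em] := place_inside hin.
  right; change (nat_of_ord v = (k.+3 + l)%N); rewrite em; congr (_ + _)%N; apply: contrapT => /eqP ne; apply: (p5 l m hl hm).
    by rewrite eq_sym.
  by rewrite -(place_V V hm) -em.
move=> e f /edgesP[[e' he ->]|[l hl ->]] /edgesP[[f' hf ->]|[m hm ->]] /eqP ne z.
- rewrite !curve_rims // => h1 h2; have ne' : e' != f' by apply/eqP => ef; apply: ne; rewrite ef.
  have [j hj ->] := rim_cross he hf ne' h1 h2.
  by exists (inord j); rewrite /pos inordK ?place_rim //; nlia.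
- rewrite curve_rims // => /(rim_out he)[out _] /(p3 _ _ hm)[->|//].
  by exists (pend m).1; have [-> _] := pos_pend V (lk _ hm).
- rewrite curve_rims // => /(p3 _ _ hl) h /(rim_out hf)[out _]; case: h => [->|//].
  by exists (pend l).1; have [-> _] := pos_pend V (lk _ hl).
- move=> h1 h2; exfalso; apply: (p4 l m z hl hm) => //.
  by apply/eqP => lm; apply: ne; rewrite lm.
Qed.

Lemma planar_pendants i b : (i <= k)%N -> straight b ->
  planar_drawing (pos V) (edges i) b -> pendants k V i (legs V b).
Proof.
move=> ik sb [_ [h1 [h2 h3]]].
have lk l : (1 <= l <= i)%N -> (1 <= l <= k)%N by move=> hl; nlia.
have shape l : (1 <= l <= i)%N -> legs V b l = wp l :: rcons (b (pend l)) (V l).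
  by move=> hl; rewrite /legs /edge_pts; have [-> ->] := pos_pend V (lk _ hl).
have val1 l : (1 <= l <= i)%N -> val (pend l).1 = l /\ val (pend l).2 = (k.+3 + l)%N.
  move=> hl; have [u1 u2] : (l < N.+1)%N /\ (k.+3 + l < N.+1)%N by split; nlia.
  by rewrite /pend /mke /= !inordK.
split.
- by move=> l hl; apply: h1; exact: edges_pend.
- by move=> l hl; exists (b (pend l)); exact: shape.
- move=> l z hl; have sl := h1 _ (edges_pend hl); rewrite -/(legs V b l) shape // in sl.
  rewrite shape //; apply: confined (lk _ hl) (Vin (lk _ hl)) sl _ _ => e y he ey.
  rewrite -shape // => hy.
  have ne : pend l != mke e by apply/eqP; exact: pend_rims (lk _ hl) he.
  have [|v ev] := h3 _ _ (edges_pend hl) (edges_rims i he) ne y hy; first by rewrite curve_rims.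
  rewrite ev in hy ey *; have [p1 p2] := pos_pend V (lk _ hl).
  case: (h2 _ _ (edges_pend hl) hy) => ve; first by rewrite ve p1.
  by exfalso; apply: (rim_out he ey).1; rewrite ve p2; exact: Vin (lk _ hl).
- move=> l m z hl hm lm hz hz'.
  have ne : pend l != pend m.
    by apply/eqP => /(pend_inj (lk _ hl) (lk _ hm)) e; rewrite e eqxx in lm.
  have [v ev] := h3 _ _ (edges_pend hl) (edges_pend hm) ne z hz hz'; rewrite ev in hz hz'.
  have [l1 l2] := val1 _ hl; have [m1 m2] := val1 _ hm.
  move: lm; case: (h2 _ _ (edges_pend hl) hz) => /(congr1 val); rewrite ?l1 ?l2 => e1;
    case: (h2 _ _ (edges_pend hm) hz') => /(congr1 val); rewrite ?m1 ?m2 e1; nlia.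
- move=> l m hl hm lm hz.
  have [_ p2] := pos_pend V hm; rewrite -p2 in hz.
  have [l1 l2] := val1 _ hl.
  have m2 : val (pend m).2 = (k.+3 + m)%N by rewrite /pend /mke /= inordK //; nlia.
  by move: lm; case: (h2 _ _ (edges_pend hl) hz) => /(congr1 val); rewrite m2 ?l1 ?l2; nlia.
Qed.

End Planar.

Definition noBends : edge n -> seq pt := fun=> [::].

Lemma vp0_inside l : (1 <= l <= k)%N -> inside (vp0 l).
Proof.
move=> hl; have l1 : 1 <= l%:R :> R by apply: (natrR R (m := 1)); nlia.
have lk : l%:R <= k%:R :> R by apply: natrR; nlia.
by rewrite vp0E /inside widthE heightE /=; lra.
Qed.

Lemma vp0_inj l m : (1 <= l <= k)%N -> (1 <= m <= k)%N -> vp0 l = vp0 m -> l = m.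
Proof.
move=> _ _; rewrite !vp0E => -[e]; apply/eqP; rewrite -(eqr_nat R); apply/eqP; lra.
Qed.

Lemma vp_inj l m : (1 <= l <= k)%N -> (1 <= m <= k)%N -> vp l = vp m -> l = m.
Proof.
have k0 := @natk0 R k; move=> hl hm.
case: (eqVneq l 1%N) => [->|l1]; case: (eqVneq m 1%N) => [->|m1] //.
- by rewrite vp1 vpE ?gateE; [move=> /(congr1 snd) /= e; exfalso; lra|nlia].
- by rewrite vp1 vpE ?gateE; [move=> /(congr1 snd) /= e; exfalso; lra|nlia].
rewrite !vpE; [|nlia|nlia] => -[e]; apply/eqP; rewrite -(eqr_nat R); apply/eqP; lra.
Qed.

Lemma reference_pendants : pendants k vp0 k (legs vp0 noBends).
Proof.
have shape l : (1 <= l <= k)%N -> legs vp0 noBends l = [:: wp l; vp0 l].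
  by move=> hl; rewrite /legs /edge_pts; have [-> ->] := pos_pend vp0 hl.
have xl l z : (1 <= l <= k)%N -> polyline (legs vp0 noBends l) z -> z.1 = - (2 * l%:R).
  by move=> hl; rewrite shape // polyline2 wpE vp0E => -[t [_ ->]] /=; ring.
split.
- by move=> l hl; rewrite shape //; apply: simple2; rewrite wpE vp0E; apply/eqP => -[]; lra.
- by move=> l hl; exists [::]; rewrite shape.
- move=> l z hl; rewrite shape // polyline2 => hz.
  exact: (seg_wp_inside hl (vp0_inside hl) hz).
- move=> l m z hl hm lm /(xl _ _ hl) e1 /(xl _ _ hm) e2; move/eqP: lm; apply.
  by apply/eqP; rewrite -(eqr_nat R); apply/eqP; lra.
- move=> l m hl hm lm /(xl _ _ hl); rewrite vp0E /= => e1; move/eqP: lm; apply.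
  by apply/eqP; rewrite -(eqr_nat R); apply/eqP; lra.
Qed.

Lemma reference_planar : planar_drawing (pos vp0) (edges k) noBends.
Proof. by apply: pendants_planar reference_pendants => //; [exact: vp0_inside | exact: vp0_inj]. Qed.

(** The map of [iso_reference] leads from this drawing to the reference one; the required isotopy is
    that of its inverse. *)
Lemma pendants_respects i b : (i <= k)%N -> straight b -> pendants k vp i (legs vp b) ->
  respects_embedding (pos vp0) noBends (pos vp) (edges i) b.
Proof.
move=> ik sb [p1 p2 p3 p4 p5].
(* The obstacles are the rim edges and, as degenerate segments, the isolated vertices. *)
pose os := [seq (rim e.1, rim e.2) | e <- rims] ++
  [seq (((j%:R, 0) : pt), ((j%:R, 0) : pt)) | j <- iota (k.+3 + k).+1 N].
have os_out o z : o \in os -> seg o.1 o.2 z -> ~ inside z.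
  rewrite mem_cat => /orP[/mapP[e he ->]|/mapP[j _ ->]] /=; first by move/(rim_out he) => [].
  by move/segxx => -> [_]; rewrite /= ltxx.
have p2' l : (1 <= l <= i)%N -> exists c s, legs vp b l = wp l :: c :: s /\ last c s = vp l.
  move=> /p2[s ->]; case E : (rcons s (vp l)) => [|c s']; first by case: s E.
  by exists c, s'; split=> //; have := last_rcons c s (vp l); rewrite E.
have [f [af fo fv fl]] := iso_reference os_out ik p1 p2' p3 p4 p5.
have [f' [af' ff' f'f]] := amb_inv af; have [h [ih h1]] := amb_isotopy af'.
have fr e z : e \in rims -> seg (rim e.1) (rim e.2) z -> f z = z.
  by move=> he hz; apply: (fo (rim e.1, rim e.2)) => //; rewrite mem_cat; apply/orP; left; apply/mapP; exists e.
exists h; split=> //; rewrite h1; split.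
  move=> v; have -> : pos vp0 v = f (pos vp v); last by rewrite ff'.
  rewrite /pos; case: (placeP k vp v) => [[hv ->]|[l hl [ev ->]]|[hv ->]].
  - rewrite place_rim //; apply: esym; case: (ltngtP (v : nat) k.+3) => [lt||e].
    + by apply: (fr _ _ (rims_mem lt)); exact: seg_l.
    + by rewrite ltnNge hv.
    + by rewrite e; apply: (fr _ _ (rims_mem0 k)); exact: seg_r.
  - by rewrite fv // ev place_V.
  - apply: esym; case: (placeP k vp0 v) => [[hv' _]|[l hl [ev _]]|[_ ->]]; [by nlia|by nlia|].
    apply: (fo (((v : nat)%:R, 0), ((v : nat)%:R, 0))); last exact: seg_l.
    rewrite mem_cat; apply/orP; right; apply/mapP; exists (v : nat) => //.
    by rewrite mem_iota; have := ltn_ord v; nlia.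
have img (B C : set pt) : f @` B = C -> f' @` C = B.
  move=> <-; apply/seteqP; split=> z; first by move=> [_ [y hy <-] <-]; rewrite ff'.
  by move=> hz; exists (f z); [exists z | rewrite ff'].
move=> e /edgesP[[e' he ->]|[l hl ->]]; apply: img.
  rewrite !curve_rims //; apply/seteqP; split=> z; first by move=> [y hy <-]; rewrite (fr _ _ he hy).
  by move=> hz; exists z => //; exact: fr hz.
have hk : (1 <= l <= k)%N by nlia.
rewrite [RHS]/curve /edge_pts /=; have [-> ->] := pos_pend vp0 hk; rewrite polyline2.
exact: fl.
Qed.

Lemma pendants_valid i b : (i <= k)%N -> straight b -> pendants k vp i (legs vp b) ->
  valid_partial (pos vp0) noBends (pos vp) (edges i) b.
Proof.
move=> ik sb pb; split; last exact: pendants_respects.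
by apply: pendants_planar => //; [exact: vp_inside | exact: vp_inj].
Qed.

End Drawing.

(** * Induction along the greedy drawing *)

Section Greedy.
Variables (R : realType) (k N : nat).
Hypotheses (kN : (k.+3 + k < N.+1)%N) (k0 : (0 < k)%N).
Local Notation pt := (R * R)%type.
Local Notation n := N.+1.
Implicit Types (x y z p : pt) (a j l m i : nat).
Local Notation wp := (@wp R).
Local Notation vp := (@vp R k).
Local Notation vp0 := (@vp0 R).
Local Notation inside := (@inside R k).
Local Notation rims := (rims k).
Local Notation mke := (mke N).
Local Notation pend := (pend k N).
Local Notation edges := (edges k N).
Local Notation noBends := (@noBends R N).
Local Notation pos V := (pos (N := N) k V).
Local Notation legs := (@legs R k N vp).

Lemma edgesS i : edges i.+1 = rcons (edges i) (pend i.+1).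
Proof. by rewrite /edges -(addn1 i) iotaD map_cat catA cats1 addn1. Qed.

Lemma edges_split i : (i < k)%N -> exists E2, edges k = edges i ++ pend i.+1 :: E2.
Proof.
move=> ik; exists [seq pend l | l <- iota i.+2 (k - i.+1)].
rewrite -cat_rcons -edgesS /edges -catA -map_cat -iotaD.
by have -> : (i.+1 + (k - i.+1) = k)%N by nlia.
Qed.

Lemma straight_upd (b : edge n -> seq pt) i s : (1 <= i <= k)%N -> straight k b -> straight k (upd_bends b (pend i) s).
Proof.
move=> hi sb e he; rewrite /upd_bends ifF ?sb //; apply/eqP => e'.
exact: (pend_rims kN hi he (esym e')).
Qed.

Lemma legs_upd (b : edge n -> seq pt) i s l : (1 <= i <= k)%N -> (1 <= l <= k)%N ->
  legs (upd_bends b (pend i) s) l = if l == i then wp i :: rcons s (vp i) else legs b l.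
Proof.
move=> hi hl; rewrite /legs /edge_pts /upd_bends; have [-> ->] := pos_pend kN vp hl.
case: (eqVneq l i) => [->|ne]; first by rewrite eqxx.
by rewrite ifF //; apply/eqP => /(pend_inj kN hl hi) e; rewrite e eqxx in ne.
Qed.

Lemma legsE (b : edge n -> seq pt) l : (1 <= l <= k)%N -> legs b l = wp l :: rcons (b (pend l)) (vp l).
Proof. by move=> hl; rewrite /legs /edge_pts; have [-> ->] := pos_pend kN vp hl. Qed.

Lemma last_polyline x s y : polyline (x :: rcons s y) y.
Proof.
case/lastP: s => [|s c]; first by rewrite polyline2; exact: seg_r.
by rewrite -!rcons_cons polyline_rcons; right; exact: seg_r.
Qed.

Lemma pendants_extend (b : edge n -> seq pt) i s : (i < k)%N -> pendants k vp i (legs b) ->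
  simple_polyline (wp i.+1 :: rcons s (vp i.+1)) ->
  (forall z, polyline (wp i.+1 :: rcons s (vp i.+1)) z -> z = wp i.+1 \/ inside z) ->
  (forall l z, (1 <= l <= i)%N -> polyline (legs b l) z -> ~ polyline (wp i.+1 :: rcons s (vp i.+1)) z) ->
  (forall l, (i.+1 < l <= k)%N -> ~ polyline (wp i.+1 :: rcons s (vp i.+1)) (vp l)) ->
  pendants k vp i.+1 (legs (upd_bends b (pend i.+1) s)).
Proof.
move=> ik [p1 p2 p3 p4 p5] q1 q3 q4 q5.
have hi : (1 <= i.+1 <= k)%N by nlia.
have lk l : (1 <= l <= i.+1)%N -> (1 <= l <= k)%N by move=> hl; nlia.
have tip l : (1 <= l <= i)%N -> polyline (legs b l) (vp l).
  by move=> hl; rewrite legsE; [exact: last_polyline | nlia].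
split.
- by move=> l hl; rewrite (legs_upd _ _ hi (lk _ hl)); case: (eqVneq l i.+1) => // ne; apply: p1; nlia.
- move=> l hl; rewrite (legs_upd _ _ hi (lk _ hl)); case: (eqVneq l i.+1) => [->|ne]; first by exists s.
  by apply: p2; nlia.
- move=> l z hl; rewrite (legs_upd _ _ hi (lk _ hl)); case: (eqVneq l i.+1) => [->|ne]; first exact: q3.
  by apply: p3; nlia.
- move=> l m z hl hm lm; rewrite (legs_upd _ _ hi (lk _ hl)) (legs_upd _ _ hi (lk _ hm)).
  case: (eqVneq l i.+1) => [e1|n1]; case: (eqVneq m i.+1) => [e2|n2].
  + by move: lm; rewrite e1 e2 eqxx.
  + by move=> h1 h2; apply: q4 h2 h1; nlia.
  + by apply: q4; nlia.
  + by apply: p4 => //; nlia.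
move=> l m hl hm lm; rewrite (legs_upd _ _ hi (lk _ hl)); case: (eqVneq l i.+1) => [e1|n1]; last by apply: p5 => //; nlia.
case: (ltnP i.+1 m) => h; first by apply: q5; nlia.
have hm' : (1 <= m <= i)%N by nlia.
by apply: q4 (tip _ hm').
Qed.

Variable b : edge n -> seq pt.
Hypothesis gb : greedy_extension (pos vp0) noBends (pos vp) (edges k) b.

(** The straight rim is a valid drawing, so no bend is ever needed. The induction is strong because
    a competitor keeps the earlier rim edges as drawn, and these must be known to be straight. *)
Lemma greedy_straight : straight k b.
Proof.
pose W := map mke rims; pose e0 : edge n := (ord0, ord0).
have no0 : valid_partial (pos vp0) noBends (pos vp) (edges 0) noBends.
  by apply: pendants_valid => //; split=> l *; exfalso; nlia.
have H j : (j < size W)%N -> b (nth e0 W j) = [::].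
  elim/ltn_ind: j => j IH hj.
  have ew : edges k = take j W ++ nth e0 W j :: (drop j.+1 W ++ [seq pend l | l <- iota 1 k]).
    by rewrite -cat_cons -drop_nth // catA cat_take_drop.
  have [_ /(_ [::])] := gb ew; rewrite leqn0 size_eq0 => h; apply/eqP; apply: h.
  have sub : {subset rcons (take j W) (nth e0 W j) <= edges 0}.
    have -> : edges 0 = W by rewrite /edges cats0.
    by move=> f; rewrite -take_nth //; exact: mem_take.
  apply: valid_eq (valid_sub sub no0) => f; rewrite mem_rcons in_cons /upd_bends.
  case: eqVneq => //= ne /(nthP e0)[j']; rewrite size_take hj => hj' <-.
  by rewrite nth_take // IH //; nlia.
move=> e he; have he' : mke e \in W by exact: map_f.
by have := H (index (mke e) W); rewrite nth_index // index_mem => ->.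
Qed.

(** As every planar way to add the pendant edge respects the embedding, minimality can be tested
    against all of them. *)
Lemma greedy_valid i s : (i < k)%N -> pendants k vp i.+1 (legs b) /\
  (pendants k vp i.+1 (legs (upd_bends b (pend i.+1) s)) -> (size (b (pend i.+1)) <= size s)%N).
Proof.
move=> ik; have [E2 eE] := edges_split ik; have [[pl _] mn] := gb eE; rewrite -edgesS in pl mn; split.
  by apply: planar_pendants greedy_straight pl => //; exact: vp_inside.
move=> ps; apply: mn; apply: pendants_valid => //; apply: straight_upd; [nlia|exact: greedy_straight].
Qed.

Lemma greedy_pendants i : (i <= k)%N -> pendants k vp i (legs b).
Proof.
case: i => [|i] hi; first by split=> l *; exfalso; nlia.
by have [] := greedy_valid [::] hi.
Qed.

Lemma arr1 : arr k 1 (fun=> vp 1) (fun=> wp 1).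
Proof.
have kk := @natk0 R k; split=> //.
- by move=> *; rewrite wpE gateE /=; lra.
- by move=> *; rewrite vp1 /=; lra.
- by move=> d d' d0 dd; rewrite expn1; nlia.
- by move=> d d' z d0 dd; rewrite expn1; nlia.
- by move=> *; apply: vp_inside; nlia.
- by move=> d j; rewrite expn1; have := pow2 j; nlia.
- by move=> m hm; have -> : m = 1%N by nlia.
- by move=> m hm; exfalso; nlia.
Qed.

Lemma greedy_first : b (pend 1) = [::].
Proof.
have [_ h] := greedy_valid [::] k0; apply/eqP; rewrite -size_eq0 -leqn0; apply: h.
have h1 : (1 <= 1 <= k)%N by nlia.
have kk := @natk0 R k.
apply: pendants_extend => //=; rewrite ?polyline2.
- by apply: greedy_pendants.
- by apply: simple2; apply/eqP => /(congr1 snd); rewrite vp1 gateE /=; lra.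
- by move=> z; apply: seg_wp_inside => //; exact: vp_inside.
- by move=> l z hl; exfalso; nlia.
(* Only [v_2] is close: it lies vertically below [v_1], whose abscissa the segment attains only at
   its upper end. *)
move=> l /andP[l1 l2]; rewrite vp1 wpE (vpE _ _ l1) gateE => -[t [ht [e1 e2]]].
case: (ltngtP l 2) => [l3|l3|l3]; first by nlia.
  by have := natrR R l3; rewrite -natr1 => h; move: e1 => /=; lra.
rewrite l3 /= in e1; have t1 : t = 1 by lra.
by move: e2; rewrite t1 /=; lra.
Qed.

(** The strands are tied to the drawn edges only as a point set; disjointness from the next edge
    depends on nothing more. *)
Definition state i := exists tp bt : nat -> pt, arr k i tp bt /\
  forall z, (exists2 d, (0 < d < 2 ^ i)%N & seg (bt d) (tp d) z) <->
    (exists2 l, (1 <= l <= i)%N & polyline (legs b l) z).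

(** Both bounds hold for any arrangement satisfying [arr], so they meet on whatever was drawn
    before: edge [i.+1] has exactly [2 ^ i] segments, and this equality is what [tight_path] needs
    to continue. *)
Lemma greedy_state i : (i < k)%N -> state i.+1 /\ size (b (pend i.+1)) = (2 ^ i - 1)%N.
Proof.
elim: i => [|i IH] ik.
  rewrite greedy_first; split=> //; exists (fun=> vp 1), (fun=> wp 1); split; first exact: arr1.
  have h1 : (1 <= 1 <= k)%N by nlia.
  have e1 : polyline (legs b 1) = seg (wp 1) (vp 1) by rewrite legsE // greedy_first polyline2.
  move=> z; split; first by move=> [d _ hz]; exists 1%N; rewrite ?e1.
  by move=> [l hl]; have -> : l = 1%N by [nlia]; rewrite e1 => hz; exists 1%N.
have [[tp [bt [A AE]]] _] := IH (ltnW ik).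
have hk : (1 <= i.+2 <= k)%N by nlia.
have [Q [szQ q1 [s eQ] q3 [q4 q5]]] := new_path_ex A isT ik; subst Q.
have up : (size (b (pend i.+2)) <= size s)%N.
  have [_] := greedy_valid s ik; apply; apply: pendants_extend => //.
    by apply: greedy_pendants; exact: ltnW.
  move=> l z hl hz hq; have [d hd hs] : exists2 d, (0 < d < 2 ^ i.+1)%N & seg (bt d) (tp d) z.
    by apply/AE; exists l.
  exact: q4 hd hq hs.
rewrite /= size_rcons in szQ.
have [p1 _ p3 p4 _] := greedy_pendants ik.
have hi : (1 <= i.+2 <= i.+2)%N by nlia.
have b1 := p1 _ hi; rewrite legsE // in b1.
have b3 z : polyline (wp i.+2 :: rcons (b (pend i.+2)) (vp i.+2)) z -> z = wp i.+2 \/ inside z.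
  by rewrite -legsE //; exact: p3.
have b4 d z : (0 < d < 2 ^ i.+1)%N -> polyline (wp i.+2 :: rcons (b (pend i.+2)) (vp i.+2)) z ->
    ~ seg (bt d) (tp d) z.
  move=> hd; rewrite -legsE // => hz hs.
  have [l hl hz'] : exists2 l, (1 <= l <= i.+1)%N & polyline (legs b l) z by apply/AE; exists d.
  by apply: (p4 _ _ z _ _ _ hz hz'); nlia.
have lw := many_segments A isT ik b3 b4 b1; rewrite /= size_rcons in lw.
have sz : size (wp i.+2 :: rcons (b (pend i.+2)) (vp i.+2)) = (2 ^ i.+1).+1.
  by rewrite /= size_rcons; nlia.
have [tp' [bt' [A' AE']]] := tight_path A isT ik b3 b4 b1 sz.
split; last by move: sz; rewrite /= size_rcons; nlia.
exists tp', bt'; split=> // z; apply: (iff_trans (AE' z)); split.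
  move=> [/AE[l hl hz]|hz]; first by exists l => //; nlia.
  by exists i.+2 => //; rewrite legsE.
move=> [l hl hz]; case: (eqVneq l i.+2) => [e|ne]; first by right; rewrite -legsE // -e.
by left; apply/AE; exists l => //; nlia.
Qed.

End Greedy.

Theorem theorem3 (R : realType) :
  exists c : R, 0 < c /\
  exists n0 : nat, forall n : nat, (n0 <= n)%N ->
    exists (sigma : seq (edge n))                 (* edges of G, in the order sigma *)
           (pos0 : vertex n -> (R * R)%type)
           (b0 : edge n -> seq (R * R)%type)      (* reference drawing: fixes the embedding of G *)
           (pos : vertex n -> (R * R)%type),      (* the drawing H of the empty spanning subgraph *)
      edge_seq sigma /\
      planar_drawing pos0 sigma b0 /\
      injective pos /\
      forall b : edge n -> seq (R * R)%type,
        greedy_extension pos0 b0 pos sigma b ->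
        exists e : edge n, e \in sigma /\
          (2 : R) `^ (c * n%:R) <= (size (b e))%:R.
Proof.
(* The last of the [k] pendant edges has [2 ^ (k - 1) - 1 >= 2 ^ (k - 2)] bends. From
   [n <= 2 * k + 5] and [k >= 8], which [n >= 20] ensures, follows [n / 4 <= k - 2]. *)
exists (1 / 4); split; first by lra.
exists 20%N => -[//|N] hN; pose k := ((N.+1 - 4) %/ 2)%N.
have kN : (k.+3 + k < N.+1)%N by rewrite /k; lia.
have k8 : (8 <= k)%N by rewrite /k; lia.
have kN' : (N.+1 <= 2 * k + 5)%N by rewrite /k; lia.
exists (edges k N k), (pos (N := N) k (@vp0 R)), (@noBends R N), (pos (N := N) k (@vp R k)).
split; first exact: edge_seq_edges.
split; first exact: reference_planar.
split; first by apply: pos_inj; [exact: vp_inside | exact: vp_inj].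
move=> b gb; exists (pend k N k); split; first by apply: edges_pend; lia.
have [_] := greedy_state kN ltac:(lia) gb (i := k.-1) ltac:(lia).
have -> : k.-1.+1 = k by lia.
move=> ->.
apply: (@le_trans _ _ (2 `^ (k - 2)%:R)).
  apply: ler_powR; first by lra.
  have := natrR R kN'; have := natrR R k8; rewrite natrD natrM natrB; last by lia.
  by lra.
rewrite powR_mulrn; last by lra.
rewrite -natrX ler_nat; have -> : k.-1 = (k - 2).+1 by lia.
by rewrite expnS; have := pow2 (k - 2); lia.
Qed.
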